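(* Let $p>3$ be a prime. (i) If $p\equiv 1\pmod 3$ and $x,y$ are integers with $p=x^2+3y^2$, then $$\sum_{k=0}^{p-1}k^3\frac{D_k}{4^k}\equiv-\frac{64}{45}x^2+\frac{32}{45}p+\frac{43p^2}{90x^2}\pmod{p^3},$$ while if $p\equiv 2\pmod 3$ and $p\neq 5$, then $$\sum_{k=0}^{p-1}k^3\frac{D_k}{4^k}\equiv\frac{28}{9}R_3(p)\pmod{p^2}.$$ (ii) If $p\equiv 1\pmod 3$ and $x,y$ are integers with $p=x^2+3y^2$, then $$\sum_{k=0}^{p-1}k^3\frac{D_k}{16^k}\equiv\frac{4}{45}x^2-\frac{2}{45}p+\frac{p^2}{45x^2}\pmod{p^3},$$ while if $p\equiv 2\pmod 3$, then $$\sum_{k=0}^{p-1}k^3\frac{D_k}{16^k}\equiv-\frac{4}{9}R_3(p)\pmod{p^2}.$$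
   Context: The Domb numbers are $D_n=\sum_{k=0}^n\binom{n}{k}^2\binom{2k}{k}\binom{2n-2k}{n-k}$ for integers $n\ge 0$. For a prime $p>3$, $$R_3(p)=\left(1+2p+\frac43(2^{p-1}-1)-\frac32(3^{p-1}-1)\right)\binom{\frac{p-1}{2}}{\lfloor p/6\rfloor}^2.$$ Congruences are between rational numbers: $a\equiv b\pmod{p^n}$ means that $a-b=p^n r/s$ with integers $r,s$ and $p\nmid s$. Every prime $p\equiv1\pmod 3$ can be written as $p=x^2+3y^2$ with integers $x,y$.
   Formalization: In the second half of (ii), for p≡2 (mod 3), the formal theorem also assumes p≠5, because at p=5 the sum is 1399/256≡4 while -(4/9)R_3(5)=356/9≡9 (mod 25), so the stated congruence fails there. *)

(* Defs.v *)
From mathcomp Require Export all_boot all_order all_algebra.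

Local Open Scope ring_scope.

Definition domb (n : nat) : nat :=
  (\sum_(0 <= k < n.+1)
    'C(n, k) ^ 2 * 'C(2 * k, k) * 'C(2 * n - 2 * k, n - k))%N.

(* [s] is automatically nonzero, since every integer divides 0. *)
Definition cong_rat (p n : nat) (a b : rat) : Prop :=
  exists r s : int,
    ~~ (p%:Z %| s)%Z /\ a - b = p%:R ^+ n * r%:~R / s%:~R.

Notation "a ≡ b [rmod p ^ n ]" := (cong_rat p n a b)
  (at level 70, b at level 69, p at level 10, n at level 9) : ring_scope.

(* The subtractions 2^(p-1) - 1 and 3^(p-1) - 1 are in [rat], not truncated. *)
Definition R3 (p : nat) : rat :=
  (1 + 2 * p%:R + 4 / 3 * (2 ^+ p.-1 - 1) - 3 / 2 * (3 ^+ p.-1 - 1))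
  * 'C(p.-1./2, p %/ 6)%:R ^+ 2.

(* Pitfall at [p = 5]: modulo 25, [domb_cube_sum 5 16] = 1399/256 is congruent
   to 4 whereas -4/9 * [R3 5] = 356/9 is congruent to 9. *)
Definition domb_cube_sum (p m : nat) : rat :=
  \sum_(0 <= k < p) k%:R ^+ 3 * (domb k)%:R / m%:R ^+ k.

(* Main.v *)
Require Import Defs.
From mathcomp Require Import finfield.
From mathcomp Require Import ring lra zify.
Set Implicit Arguments.
Unset Strict Implicit.
Unset Printing Implicit Defensive.
Import Order.TTheory GRing.Theory Num.Theory.
Local Open Scope ring_scope.

(** Write e for 0 or 1, s = 2e - 1, and treat the base 4 as e = 0, the base 16
    as e = 1. All congruences live in the ring of p-integral elements of a field.

    Each of the two bases has its own expansion of D_n as a sum over k of a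
    binomial coefficient, depending on n, times C(2k,k)^2 C(3k,k)
    ([dombF_term4], [dombF_term16]); the three expressions satisfy the same
    recurrence. Summing over n < p by the hockey-stick identity turns the sum of
    D_n / M^n into
      sum1 = sum of p t_k / (3k+1),
      t_k = (1/2)_k (1/2 + sp/2)_k (1 + sp/2)_k (1 - sp)_k / k!^4,
    and the sum of n D_n / M^n into a combination of sum1 and the analogous sum2
    with denominators 3k+2. The recurrence of D_n gives an antidifference of
    (k^3 - alpha k - beta) D_k / M^k with a factor k^3, so modulo p^3 the sum
    with weight k^3 is a combination of sum1 and sum2 as well ([cube_sum4],
    [cube_sum16]). The coefficients of that closed form have a denominator
    divisible by 5, which is why p = 5 is an exception.

    Put n = (p-1)/2 and a = 1/2 + ep. For k <= n the term t_k agrees modulo p^2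
    with c_k = (-n)_k (a)_k / (k! (a-n)_k), and the sum of c_k / (b+k) is a
    product, by partial fractions. Because of the prefactor p, the difference
    t_k - c_k matters modulo p^3 only at the index where 3k+r is divisible by
    p; a term with k > n matters only at such an index too. The resulting
    products are computed modulo p^3 through the first two coefficients of their
    p-adic logarithms ([lg]), which are harmonic sums.

    For p = 6m+1 this gives ([sum1_6m1], [sum2_6m1])
      sum1 = w^2 exp(-(2/3) (p h + p^2 d)) mod p^3,
      sum2 = p^2 (2 - 3e) / w^2 mod p^3,
    where w = (1/2)_{2m} / (2m)!, h = H_{3m} and d is the sum of the inverse
    squares up to 2m. The first value is the square of a Jacobi sum J. Indeed,
    over Z/p^3, with the Teichmueller character tau, the quadratic character
    of 1 + t is (1 + tau t)^(n p^2), which is a combination of three powers of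
    1 + tau t with small exponents ([phi_interpolation]); hence J is an explicit
    combination of six binomial coefficients ([jac_coef]), and that equals
    - w exp(-(1/3) (p h + p^2 d)) ([jacobi_value]). On the other hand J and p/J
    are the two Jacobi sums that occur in the integers A_k, the sums over t of
    the quadratic character of 1 + k t^3. These satisfy
    A_1^2 + A_1 A_g + A_g^2 = 3p for a cubic nonresidue g, and A_1 is even, so
    A_1 = 2x up to sign ([jacobi_root]). Thus J + p/J = A_1 modulo p^3, which
    gives J^2 = 4x^2 - 2p - p^2/(4x^2) ([U_sq3]).

    For p = 6m+5 the sum sum1 vanishes modulo p^2 ([sum1_6m5]), as its head has
    a numerator divisible by p, and sum2 is computed to first order: the
    harmonic sums that occur are Fermat quotients of 2 and 3, which are the
    ones in R_3 ([sum2_6m5]). *)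

(** * Domb numbers as hypergeometric sums *)

Ltac nzn := repeat (apply/andP; split);
  by do 3! rewrite -?natrM -?natrD ?natr1; rewrite pnatr_eq0; lia.

Section DombExpansions.

Variable F : numFieldType.

Lemma binr_top (N j : nat) :
  (N.+1%:R - j%:R) * 'C(N.+1, j)%:R = N.+1%:R * 'C(N, j)%:R :> F.
Proof.
have [le_jN|lt_Nj] := leqP j N.
  by rewrite -natrB ?(leqW le_jN) // -!natrM -mul_bin_down.
rewrite (bin_small lt_Nj) mulr0; have [->|ne_j] := eqVneq j N.+1.
  by rewrite subrr mul0r.
by rewrite bin_small ?mulr0 // ltn_neqAle eq_sym ne_j.
Qed.

Lemma binr_bot (N j : nat) :
  j.+1%:R * 'C(N, j.+1)%:R = (N%:R - j%:R) * 'C(N, j)%:R :> F.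
Proof.
have [le_jN|lt_Nj] := leqP j N.
  by rewrite -natrB // -!natrM mul_bin_left.
by rewrite !bin_small ?mulr0 // ltnW.
Qed.

Lemma natrS_neq0 (k : nat) : k%:R + 1 != 0 :> F.
Proof. by rewrite natr1 pnatr_eq0. Qed.

Definition cb (k : nat) : F := 'C(2 * k, k)%:R.
Definition tri (k : nat) : F := 'C(3 * k, k)%:R.

Lemma cbS k : cb k.+1 = (4 * k%:R + 2) / (k%:R + 1) * cb k.
Proof.
rewrite /cb.
have := binr_bot (2 * k.+1) k; have := binr_top (2 * k).+1 k.
have := binr_top (2 * k) k; rewrite (_ : 2 * k.+1 = (2 * k).+2)%N; last by lia.
have n0 := natrS_neq0 k; set c := 'C(2 * k, k)%:R; set c1 := 'C(_.+1, k)%:R.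
set c2 := 'C(_.+2, k)%:R; set c3 := 'C(_.+2, _)%:R => e1 e2 e3.
have -> : c3 = (k%:R + 2) * c2 / (k%:R + 1).
  by apply: (mulfI n0); transitivity (k.+1%:R * c3); [ring | rewrite e3; field].
have -> : (k%:R + 2) * c2 = (2 * k%:R + 2) * c1.
  by transitivity ((2 * k).+2%:R * c1); [rewrite -e2; ring | ring].
have -> : c1 = (2 * k%:R + 1) * c / (k%:R + 1).
  apply: (mulfI n0); transitivity ((2 * k).+1%:R * c); first by rewrite -e1; ring.
  by field.
by field.
Qed.

(** Up to the factor 108^k this is (1/2)_k (1/3)_k (2/3)_k / k!^3. Neither factor
    is so simple alone: the denominator 2k + 1 in [triS] cancels against [cbS]. *)
Definition spo (k : nat) : F := cb k ^+ 2 * tri k.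

Lemma natr_lin_neq0 (a b k : nat) : a%:R * k%:R + b.+1%:R != 0 :> F.
Proof. by rewrite -natrM -natrD addnS pnatr_eq0. Qed.

Lemma triS k : tri k.+1 = 3 * (3 * k%:R + 1) * (3 * k%:R + 2)
   / (2 * (k%:R + 1) * (2 * k%:R + 1)) * tri k.
Proof.
rewrite /tri.
have := binr_bot (3 * k.+1) k; have := binr_top (3 * k).+2 k.
have := binr_top (3 * k).+1 k.
have := binr_top (3 * k) k; rewrite (_ : 3 * k.+1 = (3 * k).+3)%N; last by lia.
have n0 := natrS_neq0 k; have n1 := natr_lin_neq0 2 0 k.
set c := 'C(3 * k, k)%:R; set c1 := 'C(_.+1, k)%:R.
set c2 := 'C(_.+2, k)%:R; set c3 := 'C(_.+3, k)%:R.
set c4 := 'C(_.+3, _)%:R => e1 e2 e3 e4.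
have -> : c4 = (2 * k%:R + 3) * c3 / (k%:R + 1).
  by apply: (mulfI n0); transitivity (k.+1%:R * c4); [ring | rewrite e4; field].
have -> : (2 * k%:R + 3) * c3 = (3 * k%:R + 3) * c2.
  by transitivity ((3 * k).+3%:R * c2); [rewrite -e3; ring | ring].
have -> : c2 = (3 * k%:R + 2) * c1 / (2 * k%:R + 2).
  have n2 : (2 * k%:R + 2 : F) != 0 by exact: (natr_lin_neq0 2 1 k).
  apply: (mulfI n2); transitivity ((3 * k).+2%:R * c1); first by rewrite -e2; ring.
  by field.
have -> : c1 = (3 * k%:R + 1) * c / (2 * k%:R + 1).
  apply: (mulfI n1); transitivity ((3 * k).+1%:R * c); first by rewrite -e1; ring.
  by field.
by have n2 := natr_lin_neq0 2 1 k; field; rewrite n0 n1.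
Qed.

Lemma spoS k : spo k.+1 =
  6 * (2 * k%:R + 1) * (3 * k%:R + 1) * (3 * k%:R + 2) / (k%:R + 1) ^+ 3 * spo k.
Proof.
rewrite /spo cbS triS; have n0 := natrS_neq0 k.
have n1 := natr_lin_neq0 2 0 k.
by field; rewrite n0 n1.
Qed.

(** The three-term recurrence of the Domb numbers; with two initial values it
    identifies the three expressions for them. *)
Definition domb_rec (f : nat -> F) := forall n : nat,
  (n%:R + 2) ^+ 3 * f n.+2
  - 2 * (2 * n%:R + 3) * (5 * n%:R ^+ 2 + 15 * n%:R + 12) * f n.+1
  + 64 * (n%:R + 1) ^+ 3 * f n = 0.

(** Creative telescoping. Each certificate G below is a rational multiple of the
    term f (n+2) k, and so are the terms at n and n+1, with denominators that do not
    vanish; a certificate is then checked as an identity of rational functions. *)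
Lemma zeilberger (f G : nat -> nat -> F) :
  (forall n k, (n%:R + 2) ^+ 3 * f n.+2 k
     - 2 * (2 * n%:R + 3) * (5 * n%:R ^+ 2 + 15 * n%:R + 12) * f n.+1 k
     + 64 * (n%:R + 1) ^+ 3 * f n k = G n k.+1 - G n k) ->
  (forall n k, (n < k)%N -> f n k = 0) ->
  (forall n, G n 0%N = 0) -> (forall n, G n n.+3 = 0) ->
  domb_rec (fun n => \sum_(0 <= k < n.+1) f n k).
Proof.
move=> fG f0 G0 GK n.
have ext N M : (N < M)%N -> \sum_(0 <= k < M) f N k = \sum_(0 <= k < N.+1) f N k.
  move=> lt_NM; rewrite (big_cat_nat (n := N.+1)) //= [X in _ + X]big_nat_cond.
  by rewrite [X in _ + X]big1 ?addr0 // => k /andP[/andP[ltNk _] _]; rewrite f0.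
rewrite -(ext n.+1 n.+3) // -(ext n n.+3) ?ltnS //; last exact: leqW.
rewrite !mulr_sumr -sumrB -big_split /= (eq_bigr _ (fun k _ => fG n k)).
by rewrite telescope_sumr // G0 GK subr0.
Qed.

(** The factor 4^n makes the sum over n of term / 4^n a sum of binomial
    coefficients with a fixed lower index. *)
Definition term4 n k : F := 'C(n + k, 3 * k)%:R * spo k * 4 ^+ n / 16 ^+ k.

(** The step in n is solved for the smaller n: every term of the recurrence is
    then a multiple of the one at n+2, also where the binomial coefficient
    vanishes. *)
Lemma term4_step n k : term4 n k =
  (n%:R + 1 - 2 * k%:R) / (4 * (n%:R + k%:R + 1)) * term4 n.+1 k.
Proof.
have := binr_top (n + k) (3 * k); rewrite /term4 addSn.
have n0 : n%:R + k%:R + 1 != 0 :> F by rewrite -natrD natrS_neq0.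
set c1 := 'C(_.+1, _)%:R; set c := 'C(n + k, _)%:R => e.
have -> : c = (n%:R + 1 - 2 * k%:R) * c1 / (n%:R + k%:R + 1).
  apply: (mulfI n0); transitivity ((n + k).+1%:R * c); first by ring.
  by rewrite -e; field.
by rewrite (exprS 4); field; rewrite n0 expf_neq0 // pnatr_eq0.
Qed.

Lemma term4_next n k : term4 n k.+1 =
  (n%:R + k%:R + 1) * (n%:R - 2 * k%:R) * (n%:R - 2 * k%:R - 1) * (2 * k%:R + 1)
  / (8 * (k%:R + 1) ^+ 4) * term4 n k.
Proof.
rewrite /term4 spoS.
have := binr_bot (n + k.+1) (3 * k).+2; have := binr_bot (n + k.+1) (3 * k).+1.
have := binr_bot (n + k.+1) (3 * k); have := binr_top (n + k) (3 * k).
rewrite addnS (_ : 3 * k.+1 = (3 * k).+3)%N; last by lia.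
set c := 'C(n + k, _)%:R; set c1 := 'C(_, 3 * k)%:R.
set c2 := 'C(_, (3 * k).+1)%:R; set c3 := 'C(_, (3 * k).+2)%:R.
set c4 := 'C(_, (3 * k).+3)%:R => e1 e2 e3 e4.
have n0 := natrS_neq0 k; have n1 := natr_lin_neq0 3 0 k; have n2 := natr_lin_neq0 3 1 k.
have n3 := natr_lin_neq0 3 2 k.
have -> : c4 = (n%:R + k%:R + 1) * (n%:R - 2 * k%:R) * (n%:R - 2 * k%:R - 1) * c
  / ((3 * k%:R + 1) * (3 * k%:R + 2) * (3 * k%:R + 3)).
  apply: (mulfI (mulf_neq0 (mulf_neq0 n1 n2) n3)).
  transitivity ((3 * k%:R + 1) * (3 * k%:R + 2) * ((3 * k).+3%:R * c4)); first by ring.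
  rewrite e4.
  transitivity ((3 * k%:R + 1) * (n%:R - 2 * k%:R - 1) * ((3 * k).+2%:R * c3)); first by ring.
  rewrite e3.
  transitivity ((n%:R - 2 * k%:R) * (n%:R - 2 * k%:R - 1) * ((3 * k).+1%:R * c2)); first by ring.
  rewrite e2.
  transitivity ((n%:R - 2 * k%:R) * (n%:R - 2 * k%:R - 1) * ((n + k).+1%:R * c)); last first.
    by field; rewrite n1 n2 n3.
  by rewrite -e1; ring.
by rewrite (exprS 16); field; rewrite n0 n1 n2 n3 expf_neq0 // pnatr_eq0.
Qed.

Lemma term4_rec : domb_rec (fun n => \sum_(0 <= k < n.+1) term4 n k).
Proof.
pose G n k : F := k%:R ^+ 4 * - (36 * n%:R + 48) * term4 n.+2 k
  / ((n%:R + 2 + k%:R) * (n%:R + 1 + k%:R)).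
apply: (@zeilberger term4 G) => [n k|n k lt_nk|n|n].
- rewrite /G term4_next (term4_step n) (term4_step n.+1).
  have -> : n.+1%:R = n%:R + 1 :> F by ring.
  have -> : n.+2%:R = n%:R + 2 :> F by ring.
  have -> : k.+1%:R = k%:R + 1 :> F by ring.
  by field; nzn.
- by rewrite /term4 bin_small ?mul0r //; lia.
- by rewrite /G expr0n !mul0r.
- by rewrite /G /term4 bin_small ?mul0r ?mulr0 ?mul0r //; lia.
Qed.

Definition term16 n k : F := 'C(n + 2 * k, 3 * k)%:R * spo k * 16 ^+ n / (- 16) ^+ k.

Lemma term16_step n k : term16 n k =
  (n%:R + 1 - k%:R) / (16 * (n%:R + 2 * k%:R + 1)) * term16 n.+1 k.
Proof.
have := binr_top (n + 2 * k) (3 * k); rewrite /term16 addSn.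
have n0 : n%:R + 2 * k%:R + 1 != 0 :> F by nzn.
set c1 := 'C(_.+1, _)%:R; set c := 'C(n + _, _)%:R => e.
have -> : c = (n%:R + 1 - k%:R) * c1 / (n%:R + 2 * k%:R + 1).
  apply: (mulfI n0); transitivity ((n + 2 * k).+1%:R * c); first by ring.
  by rewrite -e; field.
by rewrite (exprS 16); field; rewrite n0 expf_neq0 // oppr_eq0 pnatr_eq0.
Qed.

Lemma term16_next n k : term16 n k.+1 =
  - ((n%:R + 2 * k%:R + 1) * (n%:R + 2 * k%:R + 2) * (n%:R - k%:R) * (2 * k%:R + 1))
  / (8 * (k%:R + 1) ^+ 4) * term16 n k.
Proof.
rewrite /term16 spoS.
have := binr_bot (n + 2 * k.+1) (3 * k).+2; have := binr_bot (n + 2 * k.+1) (3 * k).+1.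
have := binr_bot (n + 2 * k.+1) (3 * k); have := binr_top (n + 2 * k) (3 * k).
have := binr_top (n + 2 * k).+1 (3 * k).
rewrite (_ : n + 2 * k.+1 = (n + 2 * k).+2)%N; last by lia.
rewrite (_ : 3 * k.+1 = (3 * k).+3)%N; last by lia.
set c := 'C(n + 2 * k, _)%:R; set c' := 'C((n + 2 * k).+1, _)%:R; set c1 := 'C(_, 3 * k)%:R.
set c2 := 'C(_, (3 * k).+1)%:R; set c3 := 'C(_, (3 * k).+2)%:R.
set c4 := 'C(_, (3 * k).+3)%:R => e1' e1 e2 e3 e4.
have n0 := natrS_neq0 k; have n1 := natr_lin_neq0 3 0 k; have n2 := natr_lin_neq0 3 1 k.
have n3 := natr_lin_neq0 3 2 k.
have -> : c4 = (n%:R + 2 * k%:R + 1) * (n%:R + 2 * k%:R + 2) * (n%:R - k%:R) * c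
  / ((3 * k%:R + 1) * (3 * k%:R + 2) * (3 * k%:R + 3)).
  apply: (mulfI (mulf_neq0 (mulf_neq0 n1 n2) n3)).
  transitivity ((3 * k%:R + 1) * (3 * k%:R + 2) * ((3 * k).+3%:R * c4)); first by ring.
  rewrite e4.
  transitivity ((3 * k%:R + 1) * (n%:R - k%:R) * ((3 * k).+2%:R * c3)); first by ring.
  rewrite e3.
  transitivity ((n%:R - k%:R) * (n%:R - k%:R + 1) * ((3 * k).+1%:R * c2)); first by ring.
  rewrite e2.
  transitivity ((n%:R - k%:R) * (n%:R + 2 * k%:R + 2) * ((n + 2 * k).+1%:R * c)); last first.
    by field; rewrite n1 n2 n3.
  rewrite -e1.
  transitivity ((n%:R - k%:R) * (n%:R - k%:R + 1) * ((n + 2 * k).+2%:R * c')); last by ring.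
  by rewrite -e1'; ring.
by rewrite (exprS (- 16)); field; rewrite n0 n1 n2 n3 expf_neq0 // oppr_eq0 pnatr_eq0.
Qed.

Lemma term16_rec : domb_rec (fun n => \sum_(0 <= k < n.+1) term16 n k).
Proof.
pose G n k : F := k%:R ^+ 4 * - (9 * n%:R + 15) * term16 n.+2 k
  / ((n%:R + 2 + 2 * k%:R) * (n%:R + 1 + 2 * k%:R)).
apply: (@zeilberger term16 G) => [n k|n k lt_nk|n|n].
- rewrite /G term16_next (term16_step n) (term16_step n.+1).
  have -> : n.+1%:R = n%:R + 1 :> F by ring.
  have -> : n.+2%:R = n%:R + 2 :> F by ring.
  have -> : k.+1%:R = k%:R + 1 :> F by ring.
  by field; nzn.
- by rewrite /term16 bin_small ?mul0r //; lia.
- by rewrite /G expr0n !mul0r.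
- by rewrite /G /term16 bin_small ?mul0r ?mulr0 ?mul0r //; lia.
Qed.

Definition domb_term n k : F := 'C(n, k)%:R ^+ 2 * cb k * cb (n - k).

Lemma odd_neq0 (n k : nat) : 2 * (n%:R - k%:R) + 1 != 0 :> F.
Proof.
have -> : 2 * (n%:R - k%:R) + 1 = (2 * n).+1%:R - (2 * k)%:R :> F by ring.
by rewrite subr_eq0 eqr_nat; lia.
Qed.

Lemma domb_term_step n k : domb_term n k =
  (n%:R + 1 - k%:R) ^+ 3 / (2 * (n%:R + 1) ^+ 2 * (2 * (n%:R - k%:R) + 1)) * domb_term n.+1 k.
Proof.
rewrite /domb_term; have n0 := natrS_neq0 n; have n1 := odd_neq0 n k.
have [le_kn|lt_nk] := leqP k n; last first.
  rewrite bin_small // expr0n !mul0r; have [->|ne] := eqVneq k n.+1.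
    by rewrite (_ : _ + 1 - _ = 0) ?expr0n ?mul0r //; ring.
  by rewrite bin_small ?expr0n ?mul0r ?mulr0 //; lia.
have := binr_top n k; rewrite subSn // (cbS (n - k)) natrB //.
set c := 'C(n, _)%:R; set c1 := 'C(n.+1, _)%:R => e.
have -> : c = (n%:R + 1 - k%:R) * c1 / (n%:R + 1).
  by apply: (mulfI n0); transitivity (n.+1%:R * c); [ring | rewrite -e; field].
have n2 : n%:R - k%:R + 1 != 0 :> F by rewrite -natrB // natrS_neq0.
by field; rewrite n0 n2 n1.
Qed.

Lemma domb_term_next n k : domb_term n k.+1 =
  (n%:R - k%:R) ^+ 3 * (2 * k%:R + 1) / ((k%:R + 1) ^+ 3 * (2 * (n%:R - k%:R) - 1))
  * domb_term n k.
Proof.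
rewrite /domb_term; have n0 := natrS_neq0 k.
have [lt_kn|le_nk] := ltnP k n; last first.
  rewrite bin_small // expr0n !mul0r; have [->|ne] := eqVneq n k.
    by rewrite subrr expr0n ?mul0r.
  by rewrite bin_small ?expr0n ?mul0r ?mulr0 //; lia.
have := binr_bot n k; rewrite -(subnSK lt_kn) !cbS natrB //.
set c := 'C(n, k)%:R; set c1 := 'C(n, k.+1)%:R => e.
have -> : c1 = (n%:R - k%:R) * c / (k%:R + 1).
  by apply: (mulfI n0); transitivity (k.+1%:R * c1); [ring | rewrite e; field].
have n1 : 2 * (n%:R - k%:R) - 1 != 0 :> F.
  by rewrite (_ : _ - 1 = 2 * (n%:R - k.+1%:R) + 1) ?odd_neq0 //; ring.
have n2 : n%:R - (1 + k%:R) + 1 != 0 :> F.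
  by rewrite (_ : _ + 1 = n%:R - k%:R) ?subr_eq0 ?eqr_nat; [lia | ring].
by field; rewrite n0 n1 n2.
Qed.

Lemma domb_term_rec : domb_rec (fun n => \sum_(0 <= k < n.+1) domb_term n k).
Proof.
pose c n k : F := -224 + 296 * k%:R - 120 * k%:R ^+ 2 + 16 * k%:R ^+ 3
  + n%:R * (- 416 + 356 * k%:R - 72 * k%:R ^+ 2) + n%:R ^+ 2 * (-248 + 104 * k%:R)
  - 48 * n%:R ^+ 3.
pose G n k : F := k%:R ^+ 3 * c n k * domb_term n.+2 k
  / (4 * (n%:R + 2) ^+ 2 * (2 * (n%:R - k%:R) + 3)).
apply: (@zeilberger domb_term G) => [n k|n k lt_nk|n|n].
- have n0 := natrS_neq0 n.
  have n2 : n%:R + 2 != 0 :> F by nzn.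
  have o1 := odd_neq0 n k; have o2 := odd_neq0 n.+1 k.
  have e1 : n.+1%:R = n%:R + 1 :> F by ring.
  have e2 : n.+2%:R = n%:R + 2 :> F by ring.
  have e3 : k.+1%:R = k%:R + 1 :> F by ring.
  rewrite /G /c domb_term_next (domb_term_step n k) (domb_term_step n.+1 k) e1 e2 e3.
  have o3 : 2 * (n%:R - k%:R) + 3 != 0 :> F.
    by rewrite (_ : _ + 3 = 2 * (n.+1%:R - k%:R) + 1) //; ring.
  have o4 : 2 * (n%:R - (k%:R + 1)) + 3 != 0 :> F.
    by rewrite (_ : _ + 3 = 2 * (n%:R - k%:R) + 1) //; ring.
  by field; rewrite o3 n2 o4 natrS_neq0.
- by rewrite /domb_term bin_small ?expr0n ?mul0r //; lia.
- by rewrite /G expr0n !mul0r.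
- by rewrite /G /domb_term bin_small ?expr0n ?mul0r ?mulr0 ?mul0r //; lia.
Qed.

Lemma domb_rec_unique (f g : nat -> F) :
  domb_rec f -> domb_rec g -> f 0%N = g 0%N -> f 1%N = g 1%N -> f =1 g.
Proof.
move=> rf rg e0 e1 n; suff [] : f n = g n /\ f n.+1 = g n.+1 by [].
elim: n => [|n [IH1 IH2]] //; split=> //.
have n0 : (n%:R + 2) ^+ 3 != 0 :> F by rewrite expf_neq0 //; nzn.
apply: (mulfI n0); have := rf n; have := rg n; rewrite -IH1 -IH2 => h1 h2.
by apply/eqP; rewrite -subr_eq0 -(subrr 0) -{1}h2 -h1; apply/eqP; ring.
Qed.

Definition dombF (n : nat) : F := (domb n)%:R.

Lemma dombF_sum n : dombF n = \sum_(0 <= k < n.+1) domb_term n k.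
Proof.
rewrite /dombF /domb natr_sum; apply: eq_bigr => k _.
by rewrite /domb_term /cb mulnBr -natrX !natrM.
Qed.

Lemma dombF_rec : domb_rec dombF.
Proof. by move=> n; rewrite !dombF_sum; exact: domb_term_rec. Qed.

Lemma dombF0 : dombF 0 = 1.
Proof. by rewrite /dombF /domb big_nat1. Qed.

Lemma dombF1 : dombF 1 = 4.
Proof. by rewrite /dombF /domb big_nat_recr //= big_nat1. Qed.

Lemma dombF_term4 n : dombF n = \sum_(0 <= k < n.+1) term4 n k.
Proof.
apply: (domb_rec_unique dombF_rec term4_rec) => {n}; rewrite ?big_nat1.
  by rewrite dombF0 /term4 /spo /cb /tri !muln0 !bin0 !expr0; field.
rewrite dombF1 big_nat_recr //= big_nat1 /term4 /spo /cb /tri !muln0 !bin0.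
by rewrite (_ : 'C(1 + 1, 3 * 1) = 0)%N //; field.
Qed.

Lemma dombF_term16 n : dombF n = \sum_(0 <= k < n.+1) term16 n k.
Proof.
apply: (domb_rec_unique dombF_rec term16_rec) => {n}; rewrite ?big_nat1.
  by rewrite dombF0 /term16 /spo /cb /tri !muln0 !bin0 !expr0; field.
rewrite dombF1 big_nat_recr //= big_nat1 /term16 /spo /cb /tri !muln0 !bin0.
rewrite (_ : 'C(1 + 2 * 1, 3 * 1) = 1)%N // (_ : 'C(2 * 1, 1) = 2)%N //.
by rewrite (_ : 'C(3 * 1, 1) = 3)%N //; field.
Qed.

(** The weights 7/3 and 6/5 are the ones for which the weighted sum has a closed
    form with a factor (N+1)^3; at N + 1 = p that factor is p^3. *)
Lemma domb_telescope4 N :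
  \sum_(0 <= k < N.+1) (k%:R ^+ 3 - 7 / 3 * k%:R - 6 / 5) * dombF k / 4 ^+ k
  = N.+1%:R ^+ 3 * ((32 / 45 - 2 / 15 * N.+1%:R) * dombF N.+1
      - 16 * (32 / 45 - 2 / 15 * N.+2%:R) * dombF N) / 4 ^+ N.+1.
Proof.
elim: N => [|N IH]; first by rewrite big_nat1 dombF0 dombF1; field.
rewrite big_nat_recr //= IH; have /eqP := dombF_rec N.
have n0 : N%:R + 2 != 0 :> F by nzn.
rewrite addrAC -addrA addr_eq0 => /eqP e.
have -> : dombF N.+2 = (2 * (2 * N%:R + 3) * (5 * N%:R ^+ 2 + 15 * N%:R + 12) * dombF N.+1
   - 64 * (N%:R + 1) ^+ 3 * dombF N) / (N%:R + 2) ^+ 3.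
  have n3 : (N%:R + 2) ^+ 3 != 0 :> F by rewrite expf_neq0.
  by apply: (mulfI n3); rewrite e; field.
have -> : N.+1%:R = N%:R + 1 :> F by ring.
have -> : N.+2%:R = N%:R + 2 :> F by ring.
have -> : N.+3%:R = N%:R + 3 :> F by ring.
by rewrite !(exprS 4); field; rewrite n0 expf_neq0 // pnatr_eq0.
Qed.

Lemma domb_telescope16 N :
  \sum_(0 <= k < N.+1) (k%:R ^+ 3 - 1 / 3 * k%:R - 2 / 15) * dombF k / 16 ^+ k
  = N.+1%:R ^+ 3 * ((8 / 15 * N.+1%:R - 16 / 45) * dombF N.+1
      - 4 * (8 / 15 * N.+2%:R - 16 / 45) * dombF N) / 16 ^+ N.+1.
Proof.
elim: N => [|N IH]; first by rewrite big_nat1 dombF0 dombF1; field.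
rewrite big_nat_recr //= IH; have /eqP := dombF_rec N.
have n0 : N%:R + 2 != 0 :> F by nzn.
rewrite addrAC -addrA addr_eq0 => /eqP e.
have -> : dombF N.+2 = (2 * (2 * N%:R + 3) * (5 * N%:R ^+ 2 + 15 * N%:R + 12) * dombF N.+1
   - 64 * (N%:R + 1) ^+ 3 * dombF N) / (N%:R + 2) ^+ 3.
  have n3 : (N%:R + 2) ^+ 3 != 0 :> F by rewrite expf_neq0.
  by apply: (mulfI n3); rewrite e; field.
have -> : N.+1%:R = N%:R + 1 :> F by ring.
have -> : N.+2%:R = N%:R + 2 :> F by ring.
have -> : N.+3%:R = N%:R + 3 :> F by ring.
by rewrite !(exprS 16); field; rewrite n0 expf_neq0 // pnatr_eq0.
Qed.

End DombExpansions.

(** * Sums of Domb numbers *)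

Section SumsToHypergeometric.

Variable F : numFieldType.

(** In Pochhammer symbols (1/2)_k (1/2 + sx/2)_k (1 + sx/2)_k (1 - sx)_k / k!^4.
    The sign s is -1 for the base 4 and 1 for the base 16. *)
Definition sum_term (s x : F) (k : nat) : F :=
  \prod_(0 <= i < k) ((i%:R + 1 / 2) * (i%:R + 1 / 2 + s * x / 2)
    * (i%:R + 1 + s * x / 2) * (i%:R + 1 - s * x) / (i%:R + 1) ^+ 4).

Lemma sum_termS s x k : sum_term s x k.+1 = sum_term s x k * ((k%:R + 1 / 2) *
  (k%:R + 1 / 2 + s * x / 2) * (k%:R + 1 + s * x / 2) * (k%:R + 1 - s * x)
  / (k%:R + 1) ^+ 4).
Proof. by rewrite /sum_term big_nat_recr. Qed.

(** The binomial coefficient is what the sum over n < N leaves of [term4]; both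
    bases lead to the same product, with opposite signs of N. *)
Lemma sum_term4 N k : spo F k / 16 ^+ k * 'C(N + k, (3 * k).+1)%:R
  = N%:R / (3 * k%:R + 1) * sum_term (-1) N%:R k.
Proof.
have n1 := natr_lin_neq0 F 3 0; have n2 := natr_lin_neq0 F 3 1.
have n3 := natr_lin_neq0 F 3 2; have n4 := natr_lin_neq0 F 3 3.
have n0 := natrS_neq0 F.
elim: k => [|k IH].
  by rewrite /sum_term big_geq // /spo /cb /tri !muln0 !bin0 addn0 bin1; field.
rewrite sum_termS spoS.
have e1 := binr_bot F (N + k.+1) (3 * k).+1; have e2 := binr_bot F (N + k.+1) (3 * k).+2.
have e3 := binr_bot F (N + k.+1) (3 * k).+3; have e4 := binr_top F (N + k) (3 * k).+1.
rewrite (_ : (3 * k.+1).+1 = (3 * k).+4)%N; last by lia.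
rewrite addnS in e1 e2 e3 *; move: IH e1 e2 e3 e4.
set c := 'C(N + k, _)%:R; set c1 := 'C(_, (3 * k).+1)%:R; set c2 := 'C(_, (3 * k).+2)%:R.
set c3 := 'C(_, (3 * k).+3)%:R; set c4 := 'C(_, (3 * k).+4)%:R => IH e1 e2 e3 e4.
have -> : c4 = (N%:R + k%:R + 1) * (N%:R - 2 * k%:R - 1) * (N%:R - 2 * k%:R - 2) * c
  / ((3 * k%:R + 2) * (3 * k%:R + 3) * (3 * k%:R + 4)).
  apply: (mulfI (mulf_neq0 (mulf_neq0 (n2 k) (n3 k)) (n4 k))).
  transitivity ((3 * k%:R + 2) * (3 * k%:R + 3) * ((3 * k).+4%:R * c4)); first by ring.
  rewrite e3.
  transitivity ((3 * k%:R + 2) * (N%:R - 2 * k%:R - 2) * ((3 * k).+3%:R * c3)); first by ring.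
  rewrite e2.
  transitivity ((N%:R - 2 * k%:R - 1) * (N%:R - 2 * k%:R - 2) * ((3 * k).+2%:R * c2)); first by ring.
  rewrite e1.
  transitivity ((N%:R - 2 * k%:R - 1) * (N%:R - 2 * k%:R - 2) * ((N + k).+1%:R * c)); last first.
    by field; rewrite n2 n3 n4.
  by rewrite -e4; ring.
have -> : k.+1%:R = k%:R + 1 :> F by ring.
transitivity ((spo F k / 16 ^+ k * c) * (3 * k%:R + 1) * (((k%:R + 1 / 2) *
  (k%:R + 1 / 2 + -1 * N%:R / 2) * (k%:R + 1 + -1 * N%:R / 2) * (k%:R + 1 - -1 * N%:R)
  / (k%:R + 1) ^+ 4)) / (3 * k%:R + 4)).
  by rewrite (exprS 16); field; rewrite n0 n2 n3 n4 expf_neq0 // pnatr_eq0.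
rewrite IH (_ : 3 * (k%:R + 1) + 1 = 3 * k%:R + 4); last by ring.
set T := sum_term _ _ _.
by field; rewrite n1 n0 n4.
Qed.

Lemma sum_term16 N k : spo F k / (- 16) ^+ k * 'C(N + 2 * k, (3 * k).+1)%:R
  = N%:R / (3 * k%:R + 1) * sum_term 1 N%:R k.
Proof.
have n1 := natr_lin_neq0 F 3 0; have n2 := natr_lin_neq0 F 3 1.
have n3 := natr_lin_neq0 F 3 2; have n4 := natr_lin_neq0 F 3 3.
have n0 := natrS_neq0 F.
elim: k => [|k IH].
  by rewrite /sum_term big_geq // /spo /cb /tri !muln0 !bin0 addn0 bin1; field.
rewrite sum_termS spoS.
have e1 := binr_bot F (N + 2 * k.+1) (3 * k).+1.
have e2 := binr_bot F (N + 2 * k.+1) (3 * k).+2.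
have e3 := binr_bot F (N + 2 * k.+1) (3 * k).+3.
have e4 := binr_top F (N + 2 * k) (3 * k).+1.
have e5 := binr_top F (N + 2 * k).+1 (3 * k).+1.
rewrite (_ : (3 * k.+1).+1 = (3 * k).+4)%N; last by lia.
rewrite (_ : N + 2 * k.+1 = (N + 2 * k).+2)%N in e1 e2 e3 *; last by lia.
move: IH e1 e2 e3 e4 e5.
set c := 'C(N + 2 * k, _)%:R; set c1 := 'C(_.+2, (3 * k).+1)%:R.
set c2 := 'C(_, (3 * k).+2)%:R; set c0 := 'C((N + 2 * k).+1, _)%:R.
set c3 := 'C(_, (3 * k).+3)%:R; set c4 := 'C(_, (3 * k).+4)%:R => IH e1 e2 e3 e4 e5.
have -> : c4 = (N%:R + 2 * k%:R + 1) * (N%:R + 2 * k%:R + 2) * (N%:R - k%:R - 1) * c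
  / ((3 * k%:R + 2) * (3 * k%:R + 3) * (3 * k%:R + 4)).
  apply: (mulfI (mulf_neq0 (mulf_neq0 (n2 k) (n3 k)) (n4 k))).
  transitivity ((3 * k%:R + 2) * (3 * k%:R + 3) * ((3 * k).+4%:R * c4)); first by ring.
  rewrite e3.
  transitivity ((3 * k%:R + 2) * (N%:R - k%:R - 1) * ((3 * k).+3%:R * c3)); first by ring.
  rewrite e2.
  transitivity ((N%:R - k%:R) * (N%:R - k%:R - 1) * ((3 * k).+2%:R * c2)); first by ring.
  rewrite e1.
  transitivity ((N%:R - k%:R) * (N%:R - k%:R - 1) * (((N + 2 * k).+2%:R - (3 * k).+1%:R) * c1)).
    by ring.
  rewrite e5.
  transitivity ((N%:R + 2 * k%:R + 2) * (N%:R - k%:R - 1) * ((N + 2 * k).+1%:R * c)); last first.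
    by field; rewrite n2 n3 n4.
  by rewrite -e4; ring.
have -> : k.+1%:R = k%:R + 1 :> F by ring.
transitivity ((spo F k / (- 16) ^+ k * c) * (3 * k%:R + 1) * (((k%:R + 1 / 2) *
  (k%:R + 1 / 2 + 1 * N%:R / 2) * (k%:R + 1 + 1 * N%:R / 2) * (k%:R + 1 - 1 * N%:R)
  / (k%:R + 1) ^+ 4)) / (3 * k%:R + 4)).
  by rewrite (exprS (- 16)); field; rewrite n0 n2 n3 n4 expf_neq0 // oppr_eq0 pnatr_eq0.
rewrite IH (_ : 3 * (k%:R + 1) + 1 = 3 * k%:R + 4); last by ring.
set T := sum_term _ _ _.
by field; rewrite n1 n0 n4.
Qed.

Lemma hockey4 N k :
  \sum_(0 <= n < N) 'C(n + k, 3 * k)%:R = 'C(N + k, (3 * k).+1)%:R :> F.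
Proof.
elim: N => [|N IH]; first by rewrite big_geq // bin_small //; lia.
by rewrite big_nat_recr //= IH addSn binS natrD.
Qed.

Lemma hockey16 N k :
  \sum_(0 <= n < N) 'C(n + 2 * k, 3 * k)%:R = 'C(N + 2 * k, (3 * k).+1)%:R :> F.
Proof.
elim: N => [|N IH]; first by rewrite big_geq // bin_small //; lia.
by rewrite big_nat_recr //= IH addSn binS natrD.
Qed.

Lemma hockey4_weighted N k :
  \sum_(0 <= n < N) n%:R * 'C(n + k, 3 * k)%:R
  = ((3 * k%:R + 1) * N%:R - (k%:R + 1)) / (3 * k%:R + 2)
    * 'C(N + k, (3 * k).+1)%:R :> F.
Proof.
have n1 := natr_lin_neq0 F 3 0 k; have n2 := natr_lin_neq0 F 3 1 k.
elim: N => [|N IH]; first by rewrite big_geq // bin_small ?mulr0 //; lia.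
rewrite big_nat_recr //= IH addSn binS natrD.
have := binr_bot F (N + k) (3 * k).
set c := 'C(_, 3 * k)%:R; set c1 := 'C(_, _.+1)%:R => e.
have -> : c1 = (N%:R - 2 * k%:R) * c / (3 * k%:R + 1).
  by apply: (mulfI n1); transitivity ((3 * k).+1%:R * c1); [ring | rewrite e; field].
by field; rewrite n1 n2.
Qed.

Lemma hockey16_weighted N k :
  \sum_(0 <= n < N) n%:R * 'C(n + 2 * k, 3 * k)%:R
  = ((3 * k%:R + 1) * N%:R - (2 * k%:R + 1)) / (3 * k%:R + 2)
    * 'C(N + 2 * k, (3 * k).+1)%:R :> F.
Proof.
have n1 := natr_lin_neq0 F 3 0 k; have n2 := natr_lin_neq0 F 3 1 k.
elim: N => [|N IH]; first by rewrite big_geq // bin_small ?mulr0 //; lia.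
rewrite big_nat_recr //= IH addSn binS natrD.
have := binr_bot F (N + 2 * k) (3 * k).
set c := 'C(_, 3 * k)%:R; set c1 := 'C(_, _.+1)%:R => e.
have -> : c1 = (N%:R - k%:R) * c / (3 * k%:R + 1).
  by apply: (mulfI n1); transitivity ((3 * k).+1%:R * c1); [ring | rewrite e; field].
by field; rewrite n1 n2.
Qed.

Definition sum1 (s : F) N := \sum_(0 <= k < N) N%:R * sum_term s N%:R k / (3 * k%:R + 1).
Definition sum2 (s : F) N := \sum_(0 <= k < N) N%:R * sum_term s N%:R k / (3 * k%:R + 2).

Lemma exchange_triangular (N : nat) (w : nat -> F) (f : nat -> nat -> F) :
  (forall n k, (n < k)%N -> f n k = 0) ->
  \sum_(0 <= n < N) w n * \sum_(0 <= k < n.+1) f n k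
  = \sum_(0 <= k < N) \sum_(0 <= n < N) w n * f n k.
Proof.
move=> f0; rewrite exchange_big /=; apply: eq_big_nat => n /andP[_ lt_nN].
rewrite -mulr_sumr; congr (_ * _).
rewrite (big_cat_nat (n := n.+1) (p := N)) //= [X in _ + X]big_nat_cond.
by rewrite [X in _ + X]big1 ?addr0 // => k /andP[/andP[ltNk _] _]; rewrite f0.
Qed.

Lemma term4_small n k : (n < k)%N -> term4 F n k = 0.
Proof. by move=> lt_nk; rewrite /term4 bin_small ?mul0r //; lia. Qed.

Lemma term16_small n k : (n < k)%N -> term16 F n k = 0.
Proof. by move=> lt_nk; rewrite /term16 bin_small ?mul0r //; lia. Qed.

Lemma domb_sum4 N : \sum_(0 <= n < N) dombF F n / 4 ^+ n = sum1 (-1) N.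
Proof.
under eq_bigr do rewrite dombF_term4 mulrC.
rewrite (exchange_triangular _ _ term4_small); apply: eq_bigr => k _.
transitivity (N%:R / (3 * k%:R + 1) * sum_term (-1) N%:R k); last by rewrite mulrAC.
rewrite -sum_term4 -hockey4 mulr_sumr; apply: eq_bigr => n _; rewrite /term4.
by field; rewrite !expf_neq0 // pnatr_eq0.
Qed.

Lemma domb_sum16 N : \sum_(0 <= n < N) dombF F n / 16 ^+ n = sum1 1 N.
Proof.
under eq_bigr do rewrite dombF_term16 mulrC.
rewrite (exchange_triangular _ _ term16_small); apply: eq_bigr => k _.
transitivity (N%:R / (3 * k%:R + 1) * sum_term 1 N%:R k); last by rewrite mulrAC.
rewrite -sum_term16 -hockey16 mulr_sumr; apply: eq_bigr => n _; rewrite /term16.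
by field; rewrite !expf_neq0 // ?oppr_eq0 pnatr_eq0.
Qed.

Lemma domb_wsum4 N : \sum_(0 <= n < N) n%:R * dombF F n / 4 ^+ n
  = - (2 / 3) * sum1 (-1) N + (N%:R + 1 / 3) * sum2 (-1) N.
Proof.
under eq_bigr do rewrite dombF_term4 mulrAC.
rewrite (exchange_triangular _ _ term4_small) !mulr_sumr -big_split.
apply: eq_bigr => k _ /=.
have n1 := natr_lin_neq0 F 3 0 k; have n2 := natr_lin_neq0 F 3 1 k.
transitivity (((3 * k%:R + 1) * N%:R - (k%:R + 1)) / (3 * k%:R + 2) *
  (N%:R / (3 * k%:R + 1) * sum_term (-1) N%:R k)); last by field; rewrite n1 n2.
rewrite -sum_term4 mulrCA -hockey4_weighted mulr_sumr; apply: eq_bigr => n _.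
by rewrite /term4; field; rewrite !expf_neq0 // pnatr_eq0.
Qed.

Lemma domb_wsum16 N : \sum_(0 <= n < N) n%:R * dombF F n / 16 ^+ n
  = - (1 / 3) * sum1 1 N + (N%:R - 1 / 3) * sum2 1 N.
Proof.
under eq_bigr do rewrite dombF_term16 mulrAC.
rewrite (exchange_triangular _ _ term16_small) !mulr_sumr -big_split.
apply: eq_bigr => k _ /=.
have n1 := natr_lin_neq0 F 3 0 k; have n2 := natr_lin_neq0 F 3 1 k.
transitivity (((3 * k%:R + 1) * N%:R - (2 * k%:R + 1)) / (3 * k%:R + 2) *
  (N%:R / (3 * k%:R + 1) * sum_term 1 N%:R k)); last by field; rewrite n1 n2.
rewrite -sum_term16 mulrCA -hockey16_weighted mulr_sumr; apply: eq_bigr => n _.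
by rewrite /term16; field; rewrite !expf_neq0 // ?oppr_eq0 pnatr_eq0.
Qed.

End SumsToHypergeometric.

(** * p-integral elements and truncated logarithms *)

Section PadicCongruences.

Variables (F : numFieldType) (p : nat).

(** The localisation of Z at p, seen in F. *)
Definition pint (x : F) := exists r s : int, ~~ (p%:Z %| s)%Z /\ x = r%:~R / s%:~R.

Definition cg (n : nat) (x y : F) := exists2 c, pint c & x - y = p%:R ^+ n * c.

Hypothesis p_prime : prime p.

Lemma dvdz_intr_neq0 (s : int) : ~~ (p%:Z %| s)%Z -> s%:~R != 0 :> F.
Proof. by rewrite intr_eq0; apply: contraNneq => ->; rewrite dvdz0. Qed.

Lemma pndvdM (s t : int) : ~~ (p%:Z %| s)%Z -> ~~ (p%:Z %| t)%Z -> ~~ (p%:Z %| s * t)%Z.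
Proof. by rewrite !dvdzE abszM /= Euclid_dvdM // negb_or => -> ->. Qed.

Lemma pint_int (r : int) : pint r%:~R.
Proof.
exists r, 1; rewrite divr1; split=> //.
by rewrite dvdzE /= dvdn1; apply: contraTneq p_prime => ->.
Qed.

Lemma pint_nat (n : nat) : pint n%:R.
Proof. exact: (pint_int n). Qed.

Lemma pint1 : pint 1. Proof. exact: (pint_nat 1). Qed.
Lemma pint0 : pint 0. Proof. exact: (pint_nat 0). Qed.

Lemma pintD x y : pint x -> pint y -> pint (x + y).
Proof.
move=> [r [s [ps ->]]] [r' [s' [ps' ->]]]; exists (r * s' + r' * s), (s * s').
split; first exact: pndvdM.
rewrite rmorphD !rmorphM /=; have := dvdz_intr_neq0 ps; have := dvdz_intr_neq0 ps'.
by move=> h h'; field; rewrite h h'.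
Qed.

Lemma pintM x y : pint x -> pint y -> pint (x * y).
Proof.
move=> [r [s [ps ->]]] [r' [s' [ps' ->]]]; exists (r * r'), (s * s').
split; first exact: pndvdM.
by rewrite !rmorphM /= mulf_div.
Qed.

Lemma pintN x : pint x -> pint (- x).
Proof. by move=> [r [s [ps ->]]]; exists (- r), s; rewrite rmorphN mulNr. Qed.

Lemma pintX x n : pint x -> pint (x ^+ n).
Proof. by move=> px; elim: n => [|n IH]; rewrite ?expr0 ?exprS; [exact: pint1|exact: pintM]. Qed.

Lemma pint_sum (f : nat -> F) m n :
  (forall i, (m <= i < n)%N -> pint (f i)) -> pint (\sum_(m <= i < n) f i).
Proof.
move=> pf; rewrite big_nat_cond; apply: big_ind => [||i /andP[mi _]].
- exact: pint0.
- exact: pintD.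
- exact: pf.
Qed.

Lemma pint_prod (f : nat -> F) m n :
  (forall i, (m <= i < n)%N -> pint (f i)) -> pint (\prod_(m <= i < n) f i).
Proof.
move=> pf; rewrite big_nat_cond; apply: big_ind => [||i /andP[mi _]].
- exact: pint1.
- exact: pintM.
- exact: pf.
Qed.

Lemma pintV_int (s : int) : ~~ (p%:Z %| s)%Z -> pint (s%:~R^-1).
Proof. by move=> ps; exists 1, s; rewrite mul1r. Qed.

Lemma pintV_nat (k : nat) : ~~ (p %| k)%N -> pint (k%:R^-1).
Proof. by move=> pk; apply: (@pintV_int k); rewrite dvdzE. Qed.

Lemma pintV_small (k : nat) : (0 < k < p)%N -> pint (k%:R^-1).
Proof. by move=> /andP[k0 kp]; apply: pintV_nat; rewrite gtnNdvd. Qed.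

Lemma pint_unit1 c : pint c -> 1 + p%:R * c != 0 /\ pint (1 + p%:R * c)^-1.
Proof.
move=> [r [s [ps ->]]]; have s0 := dvdz_intr_neq0 ps.
have pd : ~~ (p%:Z %| s + p%:Z * r)%Z by rewrite rpredDr // dvdz_mulr.
have d0 := dvdz_intr_neq0 pd; rewrite rmorphD rmorphM /= in d0.
have e : 1 + p%:R * (r%:~R / s%:~R) = (s%:~R + p%:R * r%:~R) / s%:~R :> F by field.
rewrite e; split; first by rewrite mulf_neq0 ?invr_neq0.
exists s, (s + p%:Z * r); split=> //.
by rewrite invf_div rmorphD rmorphM.
Qed.

Lemma cg_refl n x : cg n x x.
Proof. by exists 0; [exact: pint0 | rewrite subrr mulr0]. Qed.

Lemma cg_sym n x y : cg n x y -> cg n y x.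
Proof. by move=> [c pc e]; exists (- c); [exact: pintN | rewrite mulrN -e opprB]. Qed.

Lemma cg_trans n x y z : cg n x y -> cg n y z -> cg n x z.
Proof.
move=> [c pc e] [c' pc' e']; exists (c + c'); first exact: pintD.
by rewrite mulrDr -e -e' addrA subrK.
Qed.

Lemma cgD n x y x' y' : cg n x y -> cg n x' y' -> cg n (x + x') (y + y').
Proof.
move=> [c pc e] [c' pc' e']; exists (c + c'); first exact: pintD.
by rewrite mulrDr -e -e' opprD addrACA.
Qed.

Lemma cgN n x y : cg n x y -> cg n (- x) (- y).
Proof. by move=> [c pc e]; exists (- c); [exact: pintN | rewrite mulrN -e opprD]. Qed.

Lemma cgB n x y x' y' : cg n x y -> cg n x' y' -> cg n (x - x') (y - y').
Proof. by move=> h h'; apply: cgD => //; apply: cgN. Qed.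

Lemma cgM n x y x' y' :
  pint x -> pint y' -> cg n x y -> cg n x' y' -> cg n (x * x') (y * y').
Proof.
move=> px py' [c pc e] [c' pc' e']; exists (c * y' + x * c').
  by apply: pintD; apply: pintM.
transitivity ((x - y) * y' + x * (x' - y')); first by ring.
by rewrite e e'; ring.
Qed.

Lemma cgMl n a x y : pint a -> cg n x y -> cg n (a * x) (a * y).
Proof.
move=> pa [c pc e]; exists (a * c); first exact: pintM.
by rewrite -mulrBr e mulrCA.
Qed.

Lemma cgMr n a x y : pint a -> cg n x y -> cg n (x * a) (y * a).
Proof. by rewrite !(mulrC _ a); exact: cgMl. Qed.

Lemma cg_sum n (f g : nat -> F) k l :
  (forall i, (k <= i < l)%N -> cg n (f i) (g i)) ->
  cg n (\sum_(k <= i < l) f i) (\sum_(k <= i < l) g i).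
Proof.
move=> h; rewrite big_nat_cond [X in cg n _ X]big_nat_cond.
apply: (big_ind2 (cg n)) => [||i /andP[ki _]]; first exact: cg_refl.
  exact: cgD.
exact: h.
Qed.

Lemma cg_weak m n x y : (m <= n)%N -> cg n x y -> cg m x y.
Proof.
move=> le_mn [c pc e]; exists (p%:R ^+ (n - m) * c).
  by apply: pintM => //; apply: pintX; exact: pint_nat.
by rewrite mulrA -exprD subnKC.
Qed.

Lemma cg_pint n x y : cg n x y -> pint y -> pint x.
Proof.
move=> [c pc e] py; rewrite -(subrK y x) e; apply: pintD => //.
by apply: pintM => //; apply: pintX; exact: pint_nat.
Qed.

Lemma cg_intro n c x y : pint c -> x = y + p%:R ^+ n * c -> cg n x y.
Proof. by move=> pc ->; exists c; rewrite // addrAC subrr add0r. Qed.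

Lemma cg_eq n x y : x = y -> cg n x y.
Proof. by move=> ->; exact: cg_refl. Qed.

Lemma pnat_neq0 : p%:R != 0 :> F.
Proof. by rewrite pnatr_eq0 -lt0n prime_gt0. Qed.

End PadicCongruences.

Ltac pin_step := first
 [ assumption | apply: pint1 | apply: pint0 | apply: pint_nat | apply: pint_int
 | apply: pintN | apply: pintD | apply: pintX | apply: pintM ]; try assumption.
Ltac pin := repeat pin_step.

Section TruncatedExponential.

Variables (F : numFieldType) (p : nat).
Hypotheses (p_prime : prime p) (p_gt3 : (3 < p)%N).

Local Notation P := (p%:R : F).
Local Notation pint := (pint p).
Local Notation cg := (cg p).

Lemma pint_half : pint (2 : F)^-1.
Proof. by apply: pintV_small => //; lia. Qed.
Lemma pint_third : pint (3 : F)^-1.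
Proof. by apply: pintV_small => //; lia. Qed.
Hint Resolve pint_half pint_third : core.

(** The exponential of p a + p^2 b, without the terms divisible by p^3. *)
Definition texp (a b : F) := 1 + P * a + P ^+ 2 * (a ^+ 2 / 2 + b).

(** Multiplicative bookkeeping modulo p^3: a and b are the coefficients of p and p^2
    in the p-adic logarithm of X. *)
Definition lg (X a b : F) := [/\ pint a, pint b & cg 3 X (texp a b)].

Lemma pint_texp a b : pint a -> pint b -> pint (texp a b).
Proof. by move=> pa pb; rewrite /texp; pin. Qed.

Lemma texpD a b a' b' : pint a -> pint b -> pint a' -> pint b' ->
  cg 3 (texp a b * texp a' b') (texp (a + a') (b + b')).
Proof.
move=> pa pb pa' pb'; set u := a ^+ 2 / 2 + b; set u' := a' ^+ 2 / 2 + b'.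
apply: (@cg_intro _ _ _ (a * u' + a' * u + P * u * u')); first by rewrite /u /u'; pin.
by rewrite /texp -/u -/u' (_ : (a + a') ^+ 2 / 2 + (b + b') = u + u' + a * a');
   rewrite /u /u'; field.
Qed.

Lemma lg_pint X a b : lg X a b -> pint X.
Proof. by move=> [pa pb /cg_pint]; apply=> //; exact: pint_texp. Qed.

Lemma lg_unit X a b : lg X a b -> X != 0 /\ pint X^-1.
Proof.
move=> [pa pb [c pc e]].
have -> : X = 1 + P * (a + P * (a ^+ 2 / 2 + b) + P ^+ 2 * c).
  by rewrite -[X](subrK (texp a b)) e /texp; field.
by apply: pint_unit1 => //; pin.
Qed.

Lemma lgM X a b X' a' b' : lg X a b -> lg X' a' b' -> lg (X * X') (a + a') (b + b').
Proof.
move=> L [pa' pb' h']; have px := lg_pint L; case: L => pa pb h.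
split; [by pin|by pin|].
apply: cg_trans (texpD pa pb pa' pb') => //.
by apply: cgM => //; exact: pint_texp.
Qed.

Lemma lg1 : lg 1 0 0.
Proof. by split; [pin|pin|apply: cg_eq => //; rewrite /texp; field]. Qed.

Lemma lgV X a b : lg X a b -> lg X^-1 (- a) (- b).
Proof.
move=> L; have [X0 pX'] := lg_unit L; case: L => pa pb h; split; [by pin|by pin|].
have h1 : cg 3 (X * texp (- a) (- b)) 1.
  apply: (@cg_trans _ _ p_prime _ _ (texp a b * texp (- a) (- b))).
    by apply: cgMr => //; apply: pint_texp; pin.
  apply: cg_trans (texpD pa pb _ _) _ => //; [by pin|by pin|].
  by apply: cg_eq => //; rewrite /texp !subrr; field.
have := cgMl p_prime pX' h1; rewrite mulr1 mulKf // => ?; exact: cg_sym.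
Qed.

Lemma lg1p c : pint c -> lg (1 + P * c) c (- (c ^+ 2 / 2)).
Proof.
move=> pc; split=> //; first by pin.
by apply: cg_eq => //; rewrite /texp; field.
Qed.

Lemma lg_prod (X a b : nat -> F) k l :
  (forall i, (k <= i < l)%N -> lg (X i) (a i) (b i)) ->
  lg (\prod_(k <= i < l) X i) (\sum_(k <= i < l) a i) (\sum_(k <= i < l) b i).
Proof.
move=> h; rewrite big_nat_cond [\sum_(_ <= i < _) a i]big_nat_cond.
rewrite [\sum_(_ <= i < _) b i]big_nat_cond.
apply: (big_rec3 lg) => [|i a' b' X' /andP[ki _] L]; first exact: lg1.
by apply: lgM => //; exact: h.
Qed.

(** Harmonic sums reduce to one another modulo p^2 with a remainder p g; in a
    logarithm p a + p^2 b that remainder belongs to b. *)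
Lemma lg_shift X a b a' b' g : lg X a b -> pint a' -> pint b' -> pint g ->
  cg 2 a (a' + P * g) -> cg 1 b b' -> lg X a' (b' + g).
Proof.
move=> [pa pb h] pa' pb' pg [c pc e] [d pd f]; split=> //; first by pin.
apply: (cg_trans p_prime h); have -> : a = a' + P * g + P ^+ 2 * c by rewrite -e; ring.
have -> : b = b' + P * d by rewrite -[b](subrK b') f; ring.
apply: (@cg_intro _ _ _ (c + d + a' * g + a' * P * c + P * g ^+ 2 / 2 + P ^+ 2 * g * c
   + P ^+ 3 * c ^+ 2 / 2)); first by pin.
by rewrite /texp; field.
Qed.

Lemma lg_eq X a b X' a' b' : lg X a b -> X = X' -> a = a' -> b = b' -> lg X' a' b'.
Proof. by move=> L <- <- <-. Qed.

Lemma lg_cg2 X a b a' : lg X a b -> pint a' -> cg 1 a a' -> cg 2 X (1 + P * a').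
Proof.
move=> [pa pb [c pc e]] pa' [d pd f].
apply: (@cg_intro _ _ _ (d + (a ^+ 2 / 2 + b) + P * c)); first by pin.
rewrite -[X](subrK (texp a b)) e /texp.
have -> : a = a' + P * d by rewrite -[a](subrK a') f; ring.
by field.
Qed.

End TruncatedExponential.

(** * Partial fractions *)

Ltac fld := field; repeat (apply/andP; split); try assumption.

Section PartialFractions.

Variables (F : numFieldType) (a : F).
Hypothesis a_nonint : forall i j : nat, a + i%:R != j%:R.

(** In Pochhammer symbols (-n)_k (a)_k / (k! (a-n)_k): the residues of the
    rational function of b in [partial_fractions]. *)
Definition pf_term (n k : nat) : F :=
  \prod_(0 <= i < k) ((i%:R - n%:R) * (i%:R + a) / ((i%:R + 1) * (i%:R + a - n%:R))).

Lemma pf_termS n k : pf_term n k.+1 = pf_term n k *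
  ((k%:R - n%:R) * (k%:R + a) / ((k%:R + 1) * (k%:R + a - n%:R))).
Proof. by rewrite /pf_term big_nat_recr. Qed.

Lemma a_neq0 k n : k%:R + a - n%:R != 0.
Proof. by rewrite addrC [k%:R + a]addrC addrC subr_eq0. Qed.

Lemma a_neq0' k n : n%:R - k%:R - a != 0.
Proof.
have -> : n%:R - k%:R - a = - (k%:R + a - n%:R) by ring.
by rewrite oppr_eq0 a_neq0.
Qed.

Lemma pf_termSn n k : (n.+1%:R) * (k%:R + a - n.+1%:R) * pf_term n k
  = (n.+1%:R - k%:R) * (a - n.+1%:R) * pf_term n.+1 k.
Proof.
elim: k => [|k IH]; first by rewrite /pf_term !big_geq //; ring.
rewrite !pf_termS; have h1 := a_neq0 k n; have h2 := a_neq0 k n.+1; have h0 := natrS_neq0 F k.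
have e1 : n.+1%:R = n%:R + 1 :> F by ring.
have e2 : k.+1%:R = k%:R + 1 :> F by ring.
rewrite e1 e2 in IH h2 *.
transitivity ((n%:R + 1) * (k%:R + a - (n%:R + 1)) * pf_term n k *
  ((k%:R - n%:R) * (k%:R + a) / ((k%:R + 1) * (k%:R + a - (n%:R + 1))))).
  by fld.
rewrite IH.
by fld.
Qed.

(** The sum by which the induction step in [partial_fractions] fails to be
    termwise; it has an antidifference, hence vanishes over the full range. *)
Lemma pf_term_gosper n k :
  \sum_(0 <= j < k) pf_term n.+1 j / (n.+1%:R - j%:R - a)
  = k%:R * pf_term n.+1 k / (n.+1%:R * a).
Proof.
have a0 : a != 0 by have := a_neq0 0 0; rewrite add0r subr0.
elim: k => [|k IH]; first by rewrite big_geq // !mul0r.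
rewrite big_nat_recr //= IH pf_termS.
have h1 := a_neq0 k n.+1; have h2 := a_neq0' k n.+1; have h0 := natrS_neq0 F k.
have h3 := natrS_neq0 F n.
have e1 : n.+1%:R = n%:R + 1 :> F by ring.
have e2 : k.+1%:R = k%:R + 1 :> F by ring.
rewrite e1 e2 in h1 h2 *.
by fld.
Qed.

(** By induction on n: the difference of two consecutive cases is a multiple of
    the sum in [pf_term_gosper]. *)
Lemma partial_fractions b n : (forall k : nat, b + k%:R != 0) ->
  \sum_(0 <= k < n.+1) pf_term n k / (b + k%:R)
  = \prod_(0 <= i < n) ((i%:R + 1) * (b + i%:R + 1 - a)
       / ((i%:R + 1 - a) * (b + i%:R + 1))) / b.
Proof.
move=> hb; have b0 : b != 0 by have := hb 0; rewrite addr0.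
elim: n => [|n IH]; first by rewrite big_nat1 big_geq // /pf_term big_geq // addr0.
have c0 m : pf_term m m.+1 = 0 by rewrite pf_termS subrr !mul0r mulr0.
rewrite [X in _ = X / b]big_nat_recr //= mulrAC -IH.
have -> : \sum_(0 <= k < n.+1) pf_term n k / (b + k%:R)
    = \sum_(0 <= k < n.+2) pf_term n k / (b + k%:R).
  by rewrite [RHS]big_nat_recr //= c0 mul0r addr0.
have h1 : n%:R + 1 - a != 0 by have := a_neq0' 0 n.+1; rewrite subr0 -natr1.
have h2 : b + n%:R + 1 != 0 by rewrite -addrA natr1 hb.
apply/eqP; rewrite -subr_eq0; apply/eqP.
transitivity (- a / (b + n%:R + 1) *
   \sum_(0 <= k < n.+2) pf_term n.+1 k / (n.+1%:R - k%:R - a)); last first.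
  by rewrite pf_term_gosper c0 mulr0 mul0r mulr0.
rewrite mulr_suml mulr_sumr -sumrB; apply: eq_bigr => k _.
have h3 := a_neq0 k n.+1; have h4 := a_neq0' k n.+1.
have h5 := natrS_neq0 F n; have h6 := hb k.
have -> : pf_term n k = (n.+1%:R - k%:R) * (a - n.+1%:R) * pf_term n.+1 k
    / (n.+1%:R * (k%:R + a - n.+1%:R)).
  rewrite -pf_termSn; have e1 : n.+1%:R = n%:R + 1 :> F by ring.
  by rewrite e1 in h3 *; field; rewrite h5 h3.
have e1 : n.+1%:R = n%:R + 1 :> F by ring.
rewrite e1 in h3 h4 *.
by fld.
Qed.

(** The same product with its factors listed outwards from the pole -q in both
    directions. If p divides b + q, 2n + 1 and 2a - 1, then modulo p the factors of
    the first product are ((j + 1/2) / (j + 1))^2 and those of the second are 1. *)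
Lemma partial_fractions_at b n q : (forall k : nat, b + k%:R != 0) -> (q <= n)%N ->
  (b + q%:R) * \sum_(0 <= k < n.+1) pf_term n k / (b + k%:R)
  = \prod_(0 <= j < q) ((n%:R - j%:R) * (b + q%:R - j%:R - a)
        / ((n%:R - j%:R - a) * (b + q%:R - j%:R - 1)))
    * \prod_(0 <= j < n - q) ((b + q%:R + j%:R + 1 - a) * (j%:R + 1)
        / ((j%:R + 1 - a) * (b + q%:R + j%:R + 1))).
Proof.
move=> hb le_qn; rewrite (partial_fractions _ hb).
set z := b + q%:R.
have split m (f : nat -> F) : \prod_(0 <= i < m) f i = \prod_(0 <= j < m) f (m - j.+1)%N.
  by rewrite big_nat_rev /= add0n.
have shift (f : nat -> F) : \prod_(q <= i < n) f i = \prod_(0 <= j < n - q) f (q + j)%N.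
  by rewrite -{1}[q]add0n big_addn; apply: eq_bigr => j _; rewrite addnC.
have lowhigh (f : nat -> F) : \prod_(0 <= i < n) f i
    = \prod_(0 <= j < n - q) f j * \prod_(0 <= j < q) f (n - j.+1)%N.
  rewrite (big_cat_nat (n := n - q)) ?leq_subr //=; congr (_ * _).
  rewrite split -{1}[(n - q)%N]add0n big_addn subKn //.
  rewrite [LHS]split [RHS]split; apply: eq_big_nat => j /andP[_ jq]; congr (f _); lia.
have prod4 k l (f g u v : nat -> F) : \prod_(k <= i < l) (f i * g i / (u i * v i))
    = (\prod_(k <= i < l) f i) * (\prod_(k <= i < l) g i)
      / ((\prod_(k <= i < l) u i) * (\prod_(k <= i < l) v i)).
  by rewrite -!big_split -prodfV -big_split.
rewrite !prod4 (lowhigh (fun i => i%:R + 1)) (lowhigh (fun i => i%:R + 1 - a)).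
have cut (f : nat -> F) : \prod_(0 <= i < n) f i
    = \prod_(0 <= j < q) f (q - j.+1)%N * \prod_(0 <= j < n - q) f (q + j)%N.
  by rewrite -split -shift -big_cat_nat.
rewrite (cut (fun i => b + i%:R + 1 - a)) (cut (fun i => b + i%:R + 1)).
have -> : \prod_(0 <= j < q) ((n - j.+1)%:R + 1) = \prod_(0 <= j < q) (n%:R - j%:R) :> F.
  apply: eq_big_nat => j jq; rewrite natrB; [by ring | lia].
have -> : \prod_(0 <= j < q) ((n - j.+1)%:R + 1 - a)
    = \prod_(0 <= j < q) (n%:R - j%:R - a) :> F.
  apply: eq_big_nat => j jq; rewrite natrB; [by ring | lia].
have -> : \prod_(0 <= j < q) (b + (q - j.+1)%:R + 1 - a)
    = \prod_(0 <= j < q) (z - j%:R - a) :> F.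
  by apply: eq_big_nat => j jq; rewrite natrB /z; [ring | lia].
have -> : \prod_(0 <= j < n - q) (b + (q + j)%:R + 1 - a)
    = \prod_(0 <= j < n - q) (z + j%:R + 1 - a) :> F.
  by apply: eq_big_nat => j jq; rewrite natrD /z; ring.
have -> : \prod_(0 <= j < n - q) (b + (q + j)%:R + 1)
    = \prod_(0 <= j < n - q) (z + j%:R + 1) :> F.
  by apply: eq_big_nat => j jq; rewrite natrD /z; ring.
have ez : b * \prod_(0 <= j < q) (b + (q - j.+1)%:R + 1)
    = \prod_(0 <= j < q) (z - j%:R - 1) * z.
  rewrite -(split q (fun i => b + i%:R + 1)).
  transitivity (\prod_(0 <= i < q.+1) (b + i%:R)).
    rewrite big_nat_recl // addr0; congr (_ * _); apply: eq_bigr => i _.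
    by rewrite -natr1 addrA.
  rewrite big_nat_recr //=; congr (_ * _); rewrite split; apply: eq_big_nat => j jq.
  by rewrite natrB /z; [ring | lia].
have b0 : b != 0 by have := hb 0; rewrite addr0.
have z0 : z != 0 by exact: hb.
have nz m (f : nat -> F) : (forall i, (i < m)%N -> f i != 0) ->
    \prod_(0 <= i < m) f i != 0.
  move=> h; rewrite prodf_seq_neq0; apply/allP => i; rewrite mem_index_iota => /andP[_ im].
  exact: h.
have n1 : \prod_(0 <= j < q) (z - j%:R - 1) != 0.
  apply: nz => j jq; rewrite (_ : _ - 1 = b + (q - j.+1)%:R) ?hb //.
  by rewrite natrB /z //; ring.
have n2 : \prod_(0 <= j < n - q) (z + j%:R + 1) != 0.
  by apply: nz => j jq; rewrite (_ : _ + 1 = b + (q + j).+1%:R) ?hb // /z; ring.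
have n3 : \prod_(0 <= j < q) (n%:R - j%:R - a) != 0 by apply: nz => j _; exact: a_neq0'.
have n4 : \prod_(0 <= j < n - q) (j%:R + 1 - a) != 0.
  by apply: nz => j jq; have := a_neq0' 0 j.+1; rewrite subr0 -natr1.
have -> : \prod_(0 <= j < q) (b + (q - j.+1)%:R + 1)
    = \prod_(0 <= j < q) (z - j%:R - 1) * z / b by rewrite -ez mulrC mulKf.
by fld.
Qed.

End PartialFractions.

(** * Harmonic sums modulo powers of p *)

Section Harmonic.

Variables (F : numFieldType).

Definition harm (k : nat) : F := \sum_(0 <= i < k) (i%:R + 1)^-1.
Definition harm2 (k : nat) : F := \sum_(0 <= i < k) (i%:R + 1)^-2.
Definition oddharm (k : nat) : F := \sum_(0 <= i < k) (i%:R + 1 / 2)^-1.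
Definition oddharm2 (k : nat) : F := \sum_(0 <= i < k) (i%:R + 1 / 2)^-2.

Lemma harmS k : harm k.+1 = harm k + (k%:R + 1)^-1.
Proof. by rewrite /harm big_nat_recr. Qed.
Lemma harm2_0 : harm2 0 = 0. Proof. by rewrite /harm2 big_geq. Qed.
Lemma harm2S k : harm2 k.+1 = harm2 k + (k%:R + 1)^-2.
Proof. by rewrite /harm2 big_nat_recr. Qed.

Lemma halfn0 k : k%:R + 1 / 2 != 0 :> F.
Proof.
rewrite (_ : _ + _ = (2 * k).+1%:R / 2); last by field.
by rewrite mulf_neq0 ?invr_neq0 ?pnatr_eq0.
Qed.

Lemma oddharm_split k : oddharm k = 2 * harm (2 * k) - harm k.
Proof.
elim: k => [|k IH]; first by rewrite /oddharm /harm muln0 !big_geq // mulr0 subr0.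
rewrite /oddharm big_nat_recr //= -/(oddharm k) IH mulnS !harmS.
have h := halfn0 k; have h1 := natrS_neq0 F k; have h2 := natrS_neq0 F (2 * k).
have h3 := natrS_neq0 F (2 * k).+1.
have h4 : 2 * k%:R + 1 != 0 :> F by rewrite -natrM.
have h5 : (2 * k).+1%:R + 1 = 2 * (k%:R + 1) :> F by ring.
have h6 : k%:R + 1 / 2 = (2 * k%:R + 1) / 2 :> F by field.
by rewrite h5 h6; fld.
Qed.

Lemma oddharm2_split k : oddharm2 k = 4 * harm2 (2 * k) - harm2 k.
Proof.
elim: k => [|k IH]; first by rewrite /oddharm2 /harm2 muln0 !big_geq // mulr0 subr0.
rewrite /oddharm2 big_nat_recr //= -/(oddharm2 k) IH mulnS !harm2S.
have h := halfn0 k; have h1 := natrS_neq0 F k; have h2 := natrS_neq0 F (2 * k).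
have h3 := natrS_neq0 F (2 * k).+1.
have h4 : 2 * k%:R + 1 != 0 :> F by rewrite -natrM.
have h5 : (2 * k).+1%:R + 1 = 2 * (k%:R + 1) :> F by ring.
have h6 : k%:R + 1 / 2 = (2 * k%:R + 1) / 2 :> F by field.
by rewrite h5 h6; fld.
Qed.

Lemma rev_tail (f : nat -> F) m k : (k <= m)%N ->
  \sum_(0 <= i < m) f i = \sum_(0 <= i < m - k) f i + \sum_(0 <= j < k) f (m - j.+1)%N.
Proof.
move=> le_km; rewrite (big_cat_nat (n := m - k)) ?leq_subr //=; congr (_ + _).
rewrite -{1}[(m - k)%N]add0n big_addn subKn // big_nat_rev /=.
by apply: eq_big_nat => j jk; congr (f _); lia.
Qed.

Variables (p n : nat).
Hypotheses (p_prime : prime p) (p_gt3 : (3 < p)%N) (pE : p = (2 * n).+1).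
Local Notation P := (p%:R : F).
Local Notation pint := (@pint F p).
Local Notation cg := (@cg F p).

Let i2 : pint 2^-1 := pint_half F p_prime p_gt3.
Let i3 : pint 3^-1 := pint_third F p_gt3.

Lemma pint_e i : (i.+1 < p)%N -> pint (i%:R + 1)^-1.
Proof. by move=> ip; rewrite natr1; apply: pintV_small => //. Qed.

Lemma pint_o i : (i < n)%N -> pint (i%:R + 1 / 2)^-1.
Proof.
move=> ip; have -> : (i%:R + 1 / 2)^-1 = 2 * (2 * i).+1%:R^-1 :> F.
  have h := halfn0 i; have h1 : (2 * i).+1%:R != 0 :> F by rewrite pnatr_eq0.
  have e : (2 * i).+1%:R = 2 * (i%:R + 1 / 2) :> F by field.
  by rewrite e in h1 *; rewrite invfM mulVKf // pnatr_eq0.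
by pin; apply: pintV_small => //; lia.
Qed.

Lemma pint_harm k : (k < p)%N -> pint (harm k).
Proof. by move=> kp; apply: pint_sum => // i ik; apply: pint_e; lia. Qed.
Lemma pint_harm2 k : (k < p)%N -> pint (harm2 k).
Proof.
by move=> kp; apply: pint_sum => // i ik; rewrite -exprVn; apply: pintX => //; apply: pint_e; lia.
Qed.
Lemma pint_oddharm2 k : (k <= n)%N -> pint (oddharm2 k).
Proof.
by move=> kp; apply: pint_sum => // i ik; rewrite -exprVn; apply: pintX => //; apply: pint_o; lia.
Qed.

Lemma inv_reflect x y : x != 0 -> y != 0 -> pint x^-1 -> pint y^-1 -> y = P - x ->
  cg 2 y^-1 (- x^-1 - P * x^-2).
Proof.
move=> x0 y0 px py e; apply: (@cg_intro _ _ _ (x^-1 ^+ 2 * y^-1)); first by pin.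
by rewrite e in y0 *; fld.
Qed.

Lemma inv_reflect_sq x y : x != 0 -> y != 0 -> pint x^-1 -> pint y^-1 -> y = P - x ->
  cg 1 (y^-2) (x^-2).
Proof.
move=> x0 y0 px py e; have [c pc h] := inv_reflect x0 y0 px py e.
have -> : y^-2 = y^-1 ^+ 2 by rewrite exprVn.
rewrite -[y^-1](subrK (- x^-1 - P * x^-2)) h -[x^-2]exprVn.
apply: (@cg_intro _ _ _ (P * (P * c - x^-1 ^+ 2) ^+ 2 - 2 * x^-1 * (P * c - x^-1 ^+ 2))).
  by pin.
by ring.
Qed.

Lemma harm_reflect k : (k < p)%N -> cg 2 (harm (2 * n - k)) (harm (2 * n) + harm k + P * harm2 k).
Proof.
move=> kp; have le_k : (k <= 2 * n)%N by lia.
have -> : harm (2 * n - k) = harm (2 * n) - \sum_(0 <= j < k) ((2 * n - j.+1)%:R + 1)^-1.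
  by rewrite [harm (2 * n)](rev_tail _ le_k) addrK.
rewrite -addrA; apply: cgD => //; first exact: cg_refl.
have -> : harm k + P * harm2 k = - \sum_(0 <= i < k) (- (i%:R + 1)^-1 - P * (i%:R + 1)^-2).
  by rewrite sumrB sumrN -mulr_sumr opprB addrC opprK.
apply: cgN => //; apply: cg_sum => // i ik.
apply: inv_reflect; rewrite ?natrS_neq0 //; try by apply: pint_e; lia.
by rewrite natrB ?pE; [ring | lia].
Qed.

Lemma harm2_reflect k : (k < p)%N -> cg 1 (harm2 (2 * n - k)) (harm2 (2 * n) - harm2 k).
Proof.
move=> kp; have le_k : (k <= 2 * n)%N by lia.
have -> : harm2 (2 * n - k) = harm2 (2 * n) - \sum_(0 <= j < k) ((2 * n - j.+1)%:R + 1)^-2.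
  by rewrite [harm2 (2 * n)](rev_tail _ le_k) addrK.
apply: cgB => //; first exact: cg_refl.
apply: cg_sum => // i ik.
apply: inv_reflect_sq; rewrite ?natrS_neq0 //; try by apply: pint_e; lia.
by rewrite natrB ?pE; [ring | lia].
Qed.

Lemma oddharm_reflect_term i : (i < n)%N -> cg 2 (i%:R + 1 / 2)^-1
  (- ((n - i.+1)%:R + 1)^-1 - P / 2 * ((n - i.+1)%:R + 1)^-2).
Proof.
move=> ik; have h1 := natrS_neq0 F (n - i.+1); have h2 := halfn0 i.
have px : pint ((n - i.+1)%:R + 1)^-1 by apply: pint_e; lia.
have py := pint_o ik.
apply: (@cg_intro _ _ _ (((n - i.+1)%:R + 1)^-1 ^+ 2 * (i%:R + 1 / 2)^-1 / 4)).
  have -> : 4 = 2 * 2 :> F by ring.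
  by rewrite invfM; pin.
have e : P = 2 * ((i%:R + 1 / 2) + ((n - i.+1)%:R + 1)).
  by rewrite natrB // pE; field.
move: h1 h2; rewrite e; set x := (_ - _)%:R + 1; set y := _ + 1 / 2 => h1 h2.
by fld.
Qed.

Lemma tail_sum (f : nat -> F) m k : (k <= m)%N ->
  \sum_(0 <= j < k) f (m - j.+1)%N
  = \sum_(0 <= i < m) f i - \sum_(0 <= i < m - k) f i.
Proof. by move=> le_km; rewrite (rev_tail f le_km) addrAC subrr add0r. Qed.

Lemma oddharm_reflect k : (k <= n)%N ->
  cg 2 (oddharm k) (- (harm n - harm (n - k)) - P / 2 * (harm2 n - harm2 (n - k))).
Proof.
move=> kn; rewrite -!(tail_sum _ kn) -sumrN mulr_sumr -sumrB.
by apply: cg_sum => // i ik; apply: oddharm_reflect_term; lia.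
Qed.

Lemma oddharm2_reflect k : (k <= n)%N -> cg 1 (oddharm2 k) (harm2 n - harm2 (n - k)).
Proof.
move=> kn; rewrite -!(tail_sum _ kn); apply: cg_sum => // i ik.
have ii : (i < n)%N by lia.
have [c pc /eqP] := oddharm_reflect_term ii; rewrite subr_eq -!exprVn => /eqP ->.
set x := (_ + 1)^-1.
have px : pint x by apply: pint_e; lia.
set u := P * c - 2^-1 * x ^+ 2.
apply: (@cg_intro _ _ _ (P * u ^+ 2 - 2 * x * u)); first by rewrite /u; pin.
by rewrite /u; field.
Qed.

(** Modulo p, reflection gives harm2 (2n) = 2 harm2 n and oddharm2 n = harm2 n,
    whereas oddharm2 n = 4 harm2 (2n) - harm2 n; hence 6 harm2 n = 0. *)
Lemma harm2_half : cg 1 (harm2 n) 0.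
Proof.
have np : (n < p)%N by lia.
have h1 := oddharm2_reflect (leqnn n); rewrite oddharm2_split subnn harm2_0 subr0 in h1.
have h2 := harm2_reflect np; rewrite (_ : 2 * n - n = n)%N in h2; last by lia.
have [c pc e1] := h1; have [d pd e2] := h2.
apply: (@cg_intro _ _ _ ((c + 4 * d) * 2^-1 * 3^-1)); first by pin.
have h6 : 6 * harm2 n = P * (c + 4 * d) by rewrite mulrDr mulrCA -e2 -e1; ring.
by transitivity (6 * harm2 n / 6); [field | rewrite h6; field].
Qed.

Lemma harm2_full : cg 1 (harm2 (2 * n)) 0.
Proof.
have np : (n < p)%N by lia.
have := harm2_reflect np; rewrite (_ : 2 * n - n = n)%N; last by lia.
move=> [c pc e]; have [d pd e'] := harm2_half; rewrite subr0 in e'.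
apply: (@cg_intro _ _ _ (2 * d - c)); first by pin.
by rewrite mulrBr mulrCA -e -e'; ring.
Qed.

(** Wolstenholme's congruence for the harmonic number of index p-1. *)
Lemma harm_full : cg 2 (harm (2 * n)) 0.
Proof.
have np : (n < p)%N by lia.
have := harm_reflect np; rewrite (_ : 2 * n - n = n)%N; last by lia.
move=> [c pc e]; have [d pd e'] := harm2_half; rewrite subr0 in e'.
apply: (@cg_intro _ _ _ (- d - c)); first by pin.
have h : harm (2 * n) = - P * harm2 n - P ^+ 2 * c by rewrite -e; ring.
by rewrite h e'; ring.
Qed.

Lemma harm_mirror k : (k < p)%N -> cg 2 (harm (2 * n - k)) (harm k + P * harm2 k).
Proof.
move=> kp; apply: (cg_trans _ (harm_reflect kp)) => //.
rewrite -addrA -[X in cg _ _ X]add0r; apply: cgD => //; first exact: harm_full.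
exact: cg_refl.
Qed.

Lemma harm2_mirror k : (k < p)%N -> cg 1 (harm2 (2 * n - k)) (- harm2 k).
Proof.
move=> kp; apply: (cg_trans _ (harm2_reflect kp)) => //.
rewrite -[X in cg _ _ X]add0r; apply: cgD => //; first exact: harm2_full.
exact: cg_refl.
Qed.

End Harmonic.

(** * From the hypergeometric terms to the partial fractions *)

Section Truncation.

Variables (F : numFieldType) (p n : nat).
Hypotheses (p_prime : prime p) (p_gt3 : (3 < p)%N) (pE : p = (2 * n).+1).
Local Notation P := (p%:R : F).
Local Notation pint := (@pint F p).
Local Notation cg := (@cg F p).
Local Notation lg := (@lg F p).

Let i2 : pint 2^-1 := pint_half F p_prime p_gt3.
Let i3 : pint 3^-1 := pint_third F p_gt3.

Let o (j : nat) : F := (j%:R + 1 / 2)^-1.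
Let e (j : nat) : F := (j%:R + 1)^-1.

(** Once its value at p = 0 is taken out, every quotient of Pochhammer symbols below
    becomes a product of such factors; the parameter 0 stands for an absent
    factor. *)
Definition hyp_factor (c1 c2 c3 c4 c5 c6 c7 : F) (j : nat) : F :=
  (1 + P * (c1 * o j)) * (1 + P * (c2 * o j)) * (1 + P * (c3 * e j)) * (1 + P * (c4 * e j))
  * ((1 + P * (c5 * o j))^-1 * (1 + P * (c6 * e j))^-1 * (1 + P * (c7 * e j))^-1).

Lemma lg_hyp k c1 c2 c3 c4 c5 c6 c7 : (k <= n)%N ->
  pint c1 -> pint c2 -> pint c3 -> pint c4 -> pint c5 -> pint c6 -> pint c7 ->
  lg (\prod_(0 <= j < k) hyp_factor c1 c2 c3 c4 c5 c6 c7 j)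
     ((c1 + c2 - c5) * oddharm F k + (c3 + c4 - c6 - c7) * harm F k)
     (- ((c1 ^+ 2 + c2 ^+ 2 - c5 ^+ 2) / 2) * oddharm2 F k
      - (c3 ^+ 2 + c4 ^+ 2 - c6 ^+ 2 - c7 ^+ 2) / 2 * harm2 F k).
Proof.
move=> kn p1 p2 p3 p4 p5 p6 p7.
have L j : (0 <= j < k)%N -> lg (hyp_factor c1 c2 c3 c4 c5 c6 c7 j)
    ((c1 + c2 - c5) * o j + (c3 + c4 - c6 - c7) * e j)
    (- ((c1 ^+ 2 + c2 ^+ 2 - c5 ^+ 2) / 2) * o j ^+ 2
      - (c3 ^+ 2 + c4 ^+ 2 - c6 ^+ 2 - c7 ^+ 2) / 2 * e j ^+ 2).
  move=> jk.
  have po : pint (o j) by apply: (@pint_o F p n) => //; lia.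
  have pe : pint (e j) by apply: pint_e => //; lia.
  have l1 c : pint c -> lg (1 + P * (c * o j)) (c * o j) (- ((c * o j) ^+ 2 / 2)).
    by move=> pc; apply: lg1p => //; pin.
  have l2 c : pint c -> lg (1 + P * (c * e j)) (c * e j) (- ((c * e j) ^+ 2 / 2)).
    by move=> pc; apply: lg1p => //; pin.
  have M := @lgM F p p_prime p_gt3; have V := @lgV F p p_prime p_gt3.
  apply: lg_eq (M _ _ _ _ _ _ (M _ _ _ _ _ _ (M _ _ _ _ _ _ (M _ _ _ _ _ _ (l1 _ p1) (l1 _ p2))
    (l2 _ p3)) (l2 _ p4)) (M _ _ _ _ _ _ (M _ _ _ _ _ _ (V _ _ _ (l1 _ p5)) (V _ _ _ (l2 _ p6)))
    (V _ _ _ (l2 _ p7)))) _ _ _ => //; ring.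
apply: lg_eq (lg_prod p_prime p_gt3 L) _ _ _ => //; rewrite big_split /= -!mulr_sumr //.
rewrite sumrN -mulr_sumr; congr (_ * _ - _ * _); apply: eq_bigr => j _;
by rewrite /o /e exprVn.
Qed.

(** The quotient (1/2)_k / k!. *)
Definition wallis (k : nat) : F := \prod_(0 <= j < k) ((j%:R + 1 / 2) / (j%:R + 1)).

Lemma pint_wallis k : (k < p)%N -> pint (wallis k).
Proof.
move=> kp; apply: pint_prod => // i ik; apply: pintM => //; first by pin.
by apply: pint_e => //; lia.
Qed.

Lemma pint_wallisV k : (k <= n)%N -> pint (wallis k)^-1.
Proof.
move=> kp; rewrite /wallis -prodfV; apply: pint_prod => // i ik.
rewrite invf_div; apply: pintM => //; first by pin.
by apply: (@pint_o F p n) => //; lia.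
Qed.

Lemma wallis_neq0 k : wallis k != 0.
Proof.
rewrite prodf_seq_neq0; apply/allP => i _ /=.
by rewrite mulf_neq0 ?invr_neq0 ?halfn0 ?natrS_neq0.
Qed.

(* The base is 4 when eps is false and 16 when it is true. *)
Variable (eps : bool).
Let ep : F := eps%:R.
Let s := 2 * ep - 1.
Let a := 1 / 2 + ep * P.

Lemma sqr_bool : ep ^+ 2 = ep.
Proof. by rewrite /ep; case: (eps); rewrite ?expr1n ?expr0n. Qed.

Lemma a_nonint i j : a + i%:R != j%:R :> F.
Proof.
rewrite -(inj_eq (mulfI (_ : (2 : F) != 0))) ?pnatr_eq0 //.
have -> : 2 * (a + i%:R) = (1 + 2 * (eps * p + i))%:R :> F by rewrite /a /ep; field.
have -> : 2 * j%:R = (2 * j)%:R :> F by ring.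
by rewrite eqr_nat; lia.
Qed.

Lemma nP : n%:R = (P - 1) / 2 :> F.
Proof. by rewrite pE; field. Qed.

Lemma sum_term_wallis k :
  sum_term s P k = wallis k ^+ 2 * \prod_(0 <= j < k) hyp_factor (s / 2) 0 (s / 2) (- s) 0 0 0 j.
Proof.
rewrite /sum_term -prodrXl -big_split /=; apply: eq_bigr => j _.
have h := halfn0 F j; have h1 := natrS_neq0 F j.
have h3 : j%:R * 2 + 1 != 0 :> F by rewrite -natrM natr1 pnatr_eq0.
have h4 : 2 * j%:R + 1 != 0 :> F by rewrite -natrM natr1 pnatr_eq0.
rewrite /hyp_factor /o /e !mul0r !mulr0 !addr0 !invr1 !mulr1.
by fld.
Qed.

Lemma pf_term_wallis k : pf_term a n k
  = wallis k ^+ 2 * \prod_(0 <= j < k) hyp_factor (- (1 / 2)) ep 0 0 0 (s / 2) 0 j.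
Proof.
rewrite /pf_term -prodrXl -big_split /=; apply: eq_bigr => j _.
have h := halfn0 F j; have h1 := natrS_neq0 F j.
have h3 : j%:R * 2 + 1 != 0 :> F by rewrite -natrM natr1 pnatr_eq0.
have h4 : 2 * j%:R + 1 != 0 :> F by rewrite -natrM natr1 pnatr_eq0.
have h2 := a_neq0 a_nonint j n.
rewrite /hyp_factor !mul0r !mulr0 !addr0 !invr1 !mulr1 mul1r.
have -> : j%:R + a - n%:R = (j%:R + 1) * (1 + P * (s / 2 * e j)).
  by rewrite /a /e /s nP; fld.
have -> : j%:R - n%:R = (j%:R + 1 / 2) * (1 + P * (- (1 / 2) * o j)).
  by rewrite /o nP; fld.
have -> : j%:R + a = (j%:R + 1 / 2) * (1 + P * (ep * o j)).
  by rewrite /o /a; fld.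
set u := 1 + P * (s / 2 * _); rewrite !invfM; move: u^-1 => w.
by fld.
Qed.

(** Divided by the square of [wallis], both terms have the first logarithmic
    coefficient (s/2) (oddharm k - harm k), so they agree modulo p^2; a is chosen
    to this end. *)
Lemma sum_term_pf_term k : (k <= n)%N ->
  cg 3 (sum_term s P k - pf_term a n k)
       (P ^+ 2 * (wallis k ^+ 2 * (ep / 2 * oddharm2 F k - 3 / 4 * harm2 F k))).
Proof.
move=> kn; have kp : (k < p)%N by lia.
have pe : pint ep by apply: pint_nat.
have ps : pint s by rewrite /s; pin.
rewrite sum_term_wallis pf_term_wallis -mulrBr mulrCA.
apply: cgMl => //; first by apply: pintX => //; exact: pint_wallis.
have p0 := pint0 F p_prime.
have ph : pint (- (1 / 2)) by pin.
have ps2 : pint (s / 2) by pin.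
have psN : pint (- s) by pin.
have [_ _ h1] := lg_hyp kn ps2 p0 ps2 psN p0 p0 p0.
have [_ _ h2] := lg_hyp kn ph pe p0 p0 p0 ps2 p0.
apply: (cg_trans p_prime (cgB p_prime h1 h2)); apply: cg_eq => //.
have es : s ^+ 2 = 1.
  by transitivity (4 * ep ^+ 2 - 4 * ep + 1); [rewrite /s; ring | rewrite sqr_bool; ring].
rewrite /texp; set oo := oddharm F k; set hh := harm F k; set o2 := oddharm2 F k; set h2' := harm2 F k.
have -> : (s / 2 + 0 - 0) * oo + (s / 2 - s - 0 - 0) * hh = s / 2 * (oo - hh) by field.
have -> : (- (1 / 2) + ep - 0) * oo + (0 + 0 - s / 2 - 0) * hh = s / 2 * (oo - hh).
  by rewrite /s; field.
transitivity (P ^+ 2 * ((- (s ^+ 2) / 8 + 1 / 8 + ep ^+ 2 / 2) * o2 - s ^+ 2 * 3 / 4 * h2')).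
  by field.
by rewrite es sqr_bool; field.
Qed.

(** For k > n the factors at j = n are p/2 and ep p, so the term is divisible by
    p^2. This is the p-integral cofactor. *)
Definition tail_term (k : nat) : F :=
  (\prod_(0 <= j < n) ((j%:R + 1 / 2) * (j%:R + 1 / 2 + s * P / 2)))
  * (\prod_(n.+1 <= j < k) ((j%:R + 1 / 2) * (j%:R + 1 / 2 + s * P / 2)))
  * (\prod_(0 <= j < k) ((j%:R + 1 + s * P / 2) * (j%:R + 1 - s * P) / (j%:R + 1) ^+ 4)).

Lemma sum_term_tail k : (n < k)%N -> sum_term s P k = P ^+ 2 * (ep / 2 * tail_term k).
Proof.
move=> nk; transitivity
  (\prod_(0 <= j < k) ((j%:R + 1 / 2) * (j%:R + 1 / 2 + s * P / 2))
   * \prod_(0 <= j < k) ((j%:R + 1 + s * P / 2) * (j%:R + 1 - s * P) / (j%:R + 1) ^+ 4)).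
  by rewrite -big_split; apply: eq_bigr => j _; rewrite /= !mulrA.
rewrite (big_cat_nat (n := n)) ?(ltnW nk) //= [X in _ * X * _]big_ltn // /tail_term.
set A := \prod_(0 <= j < n) _; set B := \prod_(n.+1 <= j < k) _.
set C := \prod_(0 <= j < k) _.
by rewrite nP /s; field.
Qed.

Lemma pint_tail_term k : (k < p)%N -> pint (tail_term k).
Proof.
move=> kp; have ps : pint s by rewrite /s; pin; exact: pint_nat.
rewrite /tail_term; apply: pintM => //; first apply: pintM => //; apply: pint_prod => // j jk.
- by pin.
- by pin.
- rewrite -exprVn; apply: pintM => //; first by pin.
  by apply: pintX => //; apply: pint_e => //; lia.
Qed.

Lemma pint_quot k r : ~~ (p %| 3 * k + r)%N -> pint (3 * k%:R + r%:R)^-1.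
Proof. by move=> h; rewrite -natrM -natrD; apply: pintV_nat. Qed.

(** The prefactor P raises the congruence of the terms from p^2 to p^3 wherever
    the denominator is prime to p. *)
Lemma head_nopole r : (0 < r < 3)%N -> (forall k, (k <= n)%N -> ~~ (p %| 3 * k + r)%N) ->
  cg 3 (\sum_(0 <= k < n.+1) P * sum_term s P k / (3 * k%:R + r%:R))
       (\sum_(0 <= k < n.+1) P * pf_term a n k / (3 * k%:R + r%:R)).
Proof.
move=> r3 hr; apply: cg_sum => // k /andP[_ kn].
have [c pc h] := sum_term_pf_term kn; have kp : (k < p)%N by lia.
have pw := pint_wallis kp; have po := pint_oddharm2 F p_prime p_gt3 pE kn.
have ph := pint_harm2 F p_prime p_gt3 pE kp; have pq := pint_quot (hr _ kn).
have pe : pint ep by apply: pint_nat.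
apply: (@cg_intro _ _ _ ((wallis k ^+ 2 * (ep / 2 * oddharm2 F k - 3 / 4 * harm2 F k) + P * c)
   * (3 * k%:R + r%:R)^-1)).
  by rewrite (_ : 4 = 2 * 2 :> F) ?invfM; [pin | ring].
have -> : sum_term s P k = pf_term a n k + (sum_term s P k - pf_term a n k) by ring.
have /eqP := h; rewrite subr_eq => /eqP ->.
by move: (_^-1) => u; ring.
Qed.

(** At k = q the denominator is p and cancels the prefactor: there the terms
    themselves are compared modulo p^3. *)
Lemma head_pole r q : (0 < r < 3)%N -> (q <= n)%N -> (3 * q + r = p)%N ->
  cg 3 (\sum_(0 <= k < n.+1) P * sum_term s P k / (3 * k%:R + r%:R))
       (\sum_(0 <= k < n.+1) P * pf_term a n k / (3 * k%:R + r%:R)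
        + P ^+ 2 * (wallis q ^+ 2 * (ep / 2 * oddharm2 F q - 3 / 4 * harm2 F q))).
Proof.
move=> r3 qn hq.
have -> : P ^+ 2 * (wallis q ^+ 2 * (ep / 2 * oddharm2 F q - 3 / 4 * harm2 F q))
   = \sum_(0 <= k < n.+1) (if k == q then
        P ^+ 2 * (wallis q ^+ 2 * (ep / 2 * oddharm2 F q - 3 / 4 * harm2 F q)) else 0).
  rewrite -big_mkcond /= big_mkord (big_pred1 (Ordinal (_ : q < n.+1)%N)) //.
rewrite -big_split; apply: cg_sum => // k /andP[_ kn] /=.
have [c pc h] := sum_term_pf_term kn; have kp : (k < p)%N by lia.
have [->|ne] := eqVneq k q.
  have -> : 3 * q%:R + r%:R = P :> F by rewrite -natrM -natrD hq.
  have P0 := pnat_neq0 F p_prime.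
  have cancel X : P * X / P = X by rewrite mulrAC mulfV // mul1r.
  rewrite !cancel.
  have [d pd g] := sum_term_pf_term qn; apply: (@cg_intro _ _ _ d) => //.
  by rewrite -addrA -g; ring.
have pw := pint_wallis kp; have po := pint_oddharm2 F p_prime p_gt3 pE kn.
have ph := pint_harm2 F p_prime p_gt3 pE kp.
have pq : pint (3 * k%:R + r%:R)^-1.
  apply: pint_quot; apply/negP => /dvdnP[[|[|z]] hz]; move: hz hq ne kn qn p_gt3 r3.
  - lia.
  - lia.
  - by rewrite pE mulSn mulSn; lia.
have pe : pint ep by apply: pint_nat.
apply: (@cg_intro _ _ _ ((wallis k ^+ 2 * (ep / 2 * oddharm2 F k - 3 / 4 * harm2 F k) + P * c)
   * (3 * k%:R + r%:R)^-1)).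
  by rewrite (_ : 4 = 2 * 2 :> F) ?invfM; [pin | ring].
have -> : sum_term s P k = pf_term a n k + (sum_term s P k - pf_term a n k) by ring.
have /eqP := h; rewrite subr_eq => /eqP ->.
by move: (_^-1) => u; ring.
Qed.

Lemma tail_nopole r : (0 < r < 3)%N ->
  (forall k, (n < k < p)%N -> ~~ (p %| 3 * k + r)%N) ->
  cg 3 (\sum_(n.+1 <= k < p) P * sum_term s P k / (3 * k%:R + r%:R)) 0.
Proof.
move=> r3 hr; have h0 : \sum_(n.+1 <= k < p) 0 = 0 :> F by rewrite big1.
rewrite -[X in cg 3 _ X]h0.
apply: cg_sum => // k kn; have kp : (k < p)%N by lia.
have pt := pint_tail_term kp; have pq := pint_quot (hr _ kn).
have pe : pint ep by apply: pint_nat.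
apply: (@cg_intro _ _ _ (ep / 2 * tail_term k * (3 * k%:R + r%:R)^-1)); first by pin.
by rewrite sum_term_tail; [ring | lia].
Qed.

(** The denominator at q is 2p, which leaves half of the term; the other terms
    keep a factor p^3. *)
Lemma tail_pole r q : (0 < r < 3)%N -> (n < q < p)%N -> (3 * q + r = 2 * p)%N ->
  cg 3 (\sum_(n.+1 <= k < p) P * sum_term s P k / (3 * k%:R + r%:R))
       (P ^+ 2 * (ep / 4 * tail_term q)).
Proof.
move=> r3 qn hq.
have -> : P ^+ 2 * (ep / 4 * tail_term q)
   = \sum_(n.+1 <= k < p) (if k == q then P ^+ 2 * (ep / 4 * tail_term q) else 0).
  rewrite (big_cat_nat (n := q)) //= ?[X in _ = _ + X]big_ltn ?eqxx; try lia.
  rewrite big_nat_cond big1 ?add0r; last by move=> i /andP[/andP[_ iq] _]; rewrite ltn_eqF.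
  rewrite big_nat_cond big1 ?addr0 // => i /andP[/andP[iq _] _]; rewrite gtn_eqF //.
apply: cg_sum => // k kn; have kp : (k < p)%N by lia.
have pt := pint_tail_term kp.
have pe : pint ep by apply: pint_nat.
have [->|ne] := eqVneq k q.
  apply: cg_eq => //; rewrite sum_term_tail; last by lia.
  have -> : 3 * q%:R + r%:R = 2 * P :> F by rewrite -!natrM -natrD hq.
  have P0 := pnat_neq0 F p_prime; by fld.
have pq : pint (3 * k%:R + r%:R)^-1.
  apply: pint_quot; apply/negP => /dvdnP[[|[|[|z]]] hz]; move: hz hq ne kn qn p_gt3 r3.
  - lia.
  - lia.
  - lia.
  - by rewrite pE !mulSn; lia.
apply: (@cg_intro _ _ _ (ep / 2 * tail_term k * (3 * k%:R + r%:R)^-1)); first by pin.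
by rewrite sum_term_tail; [ring | lia].
Qed.

End Truncation.

(** * Products and factorials *)

Section Products.

Variable F : numFieldType.

Lemma prod_fact k : \prod_(0 <= j < k) (j%:R + 1) = k`!%:R :> F.
Proof.
elim: k => [|k IH]; first by rewrite big_geq.
by rewrite big_nat_recr //= IH factS natrM mulrC natr1.
Qed.

Lemma factr_neq0 k : k`!%:R != 0 :> F.
Proof. by rewrite pnatr_eq0 -lt0n fact_gt0. Qed.

Lemma prod_rev (f : nat -> F) k :
  \prod_(0 <= j < k) f j = \prod_(0 <= j < k) f (k - j.+1)%N.
Proof. by rewrite big_nat_rev /= add0n. Qed.

Lemma prod_scale (c : F) (f : nat -> F) k :
  \prod_(0 <= j < k) (c * f j) = c ^+ k * \prod_(0 <= j < k) f j.
Proof.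
elim: k => [|k IH]; first by rewrite !big_geq // mulr1.
by rewrite !big_nat_recr //= IH exprS; ring.
Qed.

Lemma prod_opp (f : nat -> F) k :
  \prod_(0 <= j < k) (- f j) = (- 1) ^+ k * \prod_(0 <= j < k) f j.
Proof. by rewrite !big_mkord prodrN card_ord. Qed.

Lemma prod_shift (f : nat -> F) k l :
  \prod_(k <= j < k + l) f j = \prod_(0 <= j < l) f (k + j)%N.
Proof.
rewrite -{1}[k]add0n big_addn addKn; apply: eq_bigr => j _.
by rewrite addnC.
Qed.

Lemma fact_split k l :
  (k + l)`!%:R = k`!%:R * \prod_(0 <= j < l) ((k + j)%:R + 1) :> F.
Proof.
rewrite -!prod_fact [LHS](big_cat_nat (n := k)) ?leq_addr //=; congr (_ * _).
exact: prod_shift.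
Qed.

Lemma prod_falling l k : (k <= l)%N ->
  \prod_(0 <= j < k) (l%:R - j%:R) = l`!%:R / (l - k)`!%:R :> F.
Proof.
elim: k => [|k IH] kl; first by rewrite big_geq // subn0 divff ?factr_neq0.
rewrite big_nat_recr //= IH ?(ltnW kl) // -subnSK // factS natrM.
have -> : (l - k.+1).+1%:R = l%:R - k%:R :> F by rewrite -natr1 natrB //; ring.
have lk : l%:R - k%:R != 0 :> F by rewrite subr_eq0 eqr_nat; lia.
have f0 := factr_neq0 (l - k.+1).
by fld.
Qed.

Lemma binr_prod N k : 'C(N, k)%:R = \prod_(0 <= j < k) ((N%:R - j%:R) / (j%:R + 1)) :> F.
Proof.
elim: k => [|k IH]; first by rewrite bin0 big_geq.
have h := natrS_neq0 F k; rewrite big_nat_recr //= -IH; apply: (mulfI h).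
by rewrite natr1 binr_bot -natr1; fld.
Qed.

Lemma sum_tail_harm k l : (k <= l)%N -> \sum_(k <= i < l) (i%:R + 1)^-1 = harm F l - harm F k.
Proof.
move=> kl; have -> : harm F l = harm F k + \sum_(k <= i < l) (i%:R + 1)^-1.
  by rewrite /harm -big_cat_nat.
by rewrite addrAC subrr add0r.
Qed.

End Products.

Section CongruentProducts.

Variables (F : numFieldType) (p : nat).
Hypotheses (p_prime : prime p) (p_gt3 : (3 < p)%N).
Local Notation P := (p%:R : F).
Local Notation pint := (@pint F p).
Local Notation cg := (@cg F p).
Local Notation lg := (@lg F p).

Let i2 : pint 2^-1 := pint_half F p_prime p_gt3.

Lemma cg_prod (f g : nat -> F) k l :
  (forall i, (k <= i < l)%N -> pint (f i)) -> (forall i, (k <= i < l)%N -> pint (g i)) ->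
  (forall i, (k <= i < l)%N -> cg 1 (f i) (g i)) ->
  cg 1 (\prod_(k <= i < l) f i) (\prod_(k <= i < l) g i).
Proof.
move=> pf pg fg; suff [] : [/\ pint (\prod_(k <= i < l) f i), pint (\prod_(k <= i < l) g i)
   & cg 1 (\prod_(k <= i < l) f i) (\prod_(k <= i < l) g i)] by [].
rewrite big_nat_cond [\prod_(_ <= i < _ ) g i]big_nat_cond.
apply: (big_ind2 (fun x y => [/\ pint x, pint y & cg 1 x y])).
- by split; [pin | pin | exact: cg_refl].
- by move=> x1 x2 y1 y2 [px px' h1] [py py' h2]; split; [pin | pin | exact: cgM].
- by move=> i /andP[ki _]; split; [exact: pf | exact: pg | exact: fg].
Qed.

Lemma cg1V x y : x != 0 -> y != 0 -> pint x^-1 -> pint y^-1 -> cg 1 x y -> cg 1 x^-1 y^-1.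
Proof.
move=> x0 y0 px py [c pc e]; apply: (@cg_intro _ _ _ (- c * x^-1 * y^-1)); first by pin.
have -> : P ^+ 1 * (- c * x^-1 * y^-1) = - (P ^+ 1 * c) * x^-1 * y^-1 by ring.
by rewrite -e; fld.
Qed.

Lemma cg1_unit x y : y != 0 -> pint y^-1 -> cg 1 x y -> pint x^-1 /\ cg 1 x^-1 y^-1.
Proof.
move=> y0 py hxy; have [c pc /eqP] := hxy; rewrite subr_eq => /eqP e.
have pcy : pint (c * y^-1) by pin.
have [u0 pu] := pint_unit1 pcy.
have ex : x = y * (1 + P * (c * y^-1)) by rewrite e; fld.
have x0 : x != 0 by rewrite ex mulf_neq0.
have px : pint x^-1 by rewrite ex invfM; pin.
by split=> //; apply: cg1V.
Qed.

Lemma pint_factV k : (k < p)%N -> pint (k`!%:R^-1).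
Proof.
move=> kp; rewrite -prod_fact -prodfV; apply: pint_prod => // i ik.
by apply: pint_e; lia.
Qed.

Lemma lg_prod_inv c k l : (l < p)%N -> pint c ->
  lg (\prod_(k <= i < l) (1 + P * (c * (i%:R + 1)^-1)))
     (c * \sum_(k <= i < l) (i%:R + 1)^-1)
     (- (c ^+ 2 / 2) * \sum_(k <= i < l) (i%:R + 1)^-2).
Proof.
move=> lp pc; have L i : (k <= i < l)%N -> lg (1 + P * (c * (i%:R + 1)^-1))
    (c * (i%:R + 1)^-1) (- (c ^+ 2 / 2) * (i%:R + 1)^-2).
  move=> il; have px : pint (i%:R + 1)^-1 by apply: pint_e; lia.
  apply: lg_eq (lg1p p_prime p_gt3 _) _ _ _ => //; first by pin.
  by rewrite -exprVn; move: (_ ^-1) => u; field.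
by apply: lg_eq (lg_prod p_prime p_gt3 L) _ _ _; rewrite ?mulr_sumr.
Qed.

End CongruentProducts.

(** * The sum whose pole lies in the first half *)

Section Thirds.

Variable F : numFieldType.

Lemma third_neq (r k : nat) : (0 < r)%N -> r%:R / 3 + k%:R != 0 :> F.
Proof.
move=> r0; have -> : r%:R / 3 + k%:R = (r + 3 * k)%:R / 3 :> F by field.
by rewrite mulf_neq0 ?invr_neq0 ?pnatr_eq0 //; lia.
Qed.

Lemma thirds_sum (c : F) (f : nat -> F) (r N : nat) : (0 < r)%N ->
  \sum_(0 <= k < N) c * f k / (3 * k%:R + r%:R)
  = c / 3 * \sum_(0 <= k < N) f k / (r%:R / 3 + k%:R).
Proof.
move=> r0; rewrite mulr_sumr; apply: eq_bigr => k _; have k0 := third_neq k r0.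
have k1 : 3 * k%:R + r%:R != 0 :> F by rewrite -natrM -natrD pnatr_eq0; lia.
have k2 : r%:R + k%:R * 3 != 0 :> F by rewrite addrC mulrC.
by fld.
Qed.

End Thirds.

Section HeadProduct.

Variables (F : numFieldType) (p n : nat).
Hypotheses (p_prime : prime p) (p_gt3 : (3 < p)%N) (pE : p = (2 * n).+1).
Local Notation P := (p%:R : F).
Local Notation pint := (@pint F p).
Local Notation cg := (@cg F p).
Local Notation lg := (@lg F p).

Let i2 : pint 2^-1 := pint_half F p_prime p_gt3.
Let i3 : pint 3^-1 := pint_third F p_gt3.

Variables (eps : bool) (r q : nat).
Hypotheses (r3 : (0 < r < 3)%N) (qn : (q <= n)%N) (qE : (3 * q + r = p)%N).
Let ep : F := eps%:R.
Let a := 1 / 2 + ep * P.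
Let pe : pint ep. Proof. exact: pint_nat. Qed.

Let hf := @hyp_factor F p.

(** Partial fractions at b = r/3, where b + q = p/3. *)
Lemma head_prod :
  \sum_(0 <= k < n.+1) P * pf_term a n k / (3 * k%:R + r%:R)
  = wallis F q ^+ 2 *
    (\prod_(0 <= j < q) hf (- (1 / 2)) (ep - 1 / 3) 0 0 0 (ep - 1 / 2) (- (1 / 3)) j
     * \prod_(0 <= j < n - q) hf (1 / 3 - ep) 0 0 0 (- ep) (1 / 3) 0 j).
Proof.
have r0 : (0 < r)%N by case/andP: r3.
rewrite (thirds_sum _ _ _ r0).
have := partial_fractions_at (a_nonint F p_gt3 pE eps) (fun k => third_neq F k r0) qn.
rewrite -/ep -/a; have -> : r%:R / 3 + q%:R = P / 3 :> F by rewrite -qE; field.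
move=> e; rewrite {}e mulrA; congr (_ * _).
  rewrite -prodrXl -big_split; apply: eq_bigr => j _ /=.
  have h0 := halfn0 F j; have h1 := natrS_neq0 F j.
  have h3 : j%:R * 2 + 1 != 0 :> F by rewrite -natrM natr1 pnatr_eq0.
  have h4 : 2 * j%:R + 1 != 0 :> F by rewrite -natrM natr1 pnatr_eq0.
  rewrite /hf /hyp_factor !mul0r !mulr0 !addr0 !invr1 !mulr1.
  have -> : n%:R - j%:R - a = - (j%:R + 1) * (1 + P * ((ep - 1 / 2) * (j%:R + 1)^-1)).
    by rewrite (nP F pE) /a; fld.
  have -> : n%:R - j%:R = - (j%:R + 1 / 2) * (1 + P * (- (1 / 2) * (j%:R + 1 / 2)^-1)).
    by rewrite (nP F pE); fld.
  have -> : P / 3 - j%:R - a = - (j%:R + 1 / 2) * (1 + P * ((ep - 1 / 3) * (j%:R + 1 / 2)^-1)).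
    by rewrite /a; fld.
  have -> : P / 3 - j%:R - 1 = - (j%:R + 1) * (1 + P * (- (1 / 3) * (j%:R + 1)^-1)).
    by fld.
  set u := 1 + P * ((ep - 1 / 2) * _); set w := 1 + P * (- (1 / 3) * _).
  by rewrite !invfM; move: u^-1 w^-1 => u1 w1; fld.
apply: eq_bigr => j _ /=.
have h0 := halfn0 F j; have h1 := natrS_neq0 F j.
have h3 : j%:R * 2 + 1 != 0 :> F by rewrite -natrM natr1 pnatr_eq0.
have h4 : 2 * j%:R + 1 != 0 :> F by rewrite -natrM natr1 pnatr_eq0.
rewrite /hf /hyp_factor !mul0r !mulr0 !addr0 !invr1 !mulr1.
have -> : P / 3 + j%:R + 1 - a = (j%:R + 1 / 2) * (1 + P * ((1 / 3 - ep) * (j%:R + 1 / 2)^-1)).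
  by rewrite /a; fld.
have -> : j%:R + 1 - a = (j%:R + 1 / 2) * (1 + P * (- ep * (j%:R + 1 / 2)^-1)).
  by rewrite /a; fld.
have -> : P / 3 + j%:R + 1 = (j%:R + 1) * (1 + P * (1 / 3 * (j%:R + 1)^-1)).
  by fld.
set u := 1 + P * (- ep * _); set w := 1 + P * (1 / 3 * _).
by rewrite !invfM; move: u^-1 w^-1 => u' w'; fld.
Qed.

Lemma head_prod_log : lg
    (\prod_(0 <= j < q) hf (- (1 / 2)) (ep - 1 / 3) 0 0 0 (ep - 1 / 2) (- (1 / 3)) j
     * \prod_(0 <= j < n - q) hf (1 / 3 - ep) 0 0 0 (- ep) (1 / 3) 0 j)
    ((5 / 6 - ep) * (harm F q - oddharm F q) + 1 / 3 * (oddharm F (n - q) - harm F (n - q)))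
    (- ((1 / 4 + (ep - 1 / 3) ^+ 2) / 2) * oddharm2 F q + ((ep - 1 / 2) ^+ 2 + 1 / 9) / 2 * harm2 F q
     + (- (((1 / 3 - ep) ^+ 2 - ep ^+ 2) / 2) * oddharm2 F (n - q) + 1 / 18 * harm2 F (n - q))).
Proof.
have k2 : (n - q <= n)%N by rewrite leq_subr.
have p0 := pint0 F p_prime.
have L1 := lg_hyp (n := n) p_prime p_gt3 pE qn.
have L2 := lg_hyp (n := n) p_prime p_gt3 pE k2.
have {}L1 := L1 F (- (1 / 2)) (ep - 1 / 3) 0 0 0 (ep - 1 / 2) (- (1 / 3)).
have {}L2 := L2 F (1 / 3 - ep) 0 0 0 (- ep) (1 / 3) 0.
have {L1}L1 := L1 ltac:(pin) ltac:(pin) p0 p0 p0 ltac:(pin) ltac:(pin).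
have {L2}L2 := L2 ltac:(pin) p0 p0 p0 ltac:(pin) ltac:(pin) p0.
by apply: lg_eq (lgM p_prime p_gt3 L1 L2) _ _ _ => //; field.
Qed.

End HeadProduct.

(** * Primes p = 6m + 1 *)

Section CaseOne.

Variables (F : numFieldType) (p m : nat).
Hypotheses (p_prime : prime p) (p_gt3 : (3 < p)%N) (pE : p = (6 * m).+1).
Local Notation P := (p%:R : F).
Local Notation pint := (@pint F p).
Local Notation cg := (@cg F p).
Local Notation lg := (@lg F p).
Local Notation H := (harm F).
Local Notation H2 := (harm2 F).
Local Notation O := (oddharm F).
Local Notation O2 := (oddharm2 F).

Let i2 : pint 2^-1 := pint_half F p_prime p_gt3.
Let i3 : pint 3^-1 := pint_third F p_gt3.
Let pE2 : p = (2 * (3 * m)).+1. Proof. by rewrite pE mulnA. Qed.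

Let h := H (3 * m).
Let b := H (2 * m).
Let d := H2 (2 * m).

Let ph : pint h. Proof. by apply: (pint_harm F p_prime p_gt3 pE2); lia. Qed.
Let pb : pint b. Proof. by apply: (pint_harm F p_prime p_gt3 pE2); lia. Qed.
Let pd : pint d. Proof. by apply: (pint_harm2 F p_prime p_gt3 pE2); lia. Qed.

(** Reflecting i to p - i, and i + 1/2 to the integer it equals modulo p, expresses
    all the harmonic sums that occur through H(3m), H(2m) and H2(2m). *)
Lemma harm_4m : cg 2 (H (4 * m)) (b + P * d).
Proof.
have kp : (2 * m < p)%N by lia.
have := harm_mirror F p_prime p_gt3 pE2 kp.
by rewrite (_ : 2 * (3 * m) - 2 * m = 4 * m)%N //; lia.
Qed.

Lemma harm2_4m : cg 1 (H2 (4 * m)) (- d).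
Proof.
have kp : (2 * m < p)%N by lia.
have := harm2_mirror F p_prime p_gt3 pE2 kp.
by rewrite (_ : 2 * (3 * m) - 2 * m = 4 * m)%N //; lia.
Qed.

Lemma harm2_m : cg 1 (H2 m) (5 * d).
Proof.
have kn : (2 * m <= 3 * m)%N by lia.
have := oddharm2_reflect F p_prime p_gt3 pE2 kn; rewrite oddharm2_split -/d.
rewrite (_ : 3 * m - 2 * m = m)%N; last by lia.
rewrite (_ : 2 * (2 * m) = 4 * m)%N; last by lia.
move=> [c1 pc1 e1]; have [c2 pc2 e2] := harm2_4m.
have [c3 pc3 e3] := harm2_half F p_prime p_gt3 pE2.
apply: (@cg_intro _ _ _ (c1 + c3 - 4 * c2)); first by pin.
have -> : P ^+ 1 * (c1 + c3 - 4 * c2) = P ^+ 1 * c1 + P ^+ 1 * c3 - 4 * (P ^+ 1 * c2) by ring.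
by rewrite -e1 -e2 -e3; ring.
Qed.

Lemma harm_m : cg 2 (H m) (h + b - P * d / 2).
Proof.
have kn : (2 * m <= 3 * m)%N by lia.
have := oddharm_reflect F p_prime p_gt3 pE2 kn; rewrite oddharm_split -/b -/h.
rewrite (_ : 3 * m - 2 * m = m)%N; last by lia.
rewrite (_ : 2 * (2 * m) = 4 * m)%N; last by lia.
move=> [c1 pc1 e1]; have [c2 pc2 e2] := harm_4m; have [c3 pc3 e3] := harm2_m.
have [c4 pc4 e4] := harm2_half F p_prime p_gt3 pE2.
apply: (@cg_intro _ _ _ (2 * c2 - c1 + (c4 - c3) / 2)); first by pin.
have -> : P ^+ 2 * (2 * c2 - c1 + (c4 - c3) / 2) = 2 * (P ^+ 2 * c2) - P ^+ 2 * c1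
  + P * (P ^+ 1 * c4 - P ^+ 1 * c3) / 2 by field.
by rewrite -e1 -e2 -e3 -e4; field.
Qed.

Lemma m_pos : (0 < m)%N. Proof. by lia. Qed.

Section Eps.

Variable (eps : bool).
Let ep : F := eps%:R.
Let s := 2 * ep - 1.
Let a := 1 / 2 + ep * P.
Let pe : pint ep. Proof. exact: pint_nat. Qed.

Let hf := @hyp_factor F p.

Let e31 : (3 * m - 2 * m = m)%N. Proof. by lia. Qed.

(** H(2m) cancels. The second coefficient is displayed as what the sums of inverse
    squares give, plus what the first coefficient passes on. *)
Lemma sum1_head_log : lg
    (\prod_(0 <= j < 2 * m) hf (- (1 / 2)) (ep - 1 / 3) 0 0 0 (ep - 1 / 2) (- (1 / 3)) j
     * \prod_(0 <= j < m) hf (1 / 3 - ep) 0 0 0 (- ep) (1 / 3) 0 j)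
    (- (2 / 3) * h) ((17 / 12 + ep / 2) * d + (2 * ep - 4 / 3) * d).
Proof.
have i4 : pint 4^-1 by rewrite (_ : 4 = 2 * 2) ?invfM; [pin | ring].
have i12 : pint 12^-1 by rewrite (_ : 12 = 4 * 3) ?invfM; [pin | ring].
have k1 : (2 * m <= 3 * m)%N by lia.
have := head_prod_log F p_prime p_gt3 pE2 eps k1; rewrite e31 -/ep => L.
have [c1 pc1 /eqP] := harm_4m; rewrite subr_eq => /eqP e1.
have [c2 pc2 /eqP] := harm2_4m; rewrite subr_eq => /eqP e2.
have [c3 pc3 /eqP] := harm2_m; rewrite subr_eq => /eqP e3.
have [c4 pc4 /eqP] := harm_m; rewrite subr_eq => /eqP e4.
have eO : O (2 * m) = 2 * H (4 * m) - b by rewrite oddharm_split (_ : 2 * (2 * m) = 4 * m)%N //; lia.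
have eO2 : O2 (2 * m) = 4 * H2 (4 * m) - d by rewrite oddharm2_split (_ : 2 * (2 * m) = 4 * m)%N //; lia.
have eOm : O m = 2 * b - H m by rewrite oddharm_split.
have eO2m : O2 m = 4 * d - H2 m by rewrite oddharm2_split.
apply: (lg_shift p_prime p_gt3 L); try by pin.
  rewrite eO eOm e1 e4.
  apply: (@cg_intro _ _ _ ((ep - 5 / 6) * 2 * c1 - 2 / 3 * c4)).
    by rewrite (_ : 6 = 2 * 3) ?invfM; [pin | ring].
  by rewrite -/b; field.
rewrite eO2 eO2m e2 e3.
apply: (@cg_intro _ _ _ (- (1 / 4 + (ep - 1 / 3) ^+ 2) / 2 * 4 * c2
  + ((1 / 3 - ep) ^+ 2 - ep ^+ 2) / 2 * c3 + c3 / 3 ^+ 2 / 2)); first by rewrite -exprVn; pin.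
rewrite -/d; apply/eqP; rewrite -subr_eq0; apply/eqP.
by transitivity ((ep ^+ 2 - ep) * (3 * d)); [field | rewrite (sqr_bool F eps) subrr mul0r].
Qed.

Lemma pole_bound k r : (0 < r < 3)%N -> (3 * m < k < p)%N -> (p %| 3 * k + r)%N ->
  (3 * k + r = 2 * p)%N.
Proof.
move=> r3 kn /dvdnP[[|[|[|z]]] hz]; rewrite hz //; move: hz kn r3; rewrite pE ?mulSn; clear; lia.
Qed.

(** Since 3 (2m) + 1 = p, the only pole is at 2m, and the tail has none. The second
    order correction of [head_pole] removes the dependence on eps. *)
Lemma sum1_6m1 : cg 3 (sum1 s p) (wallis F (2 * m) ^+ 2 * texp p (- (2 / 3) * h) (- (2 / 3) * d)).
Proof.
have pw : pint (wallis F (2 * m)) by apply: (pint_wallis F p_prime p_gt3 pE2); lia.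
have np : (3 * m < p)%N by lia.
have k1 : (2 * m <= 3 * m)%N by lia.
have -> : sum1 s p = \sum_(0 <= k < (3 * m).+1) P * sum_term s P k / (3 * k%:R + 1%:R)
   + \sum_((3 * m).+1 <= k < p) P * sum_term s P k / (3 * k%:R + 1%:R).
  by rewrite /sum1 (big_cat_nat (n := (3 * m).+1)).
have T : cg 3 (\sum_((3 * m).+1 <= k < p) P * sum_term s P k / (3 * k%:R + 1%:R)) 0.
  apply: (@tail_nopole F p _ p_prime p_gt3 pE2 eps 1 isT) => k kn.
  by apply/negP => /(pole_bound (isT : (0 < 1 < 3)%N) kn); lia.
have Hd : (3 * (2 * m) + 1 = p)%N by lia.
have hq := Hd.
have {Hd}Hd := @head_pole F p _ p_prime p_gt3 pE2 eps 1 (2 * m) isT k1 Hd.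
have {T}Hd := cgD p_prime Hd T.
apply: (cg_trans p_prime Hd); rewrite addr0 (head_prod F p_gt3 pE2 eps (r := 1) isT k1 hq) e31 -/ep [P ^+ 2 * _]mulrCA -mulrDr.
apply: cgMl => //; first by pin.
have [_ _ L] := sum1_head_log.
have [c2 pc2 /eqP] := harm2_4m; rewrite subr_eq => /eqP e2.
have eO2 : O2 (2 * m) = 4 * H2 (4 * m) - d by rewrite oddharm2_split (_ : 2 * (2 * m) = 4 * m)%N //; lia.
have {}L := cgD p_prime L (cg_refl p_prime 3 (P ^+ 2 * (eps%:R / 2 * O2 (2 * m) - 3 / 4 * H2 (2 * m)))).
apply: (cg_trans p_prime L); apply: (@cg_intro _ _ _ (ep / 2 * 4 * c2)); first by pin.
by rewrite -/ep -/d eO2 e2 /texp; field.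
Qed.

Let sg : F := (- 1) ^+ m.
Let A : F := (3 * m)`!%:R.
Let B : F := (2 * m)`!%:R.
Let C : F := m`!%:R.
Let D4 : F := (4 * m)`!%:R.

Lemma sg2 : sg * sg = 1. Proof. by rewrite /sg -expr2 sqrr_sign. Qed.

Let pA' : pint A^-1. Proof. by apply: pint_factV => //; lia. Qed.
Let pB' : pint B^-1. Proof. by apply: pint_factV => //; lia. Qed.
Let pC' : pint C^-1. Proof. by apply: pint_factV => //; lia. Qed.
Let pD' : pint D4^-1. Proof. by apply: pint_factV => //; lia. Qed.
Let pA : pint A. Proof. exact: pint_nat. Qed.
Let pB : pint B. Proof. exact: pint_nat. Qed.
Let pC : pint C. Proof. exact: pint_nat. Qed.
Let pD : pint D4. Proof. exact: pint_nat. Qed.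
Let psg : pint sg. Proof. by apply: pintX => //; pin. Qed.

(** Modulo p the factors 3m+1, ..., 4m are the negatives of 3m, ..., 2m+1. *)
Lemma fact_ratio : cg 1 D4 (sg * A ^+ 2 / B).
Proof.
have -> : D4 = A * \prod_(0 <= j < m) ((3 * m + j)%:R + 1).
  rewrite /D4 -prod_fact (big_cat_nat (n := 3 * m)) //=; last by lia.
  rewrite prod_fact; congr (_ * _).
  have e4 : (4 * m = 3 * m + m)%N by lia.
  by rewrite e4; exact: prod_shift.
have -> : sg * A ^+ 2 / B = A * (sg * \prod_(0 <= j < m) ((3 * m)%:R - j%:R)).
  rewrite prod_falling; last by lia.
  rewrite (_ : 3 * m - m = 2 * m)%N -/A -/B; last by lia.
  by have B0 := factr_neq0 F (2 * m); rewrite -/B in B0; fld.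
apply: cgMl => //; rewrite -prod_opp; apply: (cg_prod p_prime) => j jm; [by pin|by pin|].
apply: (@cg_intro _ _ _ 1); first by pin.
by rewrite pE natrD; ring.
Qed.

(** Modulo p, j + 1/2 is j - 3m. *)
Lemma wallis_fact : cg 1 (wallis F (2 * m)) (A / (C * B)).
Proof.
have -> : A / (C * B) = (\prod_(0 <= j < 2 * m) - ((3 * m)%:R - j%:R)) / B.
  rewrite prod_opp exprM sqrrN expr1n expr1n mul1r prod_falling; last by lia.
  by rewrite (_ : 3 * m - 2 * m = m)%N ?invfM ?mulrA //; lia.
rewrite /wallis big_split /= prodfV prod_fact -/B.
apply: cgMr => //; apply: (cg_prod p_prime) => j jm; [by pin|by pin|].
by apply: (@cg_intro _ _ _ (1 / 2)); [pin | rewrite pE; field].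
Qed.

Let A0 : A != 0. Proof. exact: factr_neq0. Qed.
Let B0 : B != 0. Proof. exact: factr_neq0. Qed.
Let C0 : C != 0. Proof. exact: factr_neq0. Qed.
Let D0 : D4 != 0. Proof. exact: factr_neq0. Qed.
Let sg0 : sg != 0. Proof. by rewrite /sg signr_eq0. Qed.
Let w := wallis F (2 * m).
Let w0 : w != 0. Proof. exact: wallis_neq0. Qed.
Let pw' : pint w^-1. Proof. by apply: (pint_wallisV F p_prime p_gt3 pE2); lia. Qed.
Let pw : pint w. Proof. by apply: (pint_wallis F p_prime p_gt3 pE2); lia. Qed.

Lemma wallis_inv : cg 1 (w^-2) ((C * B / A) ^+ 2).
Proof.
have h1 : cg 1 w^-1 (A / (C * B))^-1.
  apply: cg1V => //; last exact: wallis_fact.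
  - by rewrite mulf_neq0 ?invr_neq0 ?mulf_neq0.
  - by rewrite invf_div; pin.
rewrite -exprVn !expr2 (_ : C * B / A = (A / (C * B))^-1); last by rewrite invf_div.
by apply: cgM => //; rewrite invf_div; pin.
Qed.

Lemma sgV : sg^-1 = sg.
Proof. by apply: (mulfI sg0); rewrite mulfV // sg2. Qed.

Lemma fact_ratio_inv : cg 1 D4^-1 (sg * B / A ^+ 2).
Proof.
have <- : (sg * A ^+ 2 / B)^-1 = sg * B / A ^+ 2.
  by transitivity (sg^-1 * B / A ^+ 2); [fld | rewrite sgV].
apply: cg1V => //; rewrite ?D0 //; last exact: fact_ratio.
- by apply: mulf_neq0 (mulf_neq0 sg0 (expf_neq0 2 A0)) (invr_neq0 B0).
- have -> : (sg * A ^+ 2 / B)^-1 = sg * B / A ^+ 2.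
    by transitivity (sg^-1 * B / A ^+ 2); [fld | rewrite sgV].
  by rewrite -exprVn; pin.
Qed.

Let m0 : m%:R != 0 :> F. Proof. by rewrite pnatr_eq0; lia. Qed.
Let pm' : pint m%:R^-1. Proof. by apply: pintV_small => //; lia. Qed.

Lemma fact_pred : (m.-1)`!%:R = C / m%:R :> F.
Proof.
by have := factS m.-1; rewrite prednK ?m_pos // /C => ->; rewrite natrM mulrAC mulfV ?mul1r.
Qed.

(** The constant is 1 / m^2, as 6m = -1 modulo p. *)
Lemma tail_sum2 : cg 1 (tail_term F p (3 * m) eps (4 * m)) (36 / w ^+ 2).
Proof.
have ps : pint s by rewrite /s; pin.
have T1 : cg 1 (\prod_(0 <= j < 3 * m) ((j%:R + 1 / 2) * (j%:R + 1 / 2 + s * P / 2))) (A ^+ 2).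
  have -> : A ^+ 2 = \prod_(0 <= j < 3 * m) ((3 * m)%:R - j%:R) ^+ 2.
    by rewrite prodrXl prod_falling ?subnn ?divr1.
  apply: (cg_prod p_prime) => j jm; [by pin|by pin|].
  apply: (@cg_intro _ _ _ ((2 + s) / 2 * ((3 * m)%:R - j%:R) * -1 + P * (1 + s) / 4)).
    by rewrite (_ : 4 = 2 * 2) ?invfM; [pin | ring].
  by rewrite pE; field.
have T2 : cg 1 (\prod_((3 * m).+1 <= j < 4 * m) ((j%:R + 1 / 2) * (j%:R + 1 / 2 + s * P / 2)))
    ((C / m%:R) ^+ 2).
  have e4 : (4 * m = (3 * m).+1 + m.-1)%N by lia.
  rewrite -fact_pred -prod_fact -prodrXl e4 (prod_shift _ (3 * m).+1 m.-1).
  apply: (cg_prod p_prime) => j jm; [by pin|by pin|].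
  apply: (@cg_intro _ _ _ ((2 + s) / 2 * (j%:R + 1) + P * (1 + s) / 4)).
    by rewrite (_ : 4 = 2 * 2) ?invfM; [pin | ring].
  by rewrite natrD -natr1 pE; field.
have T3 : cg 1 (\prod_(0 <= j < 4 * m) ((j%:R + 1 + s * P / 2) * (j%:R + 1 - s * P) / (j%:R + 1) ^+ 4))
    (D4^-1 ^+ 2).
  rewrite /D4 -prod_fact -prodfV -prodrXl.
  have px i : (0 <= i < 4 * m)%N -> pint (i%:R + 1)^-1 by move=> im; apply: pint_e; lia.
  apply: (cg_prod p_prime) => j /px pj; [by rewrite -exprVn; pin|by pin|].
  have h1 := natrS_neq0 F j.
  apply: (@cg_intro _ _ _ ((- s / 2 * (j%:R + 1) - s ^+ 2 / 2 * P) * (j%:R + 1)^-1 ^+ 4)).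
    by pin.
  by fld.
have pT2 : pint (\prod_((3 * m).+1 <= j < 4 * m) ((j%:R + 1 / 2) * (j%:R + 1 / 2 + s * P / 2))).
  by apply: pint_prod => // i _; pin.
have pT1 : pint (\prod_(0 <= j < 3 * m) ((j%:R + 1 / 2) * (j%:R + 1 / 2 + s * P / 2))).
  by apply: pint_prod => // i _; pin.
have T : cg 1 (tail_term F p (3 * m) eps (4 * m)) (A ^+ 2 * (C / m%:R) ^+ 2 * D4^-1 ^+ 2).
  apply: cgM => //; [by pin|by pin|apply: cgM => //; by pin].
apply: (cg_trans p_prime T).
have [c1 pc1 /eqP] := fact_ratio_inv; rewrite subr_eq => /eqP e1.
have [c2 pc2 /eqP] := wallis_inv; rewrite subr_eq => /eqP e2.
have h36 : cg 1 (m%:R^-1 ^+ 2) 36.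
  by apply: (@cg_intro _ _ _ ((1 - 6 * m%:R) * m%:R^-1 ^+ 2)); [pin | rewrite pE; fld].
have [c3 pc3 /eqP] := h36; rewrite subr_eq => /eqP e3.
have -> : A ^+ 2 * (C / m%:R) ^+ 2 * D4^-1 ^+ 2 = A ^+ 2 * C ^+ 2 * (m%:R^-1 ^+ 2) * D4^-1 ^+ 2.
  by fld.
rewrite e1 e2 e3.
apply: (@cg_intro _ _ _ (A ^+ 2 * C ^+ 2 * (P * c3 + 36) *
   (P * c1 ^+ 2 + 2 * c1 * (sg * B * A^-1 ^+ 2)) + (C * B * A^-1) ^+ 2 * c3 - 36 * c2)).
  by pin.
transitivity (A ^+ 2 * C ^+ 2 * (P * c3 + 36) * (P ^+ 2 * c1 ^+ 2 + 2 * P * c1 * (sg * B / A ^+ 2)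
   + (sg * sg) * (B / A ^+ 2) ^+ 2)); first by fld.
by rewrite sg2; fld.
Qed.

Let num (i : nat) : F := 2 / 3 + i%:R + 1 - a.
Let den1 (i : nat) : F := i%:R + 1 - a.
Let den2 (i : nat) : F := 2 / 3 + i%:R + 1.
Let rest : F := A * ((\prod_(0 <= i < m.-1) num i) * \prod_(m <= i < 3 * m) num i)
  / (\prod_(0 <= i < 3 * m) den1 i * \prod_(0 <= i < 3 * m) den2 i).

(** The numerator factor at i = m - 1 is p (1/6 - eps); as no denominator is
    divisible by p, only the cofactor [rest] modulo p is needed. *)
Lemma head_sum2 :
  \sum_(0 <= k < (3 * m).+1) P * pf_term a (3 * m) k / (3 * k%:R + 2%:R)
  = P ^+ 2 * ((1 / 12 - ep / 2) * rest).
Proof.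
rewrite (thirds_sum _ _ _ (isT : (0 < 2)%N)).
rewrite (partial_fractions (a_nonint F p_gt3 pE2 eps) (3 * m) (fun k => third_neq F k (isT : (0 < 2)%N))).
rewrite -/ep -/a.
have -> : \prod_(0 <= i < 3 * m) ((i%:R + 1) * (2 / 3 + i%:R + 1 - a)
    / ((i%:R + 1 - a) * (2 / 3 + i%:R + 1)))
  = (\prod_(0 <= i < 3 * m) (i%:R + 1)) * (\prod_(0 <= i < 3 * m) num i)
    / (\prod_(0 <= i < 3 * m) den1 i * \prod_(0 <= i < 3 * m) den2 i).
  by rewrite -!big_split -prodfV -big_split.
have -> : \prod_(0 <= i < 3 * m) num i = (\prod_(0 <= i < m.-1) num i) *
    (P * (1 / 6 - ep)) * \prod_(m <= i < 3 * m) num i.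
  rewrite (big_cat_nat (n := m)) //=; last by lia.
  congr (_ * _); have := prednK m_pos; move: (m.-1) => m' em.
  rewrite -em big_nat_recr //=; congr (_ * _).
  by rewrite /num /a pE -em; field.
rewrite prod_fact -/A /rest; set d1 := \prod_(_ <= i < _) den1 i; set d2 := \prod_(_ <= i < _) den2 i.
by rewrite invfM; move: d1^-1 d2^-1 => u1 u2; field.
Qed.

Lemma fact_pred4 : (4 * m).-1`!%:R = D4 / (4 * m%:R) :> F.
Proof.
have := factS (4 * m).-1; rewrite prednK ?muln_gt0 ?m_pos // /D4 => ->.
by rewrite natrM natrM mulrAC mulfV ?mul1r // mulf_neq0 // pnatr_eq0.
Qed.

Let n4m : (4 * m%:R : F) != 0. Proof. by rewrite mulf_neq0 // pnatr_eq0. Qed.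

Lemma rest_val : cg 1 rest (24 / w ^+ 2).
Proof.
have N1 : cg 1 (\prod_(0 <= i < m.-1) num i) (- sg * (C / m%:R)).
  have -> : - sg * (C / m%:R) = \prod_(0 <= j < m.-1) - ((m.-1)%:R - j%:R).
    rewrite prod_opp prod_falling // subnn divr1 fact_pred; congr (_ * _).
    by rewrite /sg -{1}(prednK m_pos) exprS mulN1r opprK.
  apply: (cg_prod p_prime) => j jm; [by rewrite /num /a; pin|by pin|].
  have e1 : m.-1%:R = m%:R - 1 :> F by rewrite -[in RHS](prednK m_pos) -natr1 addrK.
  apply: (@cg_intro _ _ _ (1 / 6 - ep)).
    by rewrite (_ : 6 = 2 * 3) ?invfM; [pin | ring].
  by rewrite /num /a e1 pE; field.
have N2 : cg 1 (\prod_(m <= i < 3 * m) num i) B.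
  have e3 : (3 * m = m + 2 * m)%N by lia.
  rewrite e3 (prod_shift _ m (2 * m)) /B -prod_fact.
  apply: (cg_prod p_prime) => j jm; [by rewrite /num /a; pin|by pin|].
  apply: (@cg_intro _ _ _ (1 / 6 - ep)).
    by rewrite (_ : 6 = 2 * 3) ?invfM; [pin | ring].
  by rewrite /num /a natrD pE; field.
have pd1 : pint (\prod_(0 <= i < 3 * m) den1 i) by apply: pint_prod => // i _; rewrite /den1 /a; pin.
have pd2 : pint (\prod_(0 <= i < 3 * m) den2 i) by apply: pint_prod => // i _; rewrite /den2; pin.
have M1 : cg 1 (\prod_(0 <= i < 3 * m) den1 i) ((- 1) ^+ (3 * m) * A).
  have -> : (- 1) ^+ (3 * m) * A = \prod_(0 <= j < 3 * m) - ((3 * m)%:R - j%:R).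
    by rewrite prod_opp prod_falling // subnn divr1.
  apply: (cg_prod p_prime) => j jm; [by rewrite /den1 /a; pin|by pin|].
  apply: (@cg_intro _ _ _ (1 / 2 - ep)); first by pin.
  by rewrite /den1 /a pE; field.
have M2 : cg 1 (\prod_(0 <= i < 3 * m) den2 i)
    ((- 1) ^+ (3 * m) * (D4 / (4 * m%:R) / (C / m%:R))).
  have -> : (- 1) ^+ (3 * m) * (D4 / (4 * m%:R) / (C / m%:R))
      = \prod_(0 <= j < 3 * m) - ((4 * m).-1%:R - j%:R).
    rewrite prod_opp prod_falling; last by lia.
    by rewrite fact_pred4 (_ : (4 * m).-1 - 3 * m = m.-1)%N ?fact_pred //; lia.
  apply: (cg_prod p_prime) => j jm; [by rewrite /den2; pin|by pin|].
  have e1 : (4 * m).-1%:R = 4 * m%:R - 1 :> F.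
    by rewrite -natrM -[in RHS](prednK (_ : 0 < 4 * m)%N) ?muln_gt0 ?m_pos // -natr1 addrK.
  by apply: (@cg_intro _ _ _ (2 / 3)); [pin | rewrite /den2 e1 pE; field].
have ps : pint ((- 1) ^+ (3 * m)) by pin.
have s2 : (- 1) ^+ (3 * m) * (- 1) ^+ (3 * m) = 1 :> F by rewrite -expr2 sqrr_sign.
set sn := (- 1) ^+ (3 * m) in M1 M2 ps s2.
have sn0 : sn != 0 by rewrite /sn signr_eq0.
have sV : sn^-1 = sn by apply: (mulfI sn0); rewrite mulfV // s2.
have psn' : pint sn^-1 by rewrite sV.
have a1 : sn * A != 0 by apply: mulf_neq0.
have a2 : sn * (D4 / (4 * m%:R) / (C / m%:R)) != 0.
  by rewrite mulf_neq0 // mulf_neq0 ?invr_neq0 ?mulf_neq0 ?invr_neq0.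
have i4 : pint 4^-1 by rewrite (_ : 4 = 2 * 2) ?invfM; [pin | ring].
have b1 : pint (sn * A)^-1 by rewrite invfM; pin.
have e2 : (sn * (D4 / (4 * m%:R) / (C / m%:R)))^-1 = sn * 4 * C * D4^-1.
  rewrite invfM sV -!mulrA; congr (_ * _); by fld.
have b2 : pint (sn * (D4 / (4 * m%:R) / (C / m%:R)))^-1 by rewrite e2; pin.
have [q1 h1] := cg1_unit p_prime a1 b1 M1; have [q2 h2] := cg1_unit p_prime a2 b2 M2.
rewrite e2 in h2; rewrite invfM sV in h1.
have pN1 : pint (\prod_(0 <= i < m.-1) num i) by apply: pint_prod => // i _; rewrite /num /a; pin.
have pN2 : pint (\prod_(m <= i < 3 * m) num i) by apply: pint_prod => // i _; rewrite /num /a; pin.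
have T : cg 1 rest (A * (- sg * (C / m%:R) * B) * (sn * A^-1 * (sn * 4 * C * D4^-1))).
  rewrite /rest invfM; apply: cgM; [by []|by pin|by pin| |].
  - by apply: cgMl => //; apply: cgM => //; pin.
  - by apply: cgM => //; pin.
apply: (cg_trans p_prime T).
have [c1 pc1 /eqP] := fact_ratio_inv; rewrite subr_eq => /eqP e1.
have [c2' pc2 /eqP] := wallis_inv; rewrite subr_eq => /eqP e3.
have -> : A * (- sg * (C / m%:R) * B) * (sn * A^-1 * (sn * 4 * C * D4^-1))
  = - 4 * (sn * sn) * sg * C ^+ 2 * B / m%:R * D4^-1 by fld.
rewrite s2 e1 e3.
apply: (@cg_intro _ _ _ (- 4 * sg * C ^+ 2 * B / m%:R * c1 - 24 * c2'
   - 4 * (C * B * A^-1) ^+ 2 * m%:R^-1)); first by pin.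
transitivity (- 4 * C ^+ 2 * B / m%:R * (sg * (P * c1) + (sg * sg) * B / A ^+ 2)); first by fld.
by rewrite sg2 pE; fld.
Qed.

(** The head contributes 24 (1/12 - eps/2) and the pole of the tail, at 4m,
    contributes 36 eps/4, both over w^2. *)
Lemma sum2_6m1 : cg 3 (sum2 s p) (P ^+ 2 * ((2 - 3 * ep) / w ^+ 2)).
Proof.
have i4 : pint 4^-1 by rewrite (_ : 4 = 2 * 2) ?invfM; [pin | ring].
have -> : sum2 s p = \sum_(0 <= k < (3 * m).+1) P * sum_term s P k / (3 * k%:R + 2%:R)
   + \sum_((3 * m).+1 <= k < p) P * sum_term s P k / (3 * k%:R + 2%:R).
  by rewrite /sum2 (big_cat_nat (n := (3 * m).+1)) //; lia.
have q1 : (3 * m < 4 * m < p)%N by have := m_pos; lia.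
have q2 : (3 * (4 * m) + 2 = 2 * p)%N by lia.
have T := @tail_pole F p _ p_prime p_gt3 pE2 eps 2 (4 * m) isT q1 q2.
have q3 k : (k <= 3 * m)%N -> ~~ (p %| 3 * k + 2)%N.
  by move=> km; apply/negP => /dvdnP[[|[|z]]]; move: km m_pos; rewrite pE; clear; lia.
have Hd := @head_nopole F p _ p_prime p_gt3 pE2 eps 2 isT q3.
apply: (cg_trans p_prime (cgD p_prime Hd T)); rewrite -/a head_sum2.
have [c1 pc1 /eqP] := rest_val; rewrite subr_eq => /eqP e1.
have [c2 pc2 /eqP] := tail_sum2; rewrite subr_eq => /eqP e2.
rewrite e1 e2 -/ep; apply: (@cg_intro _ _ _ ((1 / 12 - ep / 2) * c1 + ep / 4 * c2)).
  by rewrite (_ : 12 = 3 * 4) ?invfM; [pin | ring].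
by fld.
Qed.

End Eps.
End CaseOne.

(** * Primes p = 6m + 5 *)

Section CaseTwo.

Variables (F : numFieldType) (p m : nat).
Hypotheses (p_prime : prime p) (p_gt3 : (3 < p)%N) (pE : p = (6 * m + 5)%N).
Local Notation P := (p%:R : F).
Local Notation pint := (@pint F p).
Local Notation cg := (@cg F p).
Local Notation lg := (@lg F p).
Local Notation H := (harm F).
Local Notation H2 := (harm2 F).
Local Notation O := (oddharm F).
Local Notation O2 := (oddharm2 F).

Let n := (3 * m + 2)%N.
Let q := (2 * m + 1)%N.

Let i2 : pint 2^-1 := pint_half F p_prime p_gt3.
Let i3 : pint 3^-1 := pint_third F p_gt3.
Let pE2 : p = (2 * n).+1. Proof. by rewrite pE /n; lia. Qed.
Let qn : (q <= n)%N. Proof. by rewrite /q /n; lia. Qed.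
Let np : (n < p)%N. Proof. by rewrite pE2; lia. Qed.
Let qp : (q < p)%N. Proof. exact: leq_ltn_trans qn np. Qed.

Lemma fact_reflect k l : (k + l).+1 = p ->
  (k + l)`!%:R = k`!%:R * ((- 1) ^+ l * l`!%:R
     * \prod_(0 <= i < l) (1 + P * (- 1 * (i%:R + 1)^-1))) :> F.
Proof.
move=> kl; rewrite fact_split; congr (_ * _).
rewrite -mulrA -prod_fact -big_split -prod_scale [LHS]prod_rev; apply: eq_big_nat => i il /=; have h := natrS_neq0 F i.
by rewrite -kl -natr1 !natrD natrB; [fld | lia].
Qed.

Lemma fact_parity k : (2 * k)`!%:R = 2 ^+ k * k`!%:R * \prod_(0 <= j < k) (2 * j%:R + 1) :> F.
Proof.
elim: k => [|k IH]; first by rewrite big_geq // !mulr1.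
rewrite (_ : 2 * k.+1 = (2 * k).+2)%N; last by lia.
by rewrite !factS !natrM IH big_nat_recr //= exprS; ring.
Qed.

Lemma fact_mod3 k : (3 * k + 1)`!%:R = 3 ^+ k * k`!%:R
   * \prod_(0 <= j < k.+1) (3 * j%:R + 1) * \prod_(0 <= j < k) (3 * j%:R + 2) :> F.
Proof.
elim: k => [|k IH]; first by rewrite big_nat1 big_geq // muln0 expr0; ring.
rewrite (_ : 3 * k.+1 + 1 = (3 * k + 1).+3)%N; last by lia.
rewrite !factS !natrM IH [X in _ = _ * X]big_nat_recr // [X in _ = _ * X * _]big_nat_recr //=.
by rewrite exprS; ring.
Qed.

(** Compare two computations of (2n)! = (p-1)!: reflecting the upper half, and
    separating even from odd factors, then reflecting the odd ones. *)
Lemma two_power : 2 ^+ (2 * n) = (\prod_(0 <= i < n) (1 + P * (- 1 * (i%:R + 1)^-1)))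
   / (\prod_(0 <= i < n) (1 + P * (- (1 / 2) * (i%:R + 1)^-1))) :> F.
Proof.
set X := \prod_(0 <= i < n) _; set Y := \prod_(0 <= i < n) _.
have [Y0 _] : Y != 0 /\ pint Y^-1.
  by apply: (lg_unit p_prime p_gt3 (lg_prod_inv p_prime p_gt3 _ np _)); pin.
have f0 := factr_neq0 F n.
have e1 : (2 * n)`!%:R = n`!%:R * ((- 1) ^+ n * n`!%:R * X) :> F.
  by rewrite mul2n -addnn fact_reflect // addnn -mul2n.
have e2 : \prod_(0 <= j < n) (2 * j%:R + 1) = (- 2) ^+ n * n`!%:R * Y.
  rewrite -mulrA -prod_fact -big_split -prod_scale [LHS]prod_rev.
  apply: eq_big_nat => i il /=; have h := natrS_neq0 F i.
  by rewrite pE2 natrB; [fld | lia].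
have := fact_parity n; rewrite e1 e2 => e3.
have s0 : (- 1) ^+ n != 0 :> F by rewrite signr_eq0.
apply: (mulfI (mulf_neq0 (mulf_neq0 s0 (mulf_neq0 f0 f0)) Y0)).
transitivity (n`!%:R * ((- 1) ^+ n * n`!%:R * X)); last by fld.
rewrite e3 mul2n -addnn exprD (_ : - 2 = - 1 * 2) ?exprMn; last by ring.
by ring.
Qed.

(** As in [two_power], with the factors of (p-1)! separated modulo 3. *)
Lemma three_power : 3 ^+ (6 * m + 4) = (\prod_(0 <= i < q) (1 + P * (- 1 * (i%:R + 1)^-1)))
   / ((\prod_(0 <= i < q) (1 + P * (- (1 / 3) * (i%:R + 1)^-1)))
      * (\prod_(q <= i < q + q.+1) (1 + P * (- (2 / 3) * (i%:R + 1)^-1)))) :> F.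
Proof.
set X := \prod_(0 <= i < q) _; set Y := \prod_(0 <= i < q) _.
set Z := \prod_(q <= i < _) _.
have eP : P = 3 * q%:R + 2 by rewrite pE /q; ring.
have qqp : (q + q.+1 < p)%N by rewrite pE /q; lia.
have [Y0 _] : Y != 0 /\ pint Y^-1.
  by apply: (lg_unit p_prime p_gt3 (lg_prod_inv p_prime p_gt3 _ qp _)); pin.
have [Z0 _] : Z != 0 /\ pint Z^-1.
  by apply: (lg_unit p_prime p_gt3 (lg_prod_inv p_prime p_gt3 _ qqp _)); pin.
have f0 := factr_neq0 F q; have f1 := factr_neq0 F (q + q.+1).
have e1 : (3 * q + 1)`!%:R = (q + q.+1)`!%:R * ((- 1) ^+ q * q`!%:R * X) :> F.
  have e0 : (3 * q + 1 = q + q.+1 + q)%N by lia.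
  by rewrite e0 fact_reflect //; rewrite pE /q; lia.
have e2 : \prod_(0 <= j < q) (3 * j%:R + 2) = (- 3) ^+ q * q`!%:R * Y.
  rewrite -mulrA -prod_fact -big_split -prod_scale [LHS]prod_rev.
  apply: eq_big_nat => i il /=; have h := natrS_neq0 F i.
  by rewrite eP natrB; [fld | lia].
have e3 : \prod_(0 <= j < q.+1) (3 * j%:R + 1) * q`!%:R = (- 3) ^+ q.+1 * (q + q.+1)`!%:R * Z.
  rewrite (fact_split F q q.+1) /Z prod_shift; set U := \prod_(0 <= j < q.+1) ((q + j)%:R + 1).
  set V := \prod_(0 <= j < q.+1) (1 + _).
  transitivity (q`!%:R * ((- 3) ^+ q.+1 * (U * V))); last by ring.
  rewrite [LHS]mulrC; congr (_ * _).
  rewrite /U /V -big_split -prod_scale [LHS]prod_rev.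
  apply: eq_big_nat => i il /=.
  have h : q%:R + i%:R + 1 != 0 :> F by rewrite -natrD natr1 pnatr_eq0.
  by rewrite eP natrD natrB; [fld | lia].
have e4 : (3 * q + 1)`!%:R = 3 ^+ q * ((- 3) ^+ q.+1 * (q + q.+1)`!%:R * Z)
    * ((- 3) ^+ q * q`!%:R * Y) by rewrite fact_mod3 -e3 e2; ring.
have s0 : (- 1) ^+ q != 0 :> F by rewrite signr_eq0.
have s2 : (- 1) ^+ q * (- 1) ^+ q = 1 :> F by rewrite -expr2 sqrr_sign.
have s3 : (- 1) ^+ q = - 1 :> F by rewrite /q addn1 exprS exprM sqrrN expr1n expr1n mulr1.
have c0 : - ((q + q.+1)`!%:R * q`!%:R * Y * Z) != 0 :> F by rewrite oppr_eq0 !mulf_neq0.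
apply: (mulfI c0).
transitivity ((q + q.+1)`!%:R * ((- 1) ^+ q * q`!%:R * X)); last by rewrite s3; fld.
rewrite -e1 e4 (_ : - 3 = - 1 * 3 :> F) ?exprMn; last by ring.
rewrite (_ : 6 * m + 4 = q + q.+1 + q)%N; last by rewrite /q; lia.
rewrite (exprD _ (q + q.+1) q) (exprD _ q q.+1) (exprS 3 q) (exprS (- 1) q) s3; ring.
Qed.

Let pHq : pint (H q). Proof. exact: (pint_harm F p_prime p_gt3 pE2 qp). Qed.
Let pHn : pint (H n). Proof. exact: (pint_harm F p_prime p_gt3 pE2 np). Qed.

(** The Fermat quotient of 2 is - H(n) / 2 modulo p. *)
Lemma harm_fermat2 : cg 2 (P * H n) (- 2 * (2 ^+ p.-1 - 1)).
Proof.
have ph : pint (- (1 / 2)) by pin.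
have L1 := lg_prod_inv p_prime p_gt3 0 np (pintN (pint1 F p_prime)).
have L2 := lg_prod_inv p_prime p_gt3 0 np ph.
have L : cg 2 (2 ^+ (2 * n)) (1 + P * (- (1 / 2) * H n)).
  rewrite two_power.
  apply: (lg_cg2 p_prime p_gt3 (lgM p_prime p_gt3 L1 (lgV p_prime p_gt3 L2))); first by pin.
  by apply: cg_eq => //; rewrite /harm; field.
have -> : p.-1 = (2 * n)%N by rewrite pE2.
have [c pc /eqP] := L; rewrite subr_eq => /eqP ->.
by apply: (@cg_intro _ _ _ (2 * c)); [pin | field].
Qed.

Lemma harm_2q1 : cg 1 (H (q + q.+1)) (H q).
Proof.
have := harm_mirror F p_prime p_gt3 pE2 qp; rewrite (_ : 2 * n - q = q + q.+1)%N; last first.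
  by rewrite /n /q; lia.
move=> h; apply: (cg_trans p_prime (cg_weak p_prime (isT : (1 <= 2)%N) h)).
by apply: (@cg_intro _ _ _ (H2 q)); [exact: (pint_harm2 F p_prime p_gt3 pE2 qp) | ring].
Qed.

(** The Fermat quotient of 3 is - (2/3) H(q) modulo p. *)
Lemma harm_fermat3 : cg 2 (P * H q) (- (3 / 2) * (3 ^+ p.-1 - 1)).
Proof.
have pt : pint (- (1 / 3)) by pin.
have pt2 : pint (- (2 / 3)) by pin.
have qqp : (q + q.+1 < p)%N by rewrite pE /q; lia.
have L1 := lg_prod_inv p_prime p_gt3 0 qp (pintN (pint1 F p_prime)).
have L2 := lg_prod_inv p_prime p_gt3 0 qp pt.
have L3 := lg_prod_inv p_prime p_gt3 q qqp pt2.
rewrite sum_tail_harm ?leq_addr // in L3.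
have V := lgV p_prime p_gt3 (lgM p_prime p_gt3 L2 L3).
have L : cg 2 (3 ^+ (6 * m + 4)) (1 + P * (- (2 / 3) * H q)).
  rewrite three_power.
  apply: (lg_cg2 p_prime p_gt3 (lgM p_prime p_gt3 L1 V)); first by pin.
  have [c pc /eqP] := harm_2q1; rewrite subr_eq => /eqP ->.
  by apply: (@cg_intro _ _ _ (2 / 3 * c)); [pin | rewrite -/(harm F q); field].
have -> : p.-1 = (6 * m + 4)%N by rewrite pE; lia.
have [c pc /eqP] := L; rewrite subr_eq => /eqP ->.
by apply: (@cg_intro _ _ _ (3 / 2 * c)); [pin | field].
Qed.

Lemma harm_q1 : H q.+1 = H q + 3 - P * (q%:R + 1)^-1.
Proof.
have h := natrS_neq0 F q; rewrite harmS -addrA; congr (_ + _).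
have -> : P = 3 * q%:R + 2 by rewrite pE /q; ring.
by fld.
Qed.

Let pq1 : pint (q%:R + 1)^-1.
Proof. by apply: pint_e; rewrite pE /q; lia. Qed.

Lemma oddharm_q : cg 1 (O q) (H q + 6).
Proof.
rewrite oddharm_split; have q1p : (q.+1 < p)%N by rewrite pE /q; lia.
have := harm_mirror F p_prime p_gt3 pE2 q1p; rewrite (_ : 2 * n - q.+1 = 2 * q)%N; last first.
  by rewrite /n /q; lia.
move=> [c pc /eqP]; rewrite subr_eq => /eqP ->; rewrite harm_q1.
have pH := pint_harm2 F p_prime p_gt3 pE2 q1p.
apply: (@cg_intro _ _ _ (2 * (P * c + H2 q.+1 - (q%:R + 1)^-1))); first by pin.
by ring.
Qed.

Lemma nq : (n - q = m.+1)%N. Proof. by rewrite /n /q; lia. Qed.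

Lemma harm_m1 : cg 1 (H m.+1) (H n + H q + 6).
Proof.
have [c1 pc1 /eqP] := oddharm_reflect F p_prime p_gt3 pE2 qn; rewrite subr_eq nq => /eqP e1.
have [c2 pc2] := oddharm_q; rewrite e1 => e2.
have mp : (m.+1 < p)%N by rewrite pE; lia.
have p1 := pint_harm2 F p_prime p_gt3 pE2 mp; have p2 := pint_harm2 F p_prime p_gt3 pE2 np.
apply: (@cg_intro _ _ _ (c2 - P * c1 + (H2 n - H2 m.+1) / 2)); first by pin.
rewrite !mulrDr -e2; by field.
Qed.

Lemma oddharm_m1 : cg 1 (O m.+1) (H q - H n).
Proof.
rewrite oddharm_split (_ : 2 * m.+1 = q.+1)%N ?harm_q1; last by rewrite /q; lia.
have [c pc /eqP] := harm_m1; rewrite subr_eq => /eqP ->.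
apply: (@cg_intro _ _ _ (- c - 2 * (q%:R + 1)^-1)); first by pin.
by ring.
Qed.

Let Bn : F := 'C(n, m)%:R.

(** C(n, q) = 2 C(n, m), and n - j = - (j + 1/2) (1 - (p/2) / (j + 1/2)). *)
Lemma wallis_binomial : wallis F q ^+ 2 = 4 * Bn ^+ 2 *
  (\prod_(0 <= j < q) hyp_factor p (- (1 / 2) : F) 0 0 0 0 0 0 j) ^- 2.
Proof.
have e1 : 'C(n, q)%:R = 2 * Bn.
  have h : m%:R + 1 != 0 :> F by exact: natrS_neq0.
  apply: (mulfI h); rewrite /Bn natr1.
  have -> : 'C(n, q) = 'C(n, m.+1) by rewrite -bin_sub ?nq // -{2}nq subKn.
  by rewrite binr_bot -natr1 /n; ring.
have p0 := pint0 F p_prime.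
have L := lg_hyp (n := n) p_prime p_gt3 pE2 qn.
have {}L := L F (- (1 / 2)) 0 0 0 0 0 0 ltac:(pin) p0 p0 p0 p0 p0 p0.
have [Y0 _] := lg_unit p_prime p_gt3 L.
have e2 : 'C(n, q)%:R = (- 1) ^+ q * (wallis F q *
    \prod_(0 <= j < q) hyp_factor p (- (1 / 2) : F) 0 0 0 0 0 0 j).
  rewrite binr_prod -big_split -prod_scale; apply: eq_bigr => j _.
  have h := natrS_neq0 F j; have h1 := halfn0 F j.
  have h3 : j%:R * 2 + 1 != 0 :> F by rewrite -natrM natr1 pnatr_eq0.
  have h4 : 2 * j%:R + 1 != 0 :> F by rewrite -natrM natr1 pnatr_eq0.
  rewrite /= /hyp_factor !mul0r !mulr0 !addr0 !invr1 !mulr1 (nP F pE2); fld.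
move: Y0 e2; set Y := \prod_(_ <= j < _) hyp_factor _ _ _ _ _ _ _ _ _ => Y0 e2.
have -> : 4 * Bn ^+ 2 = (2 * Bn) ^+ 2 by ring.
by rewrite -e1 e2 !exprMn sqrr_sign mul1r mulfK // expf_neq0.
Qed.

Section Eps.
Variable (eps : bool).
Let ep : F := eps%:R.
Let s := 2 * ep - 1.
Let a := 1 / 2 + ep * P.
Let pe : pint ep. Proof. exact: pint_nat. Qed.

Definition R3F : F :=
  (1 + 2 * P + 4 / 3 * (2 ^+ p.-1 - 1) - 3 / 2 * (3 ^+ p.-1 - 1)) * Bn ^+ 2.

(** Here 3q + 2 = p. The square of the binomial coefficient absorbs part of the
    logarithm; what is left is made of H(n) and H(q), that is, of the Fermat
    quotients in R3. *)
Lemma sum2_6m5 : cg 2 (sum2 s p) (4 * (R3F + P * (6 * ep - 3) * Bn ^+ 2)).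
Proof.
have qE : (3 * q + 2 = p)%N by rewrite pE /q; lia.
have -> : sum2 s p = \sum_(0 <= k < n.+1) P * sum_term s P k / (3 * k%:R + 2%:R)
   + \sum_(n.+1 <= k < p) P * sum_term s P k / (3 * k%:R + 2%:R).
  by rewrite /sum2 (big_cat_nat (n := n.+1)).
have T : cg 3 (\sum_(n.+1 <= k < p) P * sum_term s P k / (3 * k%:R + 2%:R)) 0.
  apply: (@tail_nopole F p _ p_prime p_gt3 pE2 eps 2 isT) => k; rewrite /n => kn.
  apply/negP => /dvdnP[[|[|[|z]]]]; move: kn; rewrite pE; clear; lia.
have Hd := @head_pole F p _ p_prime p_gt3 pE2 eps 2 q isT qn qE.
have pO2 := pint_oddharm2 F p_prime p_gt3 pE2 qn.
have pH2 := pint_harm2 F p_prime p_gt3 pE2 qp.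
have pwl := pint_wallis F p_prime p_gt3 pE2 qp.
have i4 : pint 4^-1 by rewrite (_ : 4 = 2 * 2) ?invfM; [pin | ring].
have {T}Hd := cg_weak p_prime (isT : (2 <= 3)%N) (cgD p_prime Hd T).
apply: (cg_trans p_prime Hd).
rewrite (head_prod F p_gt3 pE2 eps (r := 2) isT qn qE) -/ep nq.
have := head_prod_log F p_prime p_gt3 pE2 eps qn.
rewrite -/ep nq; set X := _ * _ => L.
have p0 := pint0 F p_prime.
have L2 := lg_hyp (n := n) p_prime p_gt3 pE2 qn.
have {}L2 := L2 F (- (1 / 2)) 0 0 0 0 0 0 ltac:(pin) p0 p0 p0 p0 p0 p0.
have L3 := lgV p_prime p_gt3 L2; move: L3 (wallis_binomial).
set Y := \prod_(0 <= j < q) hyp_factor _ (- _) _ _ _ _ _ _ _ => L3 eW.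
have {L L2 L3} : cg 2 (X * (Y^-1 * Y^-1)) (1 + P * (6 * ep - 1 - 2 / 3 * H n + H q)).
  apply: (lg_cg2 p_prime p_gt3 (lgM p_prime p_gt3 L (lgM p_prime p_gt3 L3 L3))); first by pin.
  have [c1 pc1 /eqP] := oddharm_q; rewrite subr_eq => /eqP ->.
  have [c2 pc2 /eqP] := oddharm_m1; rewrite subr_eq => /eqP ->.
  have [c3 pc3 /eqP] := harm_m1; rewrite subr_eq => /eqP ->.
  apply: (@cg_intro _ _ _ (- (5 / (2 * 3) - ep) * c1 + 1 / 3 * (c2 - c3) + c1)).
    by rewrite invfM; pin.
  by field.
move=> [c pc /eqP]; rewrite subr_eq => /eqP eX.
have [c1 pc1 /eqP] := harm_fermat2; rewrite subr_eq => /eqP e1.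
have [c2 pc2 /eqP] := harm_fermat3; rewrite subr_eq => /eqP e2.
have pB : pint Bn by apply: pint_nat.
apply: (@cg_intro _ _ _ (wallis F q ^+ 2 * (ep / 2 * O2 q - 3 / 4 * H2 q)
  + 4 * Bn ^+ 2 * (c - 2 / 3 * c1 + c2))); first by pin.
have -> : wallis F q ^+ 2 * X = 4 * Bn ^+ 2 * (X * (Y^-1 * Y^-1)).
  by rewrite eW -expr2 -exprVn mulrAC mulrA.
rewrite eX.
transitivity (4 * Bn ^+ 2 * (P ^+ 2 * c + (1 + P * (6 * ep - 1)) - 2 / 3 * (P * H n) + P * H q)
  + P ^+ 2 * (wallis F q ^+ 2 * (eps%:R / 2 * O2 q - 3 / 4 * H2 q))); first by ring.
by rewrite e1 e2 /R3F -/ep; field.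
Qed.

(** The pole at 4m + 3 lies beyond n, where the terms are divisible by p^2. In the
    head no denominator is divisible by p, while the numerator at i = m is. *)
Lemma sum1_6m5 : cg 2 (sum1 s p) 0.
Proof.
have -> : sum1 s p = \sum_(0 <= k < n.+1) P * sum_term s P k / (3 * k%:R + 1%:R)
   + \sum_(n.+1 <= k < p) P * sum_term s P k / (3 * k%:R + 1%:R).
  by rewrite /sum1 (big_cat_nat (n := n.+1)).
have i4 : pint 4^-1 by rewrite (_ : 4 = 2 * 2) ?invfM; [pin | ring].
have q1 : (n < 4 * m + 3 < p)%N by rewrite /n pE; lia.
have q2 : (3 * (4 * m + 3) + 1 = 2 * p)%N by rewrite pE; lia.
have T := @tail_pole F p _ p_prime p_gt3 pE2 eps 1 _ isT q1 q2.
have {}T : cg 2 (\sum_(n.+1 <= k < p) P * sum_term s P k / (3 * k%:R + 1%:R)) 0.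
  apply: (cg_trans p_prime (cg_weak p_prime (isT : (2 <= 3)%N) T)).
  have kp : (4 * m + 3 < p)%N by case/andP: q1.
  have pt := pint_tail_term F p_prime p_gt3 pE2 eps kp.
  by apply: (@cg_intro _ _ _ (eps%:R / 4 * tail_term F p n eps (4 * m + 3))); [pin | ring].
have q3 k : (k <= n)%N -> ~~ (p %| 3 * k + 1)%N.
  rewrite /n => kn; apply/negP => /dvdnP[[|[|z]]]; move: kn; rewrite pE; clear; lia.
have Hd := @head_nopole F p _ p_prime p_gt3 pE2 eps 1 isT q3.
rewrite -[X in cg _ _ X]addr0; apply: cgD => //.
apply: (cg_trans p_prime (cg_weak p_prime (isT : (2 <= 3)%N) Hd)).
rewrite (thirds_sum _ _ _ (isT : (0 < 1)%N)).
rewrite (partial_fractions (a_nonint F p_gt3 pE2 eps) n (fun k => third_neq F k (isT : (0 < 1)%N))).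
rewrite -/ep -/a; have mn : (m < n)%N by rewrite /n; lia.
pose g (i : nat) : F := (i%:R + 1) * (1 / 3 + i%:R + 1 - a) / ((i%:R + 1 - a) * (1 / 3 + i%:R + 1)).
have pden i : (i < n)%N -> pint ((i%:R + 1 - a)^-1) /\ pint ((1 / 3 + i%:R + 1)^-1).
  move=> il; split.
    have po := pint_o F p_prime p_gt3 pE2 il; have h := halfn0 F i.
    have pc : pint (- ep * (i%:R + 1 / 2)^-1) by pin.
    have [_ pu] := pint_unit1 pc.
    have -> : i%:R + 1 - a = (i%:R + 1 / 2) * (1 + P * (- ep * (i%:R + 1 / 2)^-1)).
      have h3 : i%:R * 2 + 1 != 0 :> F by rewrite -natrM natr1 pnatr_eq0.
      by rewrite /a; fld.
    by rewrite invfM; pin.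
  have -> : (1 / 3 + i%:R + 1)^-1 = 3 * (3 * i.+1 + 1)%:R^-1 :> F.
    have h3 : (3 * i.+1 + 1)%:R != 0 :> F by rewrite pnatr_eq0 addn1.
    have e : 1 / 3 + i%:R + 1 = (3 * i.+1 + 1)%:R / 3 :> F by field.
    by rewrite e invf_div.
  by pin; apply: pintV_nat; apply: q3.
have pg i : (i < n)%N -> pint (g i).
  by move=> il; have [u1 u2] := pden i il; rewrite /g invfM /a; pin.
pose K := \prod_(0 <= i < m) g i *
     ((m%:R + 1) * (1 / (2 * 3) - ep) * ((m%:R + 1 - a)^-1 * (1 / 3 + m%:R + 1)^-1)) *
      \prod_(m.+1 <= i < n) g i.
have -> : \prod_(0 <= i < n) g i = P * K.
  rewrite (big_cat_nat (n := m)) ?(ltnW mn) //= [X in _ * X]big_ltn //.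
  have eg : g m = P * ((m%:R + 1) * (1 / (2 * 3) - ep)
      * ((m%:R + 1 - a)^-1 * (1 / 3 + m%:R + 1)^-1)).
    have e1 : 1 / 3 + m%:R + 1 - a = P * (1 / (2 * 3) - ep) by rewrite /a pE; field.
    by rewrite /g e1 (invfM (m%:R + 1 - a)); ring.
  by rewrite eg /K; ring.
have pG1 : pint (\prod_(0 <= i < m) g i) by apply: pint_prod => // i im; apply: pg; lia.
have pG2 : pint (\prod_(m.+1 <= i < n) g i) by apply: pint_prod => // i im; apply: pg; lia.
have [u1 u2] := pden m mn.
have pK : pint K by rewrite /K invfM; pin.
apply: (@cg_intro _ _ _ K) => //.
by move: K {pK} => K; field.
Qed.

End Eps.
End CaseTwo.

(** * The value of the Jacobi sum *)

(** Eight times a Jacobi sum modulo p^3, see [jac_coef]: the constant 8 clears the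
    denominators of the coefficients 15/8, -10/8 and 3/8 of [phi_interpolation]. *)
Definition jacobi_int (p n q : nat) : int :=
  (p%:Z - 1) * (15 * 'C(n, q)%:Z
    - 10 * ('C(n + p.-1, q)%:Z + 'C(n + p.-1, q + p.-1)%:Z)
    + 3 * ('C(n + 2 * p.-1, q)%:Z + 'C(n + 2 * p.-1, q + p.-1)%:Z
           + 'C(n + 2 * p.-1, q + 2 * p.-1)%:Z)).

Section JacobiValue.

Variables (F : numFieldType) (p m : nat).
Hypotheses (p_prime : prime p) (p_gt3 : (3 < p)%N) (pE : p = (6 * m).+1).
Local Notation P := (p%:R : F).
Local Notation pint := (@pint F p).
Local Notation cg := (@cg F p).
Local Notation lg := (@lg F p).
Local Notation H := (harm F).
Local Notation H2 := (harm2 F).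
Local Notation O := (oddharm F).
Local Notation O2 := (oddharm2 F).

Let i2 : pint 2^-1 := pint_half F p_prime p_gt3.
Let i3 : pint 3^-1 := pint_third F p_gt3.
Let pE2 : p = (2 * (3 * m)).+1. Proof. by rewrite pE mulnA. Qed.
Let m0 : (0 < m)%N. Proof. exact: (m_pos p_gt3 pE). Qed.
Let i4 : pint 4^-1. Proof. by rewrite (_ : 4 = 2 * 2) ?invfM; [pin | ring]. Qed.
Let i8 : pint 8^-1. Proof. by rewrite (_ : 8 = 2 * 4) ?invfM; [pin | ring]. Qed.

Let n := (3 * m)%N.
Let q := (2 * m)%N.
Let h := H n.
Let b := H q.
Let d := H2 q.
Let v := wallis F q.

Let ph : pint h. Proof. by apply: (pint_harm F p_prime p_gt3 pE2); rewrite /n; lia. Qed.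
Let pb : pint b. Proof. by apply: (pint_harm F p_prime p_gt3 pE2); rewrite /q; lia. Qed.
Let pd : pint d. Proof. by apply: (pint_harm2 F p_prime p_gt3 pE2); rewrite /q; lia. Qed.
Let p0 : pint 0 := pint0 F p_prime.
Let qn : (q <= n)%N. Proof. by rewrite /q /n; lia. Qed.
Let np : (n < p)%N. Proof. by rewrite /n; lia. Qed.
Let qp : (q < p)%N. Proof. by rewrite /q; lia. Qed.
Let mp : (m < p)%N. Proof. by lia. Qed.

(** The change of C(n, q) when c p is added to n, together with its deviation
    from the value of [wallis]. *)
Definition upper_shift (c : F) : F :=
  \prod_(0 <= j < q) hyp_factor p (- (c + 1 / 2)) 0 0 0 0 0 0 j.

Lemma bin_upper c : 'C(n + c * p, q)%:R = v * upper_shift c%:R.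
Proof.
rewrite binr_prod /upper_shift /v /wallis -big_split /=.
have s1 : (- 1) ^+ q = 1 :> F by rewrite /q exprM sqrrN !expr1n.
rewrite -[RHS]mul1r -[X in _ = X * _]s1 -prod_scale; apply: eq_bigr => j _.
have h0 := natrS_neq0 F j; have h1 := halfn0 F j.
have h3 : j%:R * 2 + 1 != 0 :> F by rewrite -natrM natr1 pnatr_eq0.
have h4 : 2 * j%:R + 1 != 0 :> F by rewrite -natrM natr1 pnatr_eq0.
rewrite /hyp_factor !mul0r !mulr0 !addr0 !invr1 !mulr1 natrD natrM (nP F pE2).
by fld.
Qed.

Lemma lg_upper c : pint c ->
  lg (upper_shift c) (- (c + 1 / 2) * b)
     ((5 / 2 * (c + 1 / 2) ^+ 2 - 2 * (c + 1 / 2)) * d).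
Proof.
move=> pc; have L := lg_hyp (n := n) p_prime p_gt3 pE2 qn.
have {}L := L F (- (c + 1 / 2)) 0 0 0 0 0 0 ltac:(pin) p0 p0 p0 p0 p0 p0.
rewrite mulrBl; apply: (lg_shift p_prime p_gt3 L); try by pin.
  have [c1 pc1 /eqP] := harm_4m F p_prime p_gt3 pE; rewrite subr_eq => /eqP e1.
  rewrite oddharm_split (_ : 2 * q = 4 * m)%N ?e1; last by rewrite /q; lia.
  apply: (@cg_intro _ _ _ (- (c + 1 / 2) * 2 * c1)); first by pin.
  by rewrite -/q -/b -/d; field.
have [c1 pc1 /eqP] := harm2_4m F p_prime p_gt3 pE; rewrite subr_eq => /eqP e1.
rewrite oddharm2_split (_ : 2 * q = 4 * m)%N ?e1; last by rewrite /q; lia.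
apply: (@cg_intro _ _ _ (- (c + 1 / 2) ^+ 2 / 2 * 4 * c1)); first by pin.
by rewrite -/q -/d; field.
Qed.

(** The change of C(n, m) when c p is added to n. *)
Definition mid_shift (c : F) : F := \prod_(q <= i < n) (1 + P * (c * (i%:R + 1)^-1)).

Lemma bin_complement c : 'C(n + c * p, m)%:R = 'C(n, q)%:R * mid_shift c%:R.
Proof.
rewrite -(bin_sub qn) (_ : n - q = m)%N; last by rewrite /n /q; lia.
have -> : mid_shift c%:R = \prod_(0 <= j < m) (1 + P * (c%:R * ((q + (m - j.+1))%:R + 1)^-1)).
  rewrite /mid_shift (_ : n = q + m)%N; last by rewrite /n /q; lia.
  rewrite (prod_shift _ q m) prod_rev //.
rewrite !binr_prod -big_split; apply: eq_big_nat => j jm /=.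
have h0 := natrS_neq0 F j.
have e1 : (q + (m - j.+1))%:R + 1 = n%:R - j%:R :> F.
  by rewrite -natrB ?natr1; [congr (_%:R); rewrite /q /n; lia | rewrite /n; lia].
have h1 : n%:R - j%:R != 0 :> F by rewrite -e1 natrS_neq0.
by rewrite e1 natrD natrM; fld.
Qed.

Lemma lg_mid c : pint c -> lg (mid_shift c) (c * (h - b)) (c ^+ 2 / 2 * d).
Proof.
move=> pc; have L := lg_prod_inv p_prime p_gt3 q np pc.
rewrite sum_tail_harm // in L; rewrite -[c ^+ 2 / 2 * d]addr0.
apply: (lg_shift p_prime p_gt3 L); try by pin.
  by apply: cg_eq => //; rewrite mulr0 addr0.
have [c1 pc1 /eqP] := harm2_half F p_prime p_gt3 pE2; rewrite subr_eq addr0 => /eqP e1.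
have -> : \sum_(q <= i < n) (i%:R + 1)^-2 = H2 n - d.
  have -> : H2 n = d + \sum_(q <= i < n) (i%:R + 1)^-2 by rewrite /d /harm2 -big_cat_nat.
  by rewrite addrAC subrr add0r.
rewrite e1; apply: (@cg_intro _ _ _ (- c ^+ 2 / 2 * c1)); first by pin.
by field.
Qed.

Definition low_shift (c : F) (k : nat) : F := \prod_(0 <= i < k) (1 + P * (c * (i%:R + 1)^-1)).

Lemma fact_shift c k : (c * p + k)`!%:R = (c * p)`!%:R * k`!%:R * low_shift c%:R k.
Proof.
rewrite fact_split -mulrA; congr (_ * _).
rewrite -prod_fact /low_shift -big_split /=; apply: eq_bigr => i _; have h0 := natrS_neq0 F i.
by rewrite natrD natrM; fld.
Qed.

Lemma fact_2p : (2 * p)`!%:R = 2 * p`!%:R ^+ 2 * low_shift 1 (2 * n).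
Proof.
have pE3 : p = (2 * n).+1 by rewrite /n.
have -> : (2 * p = (1 * p + 2 * n).+1)%N by rewrite pE3; lia.
have ep : p`!%:R = P * (2 * n)`!%:R :> F by rewrite {1}pE3 factS natrM -pE3.
rewrite factS natrM fact_shift mul1n expr2 {2}ep.
have -> : (p + 2 * n).+1%:R = 2 * P by rewrite pE3; ring.
by ring.
Qed.

Lemma lg_low c k : (k < p)%N -> pint c -> lg (low_shift c k) (c * H k) (- (c ^+ 2 / 2) * H2 k).
Proof. by move=> kp pc; exact: (lg_prod_inv p_prime p_gt3 0 kp pc). Qed.

Definition central_ratio : F :=
  low_shift 1 (2 * n) * low_shift 2 n / (low_shift 1 q * low_shift 1 m).

Lemma bin_central : 'C(n + 2 * p, q + p)%:R = 2 * 'C(n, q)%:R * central_ratio.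
Proof.
have low0 k : (k < p)%N -> low_shift 1 k != 0.
  by move=> kp; have [] := lg_unit p_prime p_gt3 (lg_low kp (pint1 F p_prime)).
have l1 := low0 q qp; have l2 := low0 m mp.
have le1 : (q + p <= n + 2 * p)%N by rewrite /q /n; lia.
have e1 := bin_fact le1; have e2 := bin_fact qn.
have d1 : (n + 2 * p - (q + p) = 1 * p + m)%N by rewrite /q /n; lia.
have d2 : (n - q = m)%N by rewrite /q /n; lia.
rewrite d1 in e1; rewrite d2 in e2.
have {}e1 : 'C(n + 2 * p, q + p)%:R * ((1 * p + q)`!%:R * (1 * p + m)`!%:R) = (2 * p + n)`!%:R :> F.
  by rewrite -!natrM [(2 * p + n)%N]addnC -e1 [(1 * p + q)%N]addnC !mul1n.
have {}e2 : 'C(n, q)%:R * (q`!%:R * m`!%:R) = n`!%:R :> F by rewrite -!natrM e2.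
have f0 := factr_neq0 F p; have f1 := factr_neq0 F q; have f2 := factr_neq0 F m.
move: e1; rewrite !fact_shift mul1n fact_2p -e2 => e1.
apply: (mulIf (mulf_neq0 (mulf_neq0 (mulf_neq0 f0 f1) l1) (mulf_neq0 (mulf_neq0 f0 f2) l2))).
by rewrite e1 /central_ratio; fld.
Qed.

Lemma lg_central : lg central_ratio (h - 2 * b) (3 * d + d / 2).
Proof.
have p2 : pint 2 by apply: pint_nat.
have p1 := pint1 F p_prime; have nnp : (2 * n < p)%N by rewrite /n; lia.
have L := lgM p_prime p_gt3 (lgM p_prime p_gt3 (lg_low nnp p1) (lg_low np p2))
  (lgV p_prime p_gt3 (lgM p_prime p_gt3 (lg_low qp p1) (lg_low mp p1))).
apply: (lg_shift p_prime p_gt3 L); try by pin.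
  have [c1 pc1 /eqP] := harm_full F p_prime p_gt3 pE2; rewrite subr_eq addr0 => /eqP e1.
  have [c2 pc2 /eqP] := harm_m F p_prime p_gt3 pE; rewrite subr_eq => /eqP e2.
  apply: (@cg_intro _ _ _ (c1 - c2)); first by pin.
  by rewrite /n e1 e2 -/n -/q -/b -/d -/h; field.
have [c1 pc1 /eqP] := harm2_full F p_prime p_gt3 pE2; rewrite subr_eq addr0 => /eqP e1.
have [c2 pc2 /eqP] := harm2_m F p_prime p_gt3 pE; rewrite subr_eq => /eqP e2.
have [c3 pc3 /eqP] := harm2_half F p_prime p_gt3 pE2; rewrite subr_eq addr0 => /eqP e3.
apply: (@cg_intro _ _ _ (- c1 / 2 - 2 * c3 + c2 / 2)); first by pin.
by rewrite /n e1 e2 e3 -/n -/q -/d; field.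
Qed.

Lemma bin_pred N k : (0 < N)%N -> 'C(N.-1, k)%:R = 'C(N, k)%:R * (N%:R - k%:R) / N%:R :> F.
Proof.
case: N => [//|N] _; have N0 : N.+1%:R != 0 :> F by rewrite pnatr_eq0.
have N1 : N%:R + 1 != 0 :> F by rewrite natr1.
have N2 : 1 + N%:R != 0 :> F by rewrite addrC.
by apply: (mulfI N0); rewrite /= -binr_top; fld.
Qed.

Lemma bin_pred_diag N k : 'C(N, k)%:R = 'C(N.+1, k.+1)%:R * k.+1%:R / N.+1%:R :> F.
Proof.
have N0 : N.+1%:R != 0 :> F by rewrite pnatr_eq0.
have N1 : N%:R + 1 != 0 :> F by rewrite natr1.
have /= e := mul_bin_diag N.+1 k; have N2 : 1 + N%:R != 0 :> F by rewrite addrC.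
have {}e : N.+1%:R * 'C(N, k)%:R = k.+1%:R * 'C(N.+1, k.+1)%:R :> F by rewrite -!natrM e.
by apply: (mulfI N0); rewrite e; fld.
Qed.

(** The binomial coefficients of [jacobi_int] have indices n + c (p-1); lowering the
    indices of those at n + c p introduces the rational functions of p below.
    Everything is then expanded modulo p^3. *)
Lemma jacobi_value :
  cg 3 ((jacobi_int p n q)%:~R / 8) (- v * texp p (- (1 / 3) * h) (- (1 / 3) * d)).
Proof.
have pv : pint v by apply: (pint_wallis F p_prime p_gt3 pE2).
have [P1 p1] : 1 - 3 * P != 0 /\ pint (1 - 3 * P)^-1.
  have -> : 1 - 3 * P = 1 + P * - (3) by ring.
  by apply: pint_unit1; pin.
have [P2 p2] : 1 - 5 * P != 0 /\ pint (1 - 5 * P)^-1.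
  have -> : 1 - 5 * P = 1 + P * - (5) by ring.
  by apply: pint_unit1; pin.
have [P3 p3] : 1 - 5 / 3 * P != 0 /\ pint (1 - 5 / 3 * P)^-1.
  have -> : 1 - 5 / 3 * P = 1 + P * - (5 / 3) by ring.
  by apply: pint_unit1; pin.
have P3' : 3 - 5 * P != 0.
  by have -> : 3 - 5 * P = 3 * (1 - 5 / 3 * P); [field | rewrite mulf_neq0 ?pnatr_eq0].
have en : n%:R = (P - 1) / 2 :> F by rewrite (nP F pE2).
have eq : q%:R = (P - 1) / 3 :> F by rewrite pE /q; field.
have em : m%:R = (P - 1) / 6 :> F by rewrite pE; field.
have pp := prime_gt0 p_prime.
have T0 : 'C(n, q)%:R = v * upper_shift 0 by rewrite -(bin_upper 0) mul0n addn0.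
have N1 : (n + 1 * p)%:R = - (1 - 3 * P) / 2 :> F by rewrite natrD natrM en; field.
have N2 : (n + 2 * p)%:R = - (1 - 5 * P) / 2 :> F by rewrite natrD natrM en; field.
have N3 : (n + 2 * p).-1%:R = - 3 * (1 - 5 / 3 * P) / 2 :> F.
  have -> : (n + 2 * p).-1%:R = (n + 2 * p)%:R - 1 :> F.
    by rewrite -[in RHS](prednK (_ : 0 < n + 2 * p)%N) ?addn_gt0 ?muln_gt0 ?pp ?orbT // -natr1 addrK.
  by rewrite N2; field.
have sub k l : (k + m = l)%N -> 'C(l, k) = 'C(l, m).
  by move=> <-; rewrite -(bin_sub (leq_addl k m)) addnK.
have pos1 : (0 < n + 1 * p)%N by lia.
have pos2 : (0 < n + 2 * p)%N by lia.
have pos3 : (0 < (n + 2 * p).-1)%N by lia.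
have T1 : 'C(n + p.-1, q)%:R = v * upper_shift 1 * ((1 - 7 * P) / (3 * (1 - 3 * P))).
  have -> : (n + p.-1 = (n + 1 * p).-1)%N by lia.
  by rewrite bin_pred // bin_upper N1 eq; fld.
have T2 : 'C(n + p.-1, q + p.-1)%:R
    = v * (upper_shift 0 * mid_shift 1) * (2 * (1 - 4 * P) / (3 * (1 - 3 * P))).
  rewrite sub; last by rewrite /n /q; lia.
  have -> : (n + p.-1 = (n + 1 * p).-1)%N by lia.
  by rewrite bin_pred // bin_complement T0 N1 em; fld.
have e3 : (n + 2 * p.-1 = (n + 2 * p).-2)%N by lia.
have T3 : 'C(n + 2 * p.-1, q)%:R = v * upper_shift 2
    * ((1 - 13 * P) * (7 - 13 * P) / (27 * ((1 - 5 * P) * (1 - 5 / 3 * P)))).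
  by rewrite e3 bin_pred // bin_pred // bin_upper N2 N3 eq; fld.
have T5 : 'C(n + 2 * p.-1, q + 2 * p.-1)%:R = v * (upper_shift 0 * mid_shift 2)
    * (4 * ((1 - 7 * P) * (4 - 7 * P)) / (27 * ((1 - 5 * P) * (1 - 5 / 3 * P)))).
  rewrite sub; last by rewrite /n /q; lia.
  by rewrite e3 bin_pred // bin_pred // bin_complement T0 N2 N3 em; fld.
have T4 : 'C(n + 2 * p.-1, q + p.-1)%:R = v * (upper_shift 0 * central_ratio)
    * (4 * ((1 - 4 * P) * (1 - 7 * P)) / (27 * ((1 - 5 * P) * (1 - 5 / 3 * P)))).
  rewrite e3 bin_pred_diag (_ : (q + p.-1).+1 = q + p)%N; last by lia.
  rewrite prednK // bin_pred // bin_central T0 N2 N3 natrD eq.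
  by fld.
have p1' := pint1 F p_prime.
have q2 : pint 2 by apply: pint_nat.
have L0 := lg_upper p0; have L1 := lg_upper p1'; have L2 := lg_upper q2.
have [_ _ [c0 pc0 E0]] := L0; have [_ _ [c1 pc1 E1]] := L1; have [_ _ [c3 pc3 E3]] := L2.
have [_ _ [c2 pc2 E2]] := lgM p_prime p_gt3 L0 (lg_mid p1').
have [_ _ [c4 pc4 E4]] := lgM p_prime p_gt3 L0 lg_central.
have [_ _ [c5 pc5 E5]] := lgM p_prime p_gt3 L0 (lg_mid q2).
have jE : (jacobi_int p n q)%:~R = (P - 1) * (15 * 'C(n, q)%:R
    - 10 * ('C(n + p.-1, q)%:R + 'C(n + p.-1, q + p.-1)%:R)
    + 3 * ('C(n + 2 * p.-1, q)%:R + 'C(n + 2 * p.-1, q + p.-1)%:R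
           + 'C(n + 2 * p.-1, q + 2 * p.-1)%:R)) :> F.
  by rewrite /jacobi_int; ring.
rewrite jE {jE} T1 T2 T3 T4 T5 T0.
move: E2 => /eqP; rewrite subr_eq => /eqP ->.
move: E4 => /eqP; rewrite subr_eq => /eqP ->.
move: E5 => /eqP; rewrite subr_eq => /eqP ->.
move: E0 => /eqP; rewrite subr_eq => /eqP ->.
move: E1 => /eqP; rewrite subr_eq => /eqP ->.
move: E3 => /eqP; rewrite subr_eq => /eqP ->.
(* The quotient by p^3 of the remaining polynomial identity in h, b, d and p, with
   denominators cleared. *)
pose K : F := (- 2016) - 1113 * d - 456 * h - 148 * h ^+ 2 + 1080 * b + 360 * b * h - 405
   * b ^+ 2 + 3168 * P + 5067 * P * d + 1536 * P * h + 824 * P * h ^+ 2 - 2160 * P * b -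
   1980 * P * b * h + 1755 * P * b ^+ 2 - 8187 * P ^+ 2 * d - 1464 * P ^+ 2 * h - 1644 * P
   ^+ 2 * h ^+ 2 + 1080 * P ^+ 2 * b + 3960 * P ^+ 2 * b * h - 3375 * P ^+ 2 * b ^+ 2 +
   3849 * P ^+ 3 * d + 1032 * P ^+ 3 * h ^+ 2 - 2340 * P ^+ 3 * b * h + 2025 * P ^+ 3 * b
   ^+ 2.
apply: (@cg_intro _ _ _ (v * ((P - 1) / 8 * (15 * c0
   - 10 * (c1 * ((1 - 7 * P) / 3 / (1 - 3 * P)) + c2 * (2 * (1 - 4 * P) / 3 / (1 - 3 * P)))
   + 3 * (c3 * ((1 - 13 * P) * (7 - 13 * P) / 3 / 3 / 3 / (1 - 5 * P) / (1 - 5 / 3 * P))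
      + c4 * (4 * ((1 - 4 * P) * (1 - 7 * P)) / 3 / 3 / 3 / (1 - 5 * P) / (1 - 5 / 3 * P))
      + c5 * (4 * ((1 - 7 * P) * (4 - 7 * P)) / 3 / 3 / 3 / (1 - 5 * P) / (1 - 5 / 3 * P))))
   - K / 8 / 3 / 3 / 3 / (1 - 3 * P) / (1 - 5 * P) / (1 - 5 / 3 * P)))).
  by rewrite /K; pin.
rewrite /texp /K.
by fld.
Qed.

End JacobiValue.

(** * Jacobi sums over Z/p^3 *)

(** Here R stands for Z/p^3 and tau for its Teichmueller character; the hypotheses are
    the properties of tau that the classical evaluation of Jacobi sums uses. That
    tau u - 1 is a unit for u <> 1 replaces the absence of zero divisors. *)
Section CharacterSums.

Variables (R : comUnitRingType) (p : nat) (tau : 'F_p -> R).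
Hypothesis p_prime : prime p.
Hypothesis tauM : forall s t, tau (s * t) = tau s * tau t.
Hypothesis tau0 : tau 0 = 0.
Hypothesis tau1 : tau 1 = 1.
Hypothesis tau_unit : forall u, u != 1 -> tau u - 1 \is a GRing.unit.

Lemma tauX t k : tau (t ^+ k) = tau t ^+ k.
Proof. by elim: k => [|k IH]; rewrite ?expr0 // !exprS tauM IH. Qed.

Lemma fermat_Fp (t : 'F_p) : t != 0 -> t ^+ p.-1 = 1.
Proof.
move=> t0; apply: (mulfI t0); rewrite mulr1 -exprS prednK ?prime_gt0 //.
by have := expf_card t; rewrite card_Fp.
Qed.

Lemma tau_order t : t != 0 -> tau t ^+ p.-1 = 1.
Proof. by move=> t0; rewrite -tauX fermat_Fp. Qed.

Lemma exists_nontrivial_power e : ~~ (p.-1 %| e)%N -> exists2 c : 'F_p, c != 0 & c ^+ e != 1.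
Proof.
move=> ne; pose r := (e %% p.-1)%N.
have r0 : (0 < r)%N by rewrite lt0n.
have rp : (r < p.-1)%N by rewrite ltn_mod; have := prime_gt1 p_prime; lia.
have [c c0 cr] : exists2 c : 'F_p, c != 0 & c ^+ r != 1.
  apply/exists_inP; apply: contraT; rewrite negb_exists_in => /forall_inP h.
  have sz : size ('X^r - 1 : {poly 'F_p}) = r.+1 by rewrite size_XnsubC.
  have nz : ('X^r - 1 : {poly 'F_p}) != 0 by rewrite -size_poly_eq0 sz.
  have := max_poly_roots nz (rs := enum [pred c : 'F_p | c != 0]) _ (enum_uniq _).
  rewrite sz -cardE; have -> : #|[pred c : 'F_p | c != 0]| = p.-1.
    by have := cardC1 (0 : 'F_p); rewrite card_Fp.
  move=> H; have : (p.-1 < r.+1)%N.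
    apply: H; apply/allP => c; rewrite mem_enum /= => c0.
    by rewrite /root !hornerE subr_eq0; have := h c c0; rewrite negbK.
  by rewrite ltnS leqNgt rp.
exists c => //; rewrite (divn_eq e p.-1) exprD mulnC exprM fermat_Fp // expr1n mul1r //.
Qed.

Definition moment (e : nat) : R := \sum_(t : 'F_p) tau t ^+ e.

Lemma moment0 : moment 0 = p%:R.
Proof.
rewrite /moment (eq_bigr (fun=> 1)) => [|t _]; last by rewrite expr0.
by rewrite sumr_const card_Fp.
Qed.

Lemma moment_dvd e : (0 < e)%N -> (p.-1 %| e)%N -> moment e = p%:R - 1.
Proof.
move=> e0 /dvdnP[k ek]; rewrite /moment (bigD1 0) //= tau0 expr0n gtn_eqF // add0r.
rewrite (eq_bigr (fun=> 1)) => [|t t0]; last by rewrite ek mulnC exprM tau_order ?expr1n.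
rewrite sumr_const (_ : #|_| = p.-1); last by have := cardC1 (0 : 'F_p); rewrite card_Fp.
by rewrite -{2}(prednK (prime_gt0 p_prime)) -natr1 addrK.
Qed.

Lemma moment_ndvd e : ~~ (p.-1 %| e)%N -> moment e = 0.
Proof.
move=> ne; have [c c0 ce] := exists_nontrivial_power ne.
have h : tau c ^+ e * moment e = moment e.
  rewrite /moment mulr_sumr [RHS](reindex_inj (mulfI c0)); apply: eq_bigr => t _.
  by rewrite tauM exprMn.
have u := tau_unit ce; apply: (mulrI u).
by rewrite mulr0 mulrBl mul1r tauX h subrr.
Qed.

Variables (n : nat).
Hypotheses (pE : p = (2 * n).+1) (n0 : (0 < n)%N).

(** The quadratic character, as a power of tau. *)
Definition phi (z : 'F_p) : R := tau z ^+ n.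

Lemma phiM y z : phi (y * z) = phi y * phi z.
Proof. by rewrite /phi tauM exprMn. Qed.

Lemma phi0 : phi 0 = 0. Proof. by rewrite /phi tau0 expr0n gtn_eqF. Qed.

Lemma phi_sq z : z != 0 -> phi z * phi z = 1.
Proof.
move=> z0; rewrite /phi -exprD (_ : (n + n = p.-1)%N) ?tau_order //.
by rewrite pE /=; lia.
Qed.

Lemma sum_phi : \sum_z phi z = 0.
Proof. by apply: moment_ndvd; rewrite pE /= gtnNdvd //; lia. Qed.

Lemma sum_phi_affine (c w : 'F_p) : c != 0 -> \sum_u phi (c * u + w) = 0.
Proof.
move=> c0; rewrite -[RHS]sum_phi [RHS](reindex_inj (h := fun u => c * u + w)) //.
by move=> x y /addIr/(mulfI c0).
Qed.

Lemma sum_phi_quadratic (w : 'F_p) : w != 1 ->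
  \sum_t phi ((1 + t * w) * (1 + t)) = - phi w.
Proof.
move=> w1; have c0 : 1 - w != 0 by rewrite subr_eq0 eq_sym.
rewrite (reindex_inj (h := fun u : 'F_p => u^-1 - 1)) /=; last first.
  by move=> x y /addIr/invr_inj.
rewrite (bigD1 0) //= invr0 sub0r addrN mulr0 phi0 add0r.
transitivity (\sum_(u : 'F_p | u != 0) phi ((1 - w) * u + w)).
  apply: eq_bigr => u u0.
  have -> : (1 + (u^-1 - 1) * w) * (1 + (u^-1 - 1)) = ((1 - w) * u + w) * (u^-1 * u^-1).
    by field.
  by rewrite phiM (phiM u^-1) phi_sq ?invr_eq0 // mulr1.
apply/eqP; rewrite -subr_eq0 opprK addrC; apply/eqP.
have := sum_phi_affine w c0; rewrite (bigD1 0) //= mulr0 add0r.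
by [].
Qed.

Variable q : nat.
Hypotheses (qE : p = (3 * q).+1).

(** Up to the sign of the argument, the Jacobi sum of the inverse i-th power of the
    cubic character tau^q and the quadratic character. *)
Definition jac (i : nat) : R := \sum_(t : 'F_p) tau t ^+ (p.-1 - i * q) * phi (1 + t).

(** The classical product of two conjugate Jacobi sums: after t -> tw the sum over t
    is a quadratic one for each ratio w, w = 1 contributes an additional p, and the rest
    sums to zero. *)
Lemma jac_mul : jac 1 * jac 2 = p%:R.
Proof.
have q0 : (0 < q)%N by lia.
have en : (2 * n = 3 * q)%N by lia.
have e1 : (p.-1 - 1 * q = 2 * q)%N by rewrite qE /=; lia.
have e2 : (p.-1 - 2 * q = q)%N by rewrite qE /=; lia.
rewrite /jac e1 e2 mulrC big_distrl /= (bigD1 0) //= tau0 expr0n gtn_eqF // !mul0r add0r.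
transitivity (\sum_(t : 'F_p | t != 0) \sum_w tau w ^+ (2 * q) * phi ((1 + t * w) * (1 + t))).
  apply: eq_bigr => t t0; rewrite mulr_sumr (reindex_inj (mulfI t0)); apply: eq_bigr => w _ /=.
  rewrite tauM exprMn phiM.
  transitivity (tau t ^+ (q + 2 * q) * (tau w ^+ (2 * q) * (phi (1 + t * w) * phi (1 + t)))).
    by rewrite exprD; ring.
  by rewrite (_ : q + 2 * q = p.-1)%N ?tau_order ?mul1r // qE /=; lia.
rewrite exchange_big /=.
transitivity (\sum_w (tau w ^+ (2 * q) * (- phi w - 1) + (if w == 1 then p%:R else 0))).
  apply: eq_bigr => w _; rewrite -mulr_sumr.
  have phi1 : phi 1 = 1 by rewrite /phi tau1 expr1n.
  have [->|w1] := eqVneq w 1.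
    rewrite tau1 expr1n !mul1r phi1.
    rewrite (bigD1 (-1)) /=; last by rewrite oppr_eq0 oner_eq0.
    rewrite mulN1r addrN mul0r phi0 add0r.
    rewrite (eq_bigr (fun=> 1)) => [|t /andP[_ t1]]; last first.
      by rewrite mulr1 phiM phi_sq // addrC addr_eq0.
    rewrite sumr_const.
    have -> : #|[pred t : 'F_p | (t != 0) && (t != -1)]| = (p - 2)%N.
      have e := cardD1 (-1) [pred t : 'F_p | t != 0].
      rewrite !inE oppr_eq0 oner_eq0 /= in e.
      have e' : #|[pred t : 'F_p | t != 0]| = p.-1.
        by have := cardC1 (0 : 'F_p); rewrite card_Fp.
      rewrite e' in e; transitivity #|[predD1 [pred t : 'F_p | t != 0] & -1]|; last first.
        by rewrite subn2 e add1n.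
      by apply: eq_card => t; rewrite !inE andbC.
    by rewrite natrB ?prime_gt1 //; ring.
  rewrite addr0; congr (_ * _).
  have := sum_phi_quadratic w1; rewrite (bigD1 0) //= mul0r !addr0 mulr1 phi1.
  by move=> <-; rewrite [1 + _]addrC addrK.
rewrite big_split /= -big_mkcond big_pred1_eq -[RHS]add0r; congr (_ + _).
under eq_bigr do rewrite mulrBr mulr1 mulrN /phi -exprD.
rewrite sumrB sumrN -/(moment _) -/(moment (2 * q)) !moment_ndvd ?subrr ?oppr0 //.
- by rewrite addr0.
- rewrite (_ : p.-1 = 3 * q)%N ?gtnNdvd //; lia.
- by apply/negP => /dvdnP[[|[|k]]]; rewrite (_ : p.-1 = 3 * q)%N; lia.
Qed.

Definition cubic_sum (k : 'F_p) : R := \sum_(t : 'F_p) phi (1 + k * t ^+ 3).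

(** Both sides pick, among the exponents j, the multiples of q, as the moments of
    tau at other exponents vanish; the three sums on the right separate these
    multiples according to j / q modulo 3. *)
Lemma cubic_fourier k N (c : nat -> R) : k != 0 ->
  \sum_t \sum_(0 <= j < N) c j * tau (k * t ^+ 3) ^+ j
  = \sum_t \sum_(0 <= j < N) c j * tau t ^+ j
   + tau k ^+ q * \sum_t tau t ^+ (p.-1 - 1 * q) * \sum_(0 <= j < N) c j * tau t ^+ j
   + tau k ^+ (2 * q) * \sum_t tau t ^+ (p.-1 - 2 * q) * \sum_(0 <= j < N) c j * tau t ^+ j.
Proof.
move=> k0; have q0 : (0 < q)%N by lia.
have e0 : p.-1 = (3 * q)%N by rewrite qE.
have e1 : (p.-1 - 1 * q = 2 * q)%N by rewrite e0; lia.
have e2 : (p.-1 - 2 * q = q)%N by rewrite e0; lia.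
rewrite e1 e2.
have lin (f : 'F_p -> nat -> R) l : \sum_t tau t ^+ l * \sum_(0 <= j < N) c j * tau t ^+ j
    = \sum_(0 <= j < N) c j * moment (l + j).
  under eq_bigr do rewrite mulr_sumr.
  rewrite exchange_big /=; apply: eq_bigr => j _; rewrite mulr_sumr; apply: eq_bigr => t _.
  by rewrite exprD mulrCA.
rewrite !(lin (fun _ _ => 0)).
have -> : \sum_t \sum_(0 <= j < N) c j * tau t ^+ j = \sum_(0 <= j < N) c j * moment j.
  by rewrite exchange_big /=; apply: eq_bigr => j _; rewrite mulr_sumr.
rewrite exchange_big /= !mulr_sumr -!big_split; apply: eq_bigr => j _ /=.
have -> : \sum_t c j * tau (k * t ^+ 3) ^+ j = c j * (tau k ^+ j * moment (3 * j)).
  rewrite -mulr_sumr; congr (_ * _); rewrite /moment mulr_sumr; apply: eq_bigr => t _.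
  by rewrite tauM exprMn tauX -exprM.
rewrite !(mulrCA (tau k ^+ _)) -!mulrDr; congr (_ * _).
have [->|j0] := posnP j.
  rewrite muln0 expr0 mul1r moment0 !addn0 !moment_ndvd ?mulr0 ?addr0 // e0.
  - by rewrite gtnNdvd //; lia.
  - by rewrite gtnNdvd //; lia.
have [/dvdnP[l jE]|nqj] := boolP (q %| j)%N; last first.
  have nd a : (q %| a)%N -> ~~ (3 * q %| a + j)%N.
    move=> qa; apply: contra nqj => h; rewrite -(dvdn_addr _ qa).
    by apply: dvdn_trans h; rewrite dvdn_mull.
  rewrite (@moment_ndvd (3 * j)) ?(@moment_ndvd j) ?(@moment_ndvd (2 * q + j)) ?(@moment_ndvd (q + j)).
  - by rewrite !mulr0 !addr0.
  - by rewrite e0 nd.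
  - by rewrite e0 nd // dvdn_mull.
  - by rewrite e0; exact: (nd 0%N).
  - by rewrite e0 dvdn_pmul2l.
have k3 : tau k ^+ (3 * q) = 1 by rewrite -e0 tau_order.
rewrite (@moment_dvd (3 * j)) ?muln_gt0 // ?e0 ?jE ?dvdn_mul ?dvdn_mull //.
have l0 : (0 < l)%N by move: j0; rewrite jE; case: (l).
have mod3 : l = (3 * (l %/ 3) + l %% 3)%N by lia.
have dv a : (3 * q %| a * q)%N = (3 %| a)%N by rewrite dvdn_pmul2r.
have mv a : (0 < a)%N -> moment (a * q) = if (3 %| a)%N then p%:R - 1 else 0.
  move=> a0; case: ifPn => ha; first by rewrite moment_dvd ?muln_gt0 ?a0 // e0 dv.
  by rewrite moment_ndvd // e0 dv.
have -> : (2 * q + l * q = (2 + l) * q)%N by rewrite mulnDl.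
have -> : (q + l * q = (1 + l) * q)%N by rewrite mulnDl mul1n.
rewrite !mv //.
have -> : tau k ^+ (l * q) = tau k ^+ ((l %% 3) * q).
  rewrite {1}mod3 mulnDl exprD mulnAC exprM k3 expr1n mul1r //.
have h3 : (l %% 3 < 3)%N by rewrite ltn_mod.
rewrite !/dvdn -(modnDmr 2) -(modnDmr 1).
case: (l %% 3)%N h3 => [|[|[|//]]] _ /=.
- by rewrite mul0n expr0 !mulr0 mul1r !addr0.
- by rewrite mul1n !mulr0 add0r addr0.
- by rewrite !mulr0 !add0r.
Qed.

Hypothesis p_nil : p%:R ^+ 3 = 0 :> R.
Hypothesis two_unit : (2 : R) \is a GRing.unit.
Hypothesis tau_add : forall t, (1 + tau t) ^+ (p ^ 2) = tau (1 + t).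
Hypothesis tau_add_fermat :
  forall t, 1 + t != 0 -> exists w, (1 + tau t) ^+ p.-1 = 1 + p%:R * w.

Lemma tauN1 : tau (- 1) = - 1.
Proof.
have n1 : (- 1 : 'F_p) != 1.
  rewrite -subr_eq0 -opprD oppr_eq0 -[1 + 1]/(2%:R) -(dvdn_pcharf (pchar_Fp p_prime)).
  by rewrite gtnNdvd // pE; lia.
apply/eqP; rewrite -addr_eq0; apply/eqP.
apply: (mulrI (tau_unit n1)); rewrite mulr0 mulrDr mulr1 mulrBl mul1r -tauM mulrNN mulr1 tau1.
by ring.
Qed.

(** The binomial formula, cut off by nilpotency. *)
Lemma expr1D_nil (x : R) N : x ^+ 3 = 0 -> (1 + x) ^+ N = 1 + x *+ N + x ^+ 2 *+ 'C(N, 2).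
Proof.
move=> x3; elim: N => [|N IH]; first by rewrite expr0 !mulr0n !addr0.
rewrite exprS IH binS bin1.
transitivity (1 + x *+ N.+1 + x ^+ 2 *+ ('C(N, 2) + N) + x ^+ 3 *+ 'C(N, 2)); first by ring.
by rewrite x3 mul0rn addr0.
Qed.

(** With s = 1 + tau t and s^(p-1) = 1 + X, where X^3 = 0 as p divides X,
    phi (1 + t) = s^(n p^2) = s^n (1 + X)^N with 2 N = p^2 - 1. The power behaves as
    if N were -1/2, namely 1 - X/2 + 3 X^2/8; expanding in s^(p-1) = 1 + X yields
    the coefficients 15/8, -10/8 and 3/8. *)
Lemma phi_interpolation t : 8 * phi (1 + t)
  = 15 * (1 + tau t) ^+ n - 10 * (1 + tau t) ^+ (n + p.-1) + 3 * (1 + tau t) ^+ (n + 2 * p.-1).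
Proof.
have [t1|t1] := eqVneq (1 + t) 0.
  have -> : t = -1 by apply/eqP; rewrite -addr_eq0 addrC t1.
  rewrite tauN1 addrN phi0 [1 + _]addrN !expr0n !gtn_eqF ?addn_gt0 ?n0 //.
  by rewrite !mulr0 subrr addr0.
have [w ew] := tau_add_fermat t1; set s := 1 + tau t in ew *.
have d3 : (p%:R * w) ^+ 3 = 0 by rewrite exprMn p_nil mul0r.
rewrite /phi -tau_add -/s -exprM.
have pn : (p ^ 2 * n = n + p.-1 * (n * p.+1))%N by rewrite pE /=; lia.
rewrite pn (exprD _ n (p.-1 * _)) (exprD _ n p.-1) (exprD _ n (2 * p.-1)).
rewrite (mulnC 2 p.-1) !(exprM s p.-1) ew expr1D_nil //.
have eN : (2 * (n * p.+1) = p ^ 2 - 1)%N by rewrite pE; lia.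
set N := (n * p.+1)%N in eN *.
have p2 : p%:R ^+ 2 * p%:R = 0 :> R by rewrite -exprSr.
have h1 : 8 * ((p%:R * w) *+ N) = - 4 * (p%:R * w).
  transitivity (4 * (p%:R * w) * (2 * N)%:R); first by ring.
  rewrite eN natrB ?expn_gt0 ?prime_gt0 // natrX.
  transitivity (4 * w * (p%:R ^+ 2 * p%:R) - 4 * (p%:R * w)); first by ring.
  by rewrite p2; ring.
have h2 : 8 * ((p%:R * w) ^+ 2 *+ 'C(N, 2)) = 3 * (p%:R * w) ^+ 2.
  have eb : (8 * 'C(N, 2) = (2 * N) * (2 * N - 2))%N.
    have := bin2 N; have := mul_bin_diag N 1; rewrite bin1; case: (N) => [//|k] /=; lia.
  transitivity ((p%:R * w) ^+ 2 * (8 * 'C(N, 2))%:R); first by ring.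
  have p3 : (3 <= p)%N by lia.
  have p9 : (9 <= p ^ 2)%N by rewrite -mulnn (leq_mul p3 p3).
  have q1 : (1 <= p ^ 2)%N by exact: leq_trans p9.
  have q2 : (2 <= p ^ 2 - 1)%N by rewrite leq_subRL // (leq_trans _ p9).
  rewrite eb eN natrM (natrB _ q2) (natrB _ q1) natrX.
  transitivity ((p%:R ^+ 2 * p%:R) * p%:R * w ^+ 2 * (p%:R ^+ 2 - 4) + 3 * (p%:R * w) ^+ 2).
    by ring.
  by rewrite p2; ring.
transitivity (s ^+ n * (8 + 8 * ((p%:R * w) *+ N) + 8 * ((p%:R * w) ^+ 2 *+ 'C(N, 2)))).
  by ring.
by rewrite h1 h2; ring.
Qed.

Definition coef8 (j : nat) : R :=
  15 * 'C(n, j)%:R - 10 * 'C(n + p.-1, j)%:R + 3 * 'C(n + 2 * p.-1, j)%:R.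

Lemma binomial_range (x : R) N M : (N < M)%N ->
  (1 + x) ^+ N = \sum_(0 <= j < M) 'C(N, j)%:R * x ^+ j.
Proof.
move=> NM; rewrite (big_cat_nat (n := N.+1)) //= addrC big_nat_cond big1 ?add0r.
  rewrite exprDn big_mkord; apply: eq_bigr => j _.
  by rewrite expr1n mul1r -mulr_natl.
by move=> j /andP[/andP[Nj _] _]; rewrite bin_small ?mul0r.
Qed.

Lemma phi_expansion t :
  8 * phi (1 + t) = \sum_(0 <= j < 3 * p.-1) coef8 j * tau t ^+ j.
Proof.
have e0 : p.-1 = (2 * n)%N by rewrite pE.
rewrite phi_interpolation !(binomial_range _ (M := 3 * p.-1)); [|lia..].
rewrite !mulr_sumr -sumrB -big_split; apply: eq_bigr => j _ /=.
by rewrite /coef8; ring.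
Qed.

(** Expand phi by [phi_interpolation]: the moments of tau select the exponents
    congruent to q modulo p - 1. *)
Lemma jac_coef : 8 * jac 1 = (jacobi_int p n q)%:~R.
Proof.
have e0 : p.-1 = (3 * q)%N by rewrite qE.
have e2 : (3 * q = 2 * n)%N by lia.
have q0 : (0 < q)%N by lia.
rewrite /jac mulr_sumr.
transitivity (\sum_(0 <= j < 3 * p.-1) coef8 j * moment (2 * q + j)).
  rewrite [RHS](eq_bigr (fun j => \sum_t coef8 j * tau t ^+ (2 * q + j))); last first.
    by move=> j _; rewrite mulr_sumr.
  rewrite exchange_big /=; apply: eq_bigr => t _.
  rewrite mulrCA phi_expansion mulr_sumr; apply: eq_bigr => j _.
  by rewrite exprD mulrCA (_ : p.-1 - 1 * q = 2 * q)%N // e0; lia.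
have blk a : \sum_(a * p.-1 <= j < a.+1 * p.-1) coef8 j * moment (2 * q + j)
    = coef8 (q + a * p.-1) * (p%:R - 1).
  rewrite (big_cat_nat (n := q + a * p.-1)) /=; [|lia..].
  rewrite big_nat_cond big1 ?add0r; last first.
    move=> j /andP[/andP[j1 j2] _]; rewrite moment_ndvd ?mulr0 //.
    rewrite (_ : 2 * q + j = a * p.-1 + (2 * q + (j - a * p.-1)))%N; last by lia.
    by rewrite dvdn_addr ?dvdn_mull // gtnNdvd // e0; lia.
  rewrite big_ltn; last by rewrite e0 mulSn; lia.
  rewrite [X in _ + X]big_nat_cond big1 ?addr0; last first.
    move=> j /andP[/andP[j1 j2] _]; rewrite moment_ndvd ?mulr0 //.
    rewrite (_ : 2 * q + j = a.+1 * p.-1 + (j - (q + a * p.-1)))%N; last first.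
      by rewrite mulSn e0; lia.
    by rewrite dvdn_addr ?dvdn_mull // gtnNdvd //; move: j2; rewrite mulSn e0; lia.
  rewrite moment_dvd; [by []|lia|].
  have -> : (2 * q + (q + a * p.-1) = a.+1 * p.-1)%N by rewrite e0 mulSn; lia.
  by rewrite dvdn_mull.
rewrite (big_cat_nat (n := 1 * p.-1)) //=; last by lia.
rewrite (big_cat_nat (n := 2 * p.-1) (m := 1 * p.-1)) //=; [|lia..].
rewrite -[X in \sum_(X <= _ < 1 * _) _](mul0n p.-1) !blk /coef8 /jacobi_int.
rewrite mul0n addn0 mul1n.
rewrite (@bin_small n (q + p.-1)); last by lia.
rewrite (@bin_small n (q + 2 * p.-1)); last by lia.
rewrite (@bin_small (n + p.-1) (q + 2 * p.-1)); last by lia.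
by ring.
Qed.

Lemma cubic_sum_jac k : k != 0 ->
  cubic_sum k = tau k ^+ q * jac 1 + tau k ^+ (2 * q) * jac 2.
Proof.
move=> k0; have u8 : (8 : R) \is a GRing.unit.
  by rewrite (_ : 8 = 2 * 2 * 2) ?unitrM ?two_unit //; ring.
apply: (mulrI u8); rewrite /cubic_sum mulr_sumr.
transitivity (\sum_t \sum_(0 <= j < 3 * p.-1) coef8 j * tau (k * t ^+ 3) ^+ j).
  by apply: eq_bigr => t _; rewrite phi_expansion.
rewrite cubic_fourier //.
have S i : \sum_t tau t ^+ (p.-1 - i * q) * \sum_(0 <= j < 3 * p.-1) coef8 j * tau t ^+ j
   = 8 * jac i.
  rewrite /jac mulr_sumr; apply: eq_bigr => t _.
  by rewrite -phi_expansion mulrCA.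
have -> : \sum_t \sum_(0 <= j < 3 * p.-1) coef8 j * tau t ^+ j = 0.
  transitivity (8 * \sum_t phi (1 * t + 1)); last by rewrite sum_phi_affine ?mulr0 ?oner_eq0.
  rewrite mulr_sumr; apply: eq_bigr => t _.
  by rewrite -phi_expansion mul1r addrC.
by rewrite !S; ring.
Qed.

(** The quadratic character as an integer, so that character sums are bounded. *)
Definition chi (z : 'F_p) : int := if z == 0 then 0 else if z ^+ n == 1 then 1 else -1.

Lemma chi_phi z : (chi z)%:~R = phi z.
Proof.
rewrite /chi; have [->|z0] := eqVneq z 0; first by rewrite phi0.
have [e|ne] := eqVneq (z ^+ n) 1; first by rewrite /phi -tauX e tau1.
apply: (mulrI (tau_unit ne)); rewrite tauX -/(phi z) [RHS]mulrBl phi_sq // mul1r.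
by ring.
Qed.

Definition cubic_int (k : 'F_p) : int := \sum_(t : 'F_p) chi (1 + k * t ^+ 3).

Lemma cubic_intE k : (cubic_int k)%:~R = cubic_sum k.
Proof. by rewrite rmorph_sum; apply: eq_bigr => t _; rewrite /= chi_phi. Qed.

Lemma cubic_int_le k : `|cubic_int k| <= p%:Z.
Proof.
apply: le_trans (ler_norm_sum _ _ _) _.
have -> : p%:Z = \sum_(t : 'F_p) 1 by rewrite sumr_const card_Fp // natz.
by apply: ler_sum => t _; rewrite /chi; case: ifP => // _; case: ifP.
Qed.

Hypothesis int_inj : forall z : int, z%:~R = 0 :> R -> (p%:Z ^+ 3 %| z)%Z.

Lemma small_dvd (z : int) : (p%:Z ^+ 3 %| z)%Z -> `|z| < p%:Z ^+ 3 -> z = 0.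
Proof.
move=> /dvdzP[k ->]; rewrite normrM.
have p3 : 0 < p%:Z ^+ 3 by rewrite exprn_gt0 // ltz_nat prime_gt0.
rewrite (gtr0_norm p3) gtr_pMl // => k1.
by have -> : k = 0 by lia; rewrite mul0r.
Qed.

Hypothesis p_gt3 : (3 < p)%N.

Lemma exists_cubic_nonresidue : exists2 g : 'F_p, g != 0 & g ^+ q != 1.
Proof.
apply: exists_nontrivial_power; rewrite (_ : p.-1 = 3 * q)%N ?gtnNdvd //; lia.
Qed.

(** In R the left side is 3 [jac 1] [jac 2] = 3p. By [cubic_int_le] the difference
    of the two sides is less than p^3, so the congruence is an equality of integers. *)
Lemma cubic_int_norm g : g != 0 -> g ^+ q != 1 ->
  cubic_int 1 ^+ 2 + cubic_int 1 * cubic_int g + cubic_int g ^+ 2 = 3 * p%:Z.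
Proof.
move=> g0 gq; set A0 := cubic_int 1; set A1 := cubic_int g.
pose w := tau g ^+ q.
have w3 : w ^+ 3 = 1 by rewrite /w -exprM mulnC (_ : 3 * q = p.-1)%N ?tau_order // qE.
have w1 : 1 + w + w ^+ 2 = 0.
  have u := tau_unit gq; rewrite tauX -/w in u; apply: (mulrI u).
  by transitivity (w ^+ 3 - 1); [ring | rewrite w3 subrr mulr0].
have e0 : A0%:~R = jac 1 + jac 2 :> R.
  by rewrite /A0 cubic_intE cubic_sum_jac ?oner_eq0 // tau1 !expr1n !mul1r.
have e1 : A1%:~R = w * jac 1 + w ^+ 2 * jac 2 :> R.
  by rewrite /A1 cubic_intE cubic_sum_jac // /w -exprM (mulnC q).
have h : (A0 ^+ 2 + A0 * A1 + A1 ^+ 2 - 3 * p%:Z)%:~R = 0 :> R.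
  transitivity (A0%:~R ^+ 2 + A0%:~R * A1%:~R + A1%:~R ^+ 2 - 3 * p%:R : R); first by ring.
  rewrite e0 e1 -jac_mul.
  transitivity (jac 1 ^+ 2 * (1 + w + w ^+ 2) + jac 2 ^+ 2 * (1 + w * w ^+ 3 + w ^+ 2)
    + jac 1 * jac 2 * (w + w ^+ 2 + 2 * w ^+ 3 - 1)); first by ring.
  have z1 : 1 + w * w ^+ 3 + w ^+ 2 = 0 by rewrite w3 mulr1.
  have z2 : w + w ^+ 2 + 2 * w ^+ 3 - 1 = 0.
    by rewrite w3; transitivity (1 + w + w ^+ 2); [ring | ].
  by rewrite w1 z1 z2 !mulr0 !addr0.
have b0 := cubic_int_le 1; have b1 := cubic_int_le g; rewrite -/A0 in b0; rewrite -/A1 in b1.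
apply/eqP; rewrite -subr_eq0; apply/eqP; apply: (small_dvd (int_inj h)).
rewrite ler_norml in b0; rewrite ler_norml in b1.
have p4 : 4 <= p%:Z by rewrite lez_nat.
move: b0 b1 p4 => /andP[b0 b0'] /andP[b1 b1'] p4.
rewrite ltr_norml; apply/andP; split; nia.
Qed.

(** 1 + t^3 vanishes for exactly three t, which leaves an even number of signs. *)
Lemma cubic_int_even : exists X, cubic_int 1 = 2 * X.
Proof.
have [g g0 gq] := exists_cubic_nonresidue; pose w := g ^+ q.
have w3 : w ^+ 3 = 1 by rewrite /w -exprM mulnC (_ : 3 * q = p.-1)%N ?fermat_Fp // qE.
have w1 : 1 + w + w ^+ 2 = 0.
  apply: (mulfI (_ : w - 1 != 0)); first by rewrite subr_eq0.
  by transitivity (w ^+ 3 - 1); [ring | rewrite w3 subrr mulr0].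
have w0 : w != 0 by rewrite /w expf_neq0.
have w2 : w ^+ 2 != 1.
  by apply: contra gq => /eqP e; apply/eqP; rewrite -/w -w3 exprSr e mul1r.
have roots (t : 'F_p) : (1 + t ^+ 3 == 0) = (t \in [:: -1; - w; - w ^+ 2]).
  rewrite !inE -!addr_eq0 -!mulf_eq0; congr (_ == 0).
  transitivity (t ^+ 3 + (1 + w + w ^+ 2) * (t ^+ 2 + w * t) + w ^+ 3); last by ring.
  by rewrite w1 w3; ring.
have uq : uniq [:: -1; - w; - w ^+ 2].
  rewrite /= !inE !eqr_opp negb_or [1 == w]eq_sym gq [1 == _]eq_sym w2 /= andbT.
  by rewrite -subr_eq0 (_ : w - w ^+ 2 = - (w * (w - 1))) ?oppr_eq0 ?mulf_neq0 ?subr_eq0 //; ring.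
pose B : int := \sum_(t : 'F_p) ((1 + t ^+ 3 != 0) && ((1 + t ^+ 3) ^+ n != 1))%:Z.
exists (n.-1%:Z - B).
have -> : cubic_int 1 = \sum_(t : 'F_p) (1 - (t \in [:: -1; - w; - w ^+ 2])%:Z
    - 2 * ((1 + t ^+ 3 != 0) && ((1 + t ^+ 3) ^+ n != 1))%:Z).
  apply: eq_bigr => t _; rewrite /chi mul1r -roots.
  by case: ifP => //= _; case: ifP.
rewrite sumrB -mulr_sumr -/B sumrB sumr_const card_Fp //.
have -> : \sum_(t : 'F_p) (t \in [:: -1; - w; - w ^+ 2])%:Z = 3.
  rewrite -(big_morph Posz PoszD (erefl _)) -big_mkcond sum1_card /=.
  by have /card_uniqP -> := uq.
by rewrite natz; lia.
Qed.

(** p divides (xY - yX) (xY + yX); in the Brahmagupta identity for p^2 the factor it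
    divides must then vanish. *)
Lemma repr_unique (x y X Y : int) :
  p%:Z = x ^+ 2 + 3 * y ^+ 2 -> p%:Z = X ^+ 2 + 3 * Y ^+ 2 -> x ^+ 2 = X ^+ 2.
Proof.
move=> e1 e2; have p0 : 0 < p%:Z by rewrite ltz_nat prime_gt0.
have main (c : int) : (p%:Z %| x * Y + c * (y * X))%Z -> c ^+ 2 = 1 -> x ^+ 2 = X ^+ 2.
  move=> /dvdzP[k ek] c2.
  have e3 : p%:Z ^+ 2 = (x * X - 3 * c * (y * Y)) ^+ 2 + 3 * (x * Y + c * (y * X)) ^+ 2.
    rewrite expr2 {1}e1 e2.
    transitivity (x ^+ 2 * X ^+ 2 + 9 * c ^+ 2 * (y ^+ 2 * Y ^+ 2)
      + 3 * (x ^+ 2 * Y ^+ 2 + c ^+ 2 * (y ^+ 2 * X ^+ 2))); last by ring.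
    by rewrite c2; ring.
  have k0 : k = 0.
    have h : 0 <= p%:Z ^+ 2 * (1 - 3 * k ^+ 2).
      have -> : p%:Z ^+ 2 * (1 - 3 * k ^+ 2) = (x * X - 3 * c * (y * Y)) ^+ 2.
        by rewrite mulrBr mulr1 {1}e3 ek; ring.
      exact: sqr_ge0.
    rewrite pmulr_rge0 ?exprn_gt0 // in h; have h' := sqr_ge0 k.
    by apply/eqP; rewrite -sqrf_eq0; move: (k ^+ 2) h h'; clear => a; lia.
  rewrite k0 mul0r in ek.
  have e4 : x ^+ 2 * Y ^+ 2 = y ^+ 2 * X ^+ 2.
    have : (x * Y) ^+ 2 = (c * (y * X)) ^+ 2 by move: ek => /eqP; rewrite addr_eq0 => /eqP ->; rewrite sqrrN.
    by rewrite !exprMn c2 mul1r.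
  have e5 : p%:Z * (Y ^+ 2 - y ^+ 2) = 0.
    transitivity (x ^+ 2 * Y ^+ 2 - y ^+ 2 * X ^+ 2); last by rewrite e4 subrr.
    by rewrite mulrBr {1}e1 e2; ring.
  move/eqP: e5; rewrite mulf_eq0 gt_eqF //= subr_eq0 => /eqP e5.
  by apply: (addIr (3 * y ^+ 2)); rewrite -e1 -e5 -e2.
have d : (p%:Z %| (x * Y + y * X) * (x * Y - y * X))%Z.
  apply/dvdzP; exists (Y ^+ 2 - y ^+ 2).
  transitivity (x ^+ 2 * Y ^+ 2 - y ^+ 2 * X ^+ 2); first by ring.
  by rewrite [RHS]mulrC mulrBr {1}e1 e2; ring.
move: d; rewrite dvdzE abszM /= Euclid_dvdM // => /orP[d|d].
  by apply: (main 1); rewrite ?mul1r ?expr1n.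
by apply: (main (-1)); rewrite ?mulN1r ?sqrrN ?expr1n.
Qed.

(** The trace A of the Jacobi sum is [cubic_int 1], and its norm is p. The norm
    equation of [cubic_int_norm] makes A / 2 a solution X of p = X^2 + 3 Y^2. *)
Lemma jacobi_root (x y : int) : p%:Z = x ^+ 2 + 3 * y ^+ 2 ->
  exists2 A : int, A ^+ 2 = 4 * x ^+ 2 &
    (p%:Z ^+ 3 %| jacobi_int p n q ^+ 2 - 8 * A * jacobi_int p n q + 64 * p%:Z)%Z.
Proof.
move=> exy; have [g g0 gq] := exists_cubic_nonresidue.
have nrm := cubic_int_norm g0 gq; have [X eX] := cubic_int_even.
exists (cubic_int 1).
  move: nrm; set A1 := cubic_int g; rewrite eX => nrm.
  have d3 : (3 %| (2 * X - A1))%Z.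
    have : (3 %| (2 * X - A1) * (2 * X - A1))%Z.
      apply/dvdzP; exists (p%:Z - 2 * X * A1).
      transitivity ((2 * X) ^+ 2 + 2 * X * A1 + A1 ^+ 2 - 3 * (2 * X * A1)); first by ring.
      by rewrite nrm; ring.
    by rewrite dvdzE abszM /= Euclid_dvdM // orbb.
  have /dvdzP[k ek] := d3.
  have eA : A1 = 2 * X - 3 * k by rewrite [3 * k]mulrC -ek; ring.
  have ec : p%:Z = X ^+ 2 + 3 * (X - k) ^+ 2.
    by apply: (@mulfI _ (3 : int)) => //; rewrite -nrm eA; ring.
  by rewrite (repr_unique exy ec); ring.
apply: int_inj.
transitivity ((8 * jac 1) ^+ 2 - 8 * (cubic_int 1)%:~R * (8 * jac 1) + 64 * p%:R : R).
  by rewrite jac_coef; ring.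
rewrite cubic_intE cubic_sum_jac ?oner_eq0 // tau1 !expr1n !mul1r -jac_mul.
by ring.
Qed.

End CharacterSums.

(** * The Teichmueller character modulo p^3 *)

Section Teichmuller.

Variables (p m : nat).
Hypotheses (p_prime : prime p) (p_gt3 : (3 < p)%N) (pE : p = (6 * m).+1).

Local Notation R := 'Z_(p ^ 3).
Let M_gt1 : (1 < p ^ 3)%N.
Proof. by rewrite -[1%N](exp1n 3) ltn_exp2r // prime_gt1. Qed.

Lemma p_nil : p%:R ^+ 3 = 0 :> R.
Proof. by rewrite -natrX pchar_Zp. Qed.

Lemma nat_unit k : ~~ (p %| k)%N -> (k%:R : R) \is a GRing.unit.
Proof. by move=> pk; rewrite unitZpE // coprimeXl // prime_coprime. Qed.

Lemma int_inj (z : int) : z%:~R = 0 :> R -> (p%:Z ^+ 3 %| z)%Z.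
Proof.
have hn (k : nat) : k%:R = 0 :> R -> (p ^ 3 %| k)%N.
  by move=> e; rewrite /dvdn -(val_Zp_nat M_gt1) e.
case: z => k e; rewrite dvdzE abszX /=; apply: hn => //.
by move/eqP: e; rewrite NegzE rmorphN oppr_eq0 => /eqP.
Qed.

Lemma exp_perturb (x y w : R) k j : (0 < k)%N -> x = y + p%:R ^+ k * w ->
  exists u, x ^+ j = y ^+ j + p%:R * u.
Proof.
move=> k0 e; elim: j => [|j [u IH]]; first by exists 0; rewrite !expr0 mulr0 addr0.
exists (y * u + p%:R ^+ k.-1 * w * (y ^+ j + p%:R * u)).
by rewrite !exprS IH e -{1}(prednK k0) exprS; ring.
Qed.

(** Raising to the power p gains one digit of p-adic accuracy. *)
Lemma frobenius_lift (x y w : R) k : (0 < k)%N -> x = y + p%:R ^+ k * w ->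
  exists w', x ^+ p = y ^+ p + p%:R ^+ k.+1 * w'.
Proof.
move=> k0 e.
have ex N : (N <= p)%N -> exists v,
    \sum_(0 <= i < N) x ^+ (p.-1 - i) * y ^+ i = N%:R * y ^+ p.-1 + p%:R * v.
  elim: N => [|N IH] Np; first by exists 0; rewrite big_geq //; ring.
  have [v ev] := IH (ltnW Np); have [u eu] := exp_perturb (p.-1 - N) k0 e.
  exists (v + u * y ^+ N); rewrite big_nat_recr //= ev eu.
  have -> : y ^+ p.-1 = y ^+ (p.-1 - N) * y ^+ N by rewrite -exprD subnK //; lia.
  by ring.
have [v ev] := ex p (leqnn p).
exists (w * (y ^+ p.-1 + v)); rewrite -[x ^+ p](subrK (y ^+ p)) subrXX.
rewrite -(big_mkord xpredT (fun i => x ^+ (p.-1 - i) * y ^+ i)) ev {1}e exprS.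
by ring.
Qed.

Lemma exp_p2_perturb (x y w : R) : x = y + p%:R * w -> x ^+ (p ^ 2) = y ^+ (p ^ 2).
Proof.
rewrite -[p%:R]expr1 => e; have [w1 e1] := frobenius_lift (isT : 0 < 1)%N e.
have [w2 e2] := frobenius_lift (isT : 0 < 2)%N e1.
by rewrite -mulnn !exprM e2 p_nil mul0r addr0.
Qed.

Lemma natr_modp a b : a = b %[mod p] -> exists w : R, a%:R = b%:R + p%:R * w.
Proof.
move=> e; exists ((a %/ p)%:R - (b %/ p)%:R).
by rewrite {1}(divn_eq a p) {1}(divn_eq b p) e !natrD !natrM; ring.
Qed.

(** Two p-th powers make a residue modulo p well defined modulo p^3. *)
Definition teich (t : 'F_p) : R := (t : nat)%:R ^+ (p ^ 2).

Lemma teich_nat k : teich k%:R = k%:R ^+ (p ^ 2).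
Proof.
have [w e] : exists w : R, (nat_of_ord (k%:R : 'F_p))%:R = k%:R + p%:R * w.
  by apply: natr_modp; rewrite val_Fp_nat // modn_mod.
exact: exp_p2_perturb e.
Qed.

Lemma Fp_natE (t : 'F_p) : exists k : nat, t = k%:R.
Proof. by exists t; rewrite natr_Zp. Qed.

Lemma Fp_nat_eq a b : a%:R = b%:R :> 'F_p -> a = b %[mod p].
Proof. by move=> e; have := congr1 (@nat_of_ord _) e; rewrite !val_Fp_nat. Qed.

Lemma teichM s t : teich (s * t) = teich s * teich t.
Proof.
have [a ->] := Fp_natE s; have [b ->] := Fp_natE t.
by rewrite -natrM !teich_nat natrM exprMn.
Qed.

Lemma teich0 : teich 0 = 0.
Proof. by rewrite -[0]/(0%:R) teich_nat expr0n gtn_eqF // expn_gt0 prime_gt0. Qed.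

Lemma teich1 : teich 1 = 1.
Proof. by rewrite -[1]/(1%:R) teich_nat expr1n. Qed.

Lemma frob_Fp (t : 'F_p) : t ^+ (p ^ 2) = t.
Proof. by have := expf_card t; rewrite card_Fp // => e; rewrite -mulnn exprM !e. Qed.

Lemma teich_unit u : u != 1 -> teich u - 1 \is a GRing.unit.
Proof.
have [k ->] := Fp_natE u; have [->|k0] := posnP k.
  by rewrite teich0 sub0r unitrN unitr1.
rewrite teich_nat -natrX -(natrB _ (_ : 1 <= k ^ (p ^ 2))%N) ?expn_gt0 ?k0 // => k1.
apply: nat_unit; rewrite (dvdn_pcharf (pchar_Fp p_prime)) natrB ?expn_gt0 ?k0 //.
by rewrite natrX frob_Fp subr_eq0.
Qed.

Lemma teich_add t : (1 + teich t) ^+ (p ^ 2) = teich (1 + t).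
Proof.
have [k ->] := Fp_natE t; rewrite -[1 in RHS]/(1%:R) -natrD !teich_nat.
have [w e] : exists w : R, (k ^ (p ^ 2))%:R = k%:R + p%:R * w.
  by apply: natr_modp; apply: Fp_nat_eq; rewrite natrX frob_Fp.
by apply: (@exp_p2_perturb _ _ w); rewrite -natrX e natrD addrA.
Qed.

Lemma teich_add_fermat t : 1 + t != 0 ->
  exists w, (1 + teich t) ^+ p.-1 = 1 + p%:R * w.
Proof.
have [k ->] := Fp_natE t; rewrite (_ : 1 + k%:R = (1 + k)%:R) ?natrD // teich_nat -natrD => t0.
have [w e] : exists w : R, (k ^ (p ^ 2))%:R = k%:R + p%:R * w.
  by apply: natr_modp; apply: Fp_nat_eq; rewrite natrX frob_Fp.
have e1 : 1 + k%:R ^+ (p ^ 2) = (1 + k)%:R + p%:R ^+ 1 * w :> R.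
  by rewrite -natrX e natrD expr1 addrA.
have [u eu] := exp_perturb p.-1 (isT : 0 < 1)%N e1.
have [v ev] : exists v : R, ((1 + k) ^ p.-1)%:R = 1%:R + p%:R * v.
  by apply: natr_modp; apply: Fp_nat_eq; rewrite natrX fermat_Fp.
by exists (v + u); rewrite eu -natrX ev mulrDr addrA.
Qed.

Lemma jacobi_root_6m1 (x y : int) : p%:Z = x ^+ 2 + 3 * y ^+ 2 ->
  exists2 A : int, A ^+ 2 = 4 * x ^+ 2 &
    (p%:Z ^+ 3 %| jacobi_int p (3 * m) (2 * m) ^+ 2
       - 8 * A * jacobi_int p (3 * m) (2 * m) + 64 * p%:Z)%Z.
Proof.
have tu : (2 : R) \is a GRing.unit by apply: nat_unit; rewrite gtnNdvd //; lia.
apply: (jacobi_root p_prime teichM teich0 teich1 teich_unit _ _ _ p_nil tu teich_add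
  teich_add_fermat int_inj p_gt3); lia.
Qed.

End Teichmuller.

(** * The congruences *)

Section Assembly.

Variables (F : numFieldType) (p : nat).
Hypotheses (p_prime : prime p) (p_gt3 : (3 < p)%N) (p_neq5 : p != 5).
Local Notation P := (p%:R : F).
Local Notation pint := (@pint F p).
Local Notation cg := (@cg F p).

Let i2 : pint 2^-1 := pint_half F p_prime p_gt3.
Let i3 : pint 3^-1 := pint_third F p_gt3.
Let i5 : pint 5^-1.
Proof. by apply: pintV_nat; apply: contraNN p_neq5; rewrite dvdn_prime2. Qed.

Definition cube_sum (M : F) : F := \sum_(0 <= k < p) k%:R ^+ 3 * dombF F k / M ^+ k.

Lemma cube_sum4 : cg 3 (cube_sum 4)
  (7 / 3 * ((P + 1 / 3) * sum2 (-1) p) - 16 / 45 * sum1 (-1) p).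
Proof.
have pp := prednK (prime_gt0 p_prime).
have e := domb_telescope4 F p.-1; rewrite pp in e.
have -> : cube_sum 4 = 7 / 3 * (\sum_(0 <= n < p) n%:R * dombF F n / 4 ^+ n)
   + 6 / 5 * (\sum_(0 <= n < p) dombF F n / 4 ^+ n)
   + \sum_(0 <= k < p) (k%:R ^+ 3 - 7 / 3 * k%:R - 6 / 5) * dombF F k / 4 ^+ k.
  rewrite !mulr_sumr -!big_split; apply: eq_bigr => k _ /=.
  by set u := (4 ^+ k)^-1; move: u => u; field.
rewrite e domb_wsum4 domb_sum4.
apply: (@cg_intro _ _ _ (((32 * (5^-1 * 3^-1 * 3^-1) - 2 * (5^-1 * 3^-1) * P) * dombF F p
   - 16 * (32 * (5^-1 * 3^-1 * 3^-1) - 2 * (5^-1 * 3^-1) * (P + 1)) * dombF F p.-1)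
   * (2^-1 * 2^-1) ^+ p)).
  have d1 : pint (dombF F p) by apply: pint_nat.
  have d2 : pint (dombF F p.-1) by apply: pint_nat.
  by pin.
have -> : (2^-1 * 2^-1) ^+ p = (4 ^+ p)^-1 :> F.
  by rewrite -exprVn; congr (_ ^+ _); field.
by rewrite -natr1; field; rewrite expf_neq0 // pnatr_eq0.
Qed.

Lemma cube_sum16 : cg 3 (cube_sum 16)
  (1 / 3 * ((P - 1 / 3) * sum2 1 p) + 1 / 45 * sum1 1 p).
Proof.
have pp := prednK (prime_gt0 p_prime).
have e := domb_telescope16 F p.-1; rewrite pp in e.
have -> : cube_sum 16 = 1 / 3 * (\sum_(0 <= n < p) n%:R * dombF F n / 16 ^+ n)
   + 2 / 15 * (\sum_(0 <= n < p) dombF F n / 16 ^+ n)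
   + \sum_(0 <= k < p) (k%:R ^+ 3 - 1 / 3 * k%:R - 2 / 15) * dombF F k / 16 ^+ k.
  rewrite !mulr_sumr -!big_split; apply: eq_bigr => k _ /=.
  by set u := (16 ^+ k)^-1; move: u => u; field.
rewrite e domb_wsum16 domb_sum16.
apply: (@cg_intro _ _ _ (((8 * (5^-1 * 3^-1) * P - 16 * (5^-1 * 3^-1 * 3^-1)) * dombF F p
   - 4 * (8 * (5^-1 * 3^-1) * (P + 1) - 16 * (5^-1 * 3^-1 * 3^-1)) * dombF F p.-1)
   * (2^-1 * 2^-1 * 2^-1 * 2^-1) ^+ p)).
  have d1 : pint (dombF F p) by apply: pint_nat.
  have d2 : pint (dombF F p.-1) by apply: pint_nat.
  by pin.
have -> : (2^-1 * 2^-1 * 2^-1 * 2^-1) ^+ p = (16 ^+ p)^-1 :> F.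
  by rewrite -exprVn; congr (_ ^+ _); field.
by rewrite -natr1; field; rewrite expf_neq0 // pnatr_eq0.
Qed.

Lemma sign_false : 2 * (false%:R : F) - 1 = - 1. Proof. by rewrite mulr0n mulr0 sub0r. Qed.
Lemma sign_true : 2 * (true%:R : F) - 1 = 1. Proof. by rewrite mulr1n; ring. Qed.

Section One.

Variables (m : nat) (x y : int).
Hypotheses (pE : p = (6 * m).+1) (pxy : p%:Z = x ^+ 2 + 3 * y ^+ 2).
Local Notation X := (x%:~R ^+ 2 : F).

(** Otherwise p divides y as well, and p^2 divides p. *)
Lemma x_unit : ~~ (p%:Z %| x)%Z.
Proof.
apply/negP => px; have p0 : p%:Z != 0 by rewrite eqz_nat -lt0n prime_gt0.
have py : (p%:Z %| y)%Z.
  have : (p%:Z %| 3 * (y * y))%Z.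
    have -> : 3 * (y * y) = p%:Z - x * x by rewrite pxy; ring.
    by rewrite rpredB // dvdz_mulr.
  apply: contraLR => npy; apply: pndvdM => //; last exact: pndvdM.
  by rewrite dvdzE gtnNdvd.
have /dvdzP[u eu] := px; have /dvdzP[v ev] := py.
have h : p%:Z * (p%:Z * (u ^+ 2 + 3 * v ^+ 2) - 1) = 0.
  by rewrite mulrBr mulr1 {3}pxy eu ev; ring.
move/eqP: h; rewrite mulf_eq0 (negPf p0) /= subr_eq0 => /eqP h.
have : (p%:Z %| 1)%Z by apply/dvdzP; exists (u ^+ 2 + 3 * v ^+ 2); rewrite mulrC h.
by rewrite dvdzE /= dvdn1 => /eqP e; move: p_gt3; rewrite e.
Qed.

Let x0 : x%:~R != 0 :> F. Proof. exact: (dvdz_intr_neq0 F x_unit). Qed.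
Let X0 : X != 0. Proof. exact: expf_neq0. Qed.
Let pX' : pint X^-1.
Proof. by rewrite -exprVn; apply: pintX => //; apply: pintV_int => //; exact: x_unit. Qed.
Let pX : pint X. Proof. by apply: pintX => //; exact: pint_int. Qed.

Let v := wallis F (2 * m).
Let h := harm F (3 * m).
Let d := harm2 F (2 * m).
Let pE2 : p = (2 * (3 * m)).+1. Proof. by rewrite pE mulnA. Qed.
Let pv : pint v. Proof. by apply: (pint_wallis F p_prime p_gt3 pE2); lia. Qed.
Let pv' : pint v^-1. Proof. by apply: (pint_wallisV F p_prime p_gt3 pE2); lia. Qed.
Let v0 : v != 0. Proof. exact: wallis_neq0. Qed.
Let ph : pint h. Proof. by apply: (pint_harm F p_prime p_gt3 pE2); lia. Qed.
Let pd : pint d. Proof. by apply: (pint_harm2 F p_prime p_gt3 pE2); lia. Qed.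

Let i8 : pint 8^-1.
Proof. by rewrite (_ : 8 = 2 * 2 * 2) ?invfM; [pin | ring]. Qed.
Let U : F := (jacobi_int p (3 * m) (2 * m))%:~R / 8.
Let E1 : F := texp p (- (1 / 3) * h) (- (1 / 3) * d).
Let pU : pint U. Proof. by apply: pintM => //; exact: pint_int. Qed.

Lemma U_val : cg 3 U (- v * E1).
Proof. exact: (jacobi_value F p_prime p_gt3 pE). Qed.

Let LE : lg p E1 (- (1 / 3) * h) (- (1 / 3) * d).
Proof. by split; [pin | pin | exact: cg_refl]. Qed.

(** The logarithm in [sum1_6m1] is twice the one in [jacobi_value]. *)
Lemma sum1_U (eps : bool) : cg 3 (sum1 (2 * eps%:R - 1) p) (U ^+ 2).
Proof.
apply: (cg_trans p_prime (sum1_6m1 F p_prime p_gt3 pE eps)); rewrite -/v -/h -/d.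
apply: cg_sym => //; rewrite expr2.
apply: (@cg_trans _ _ p_prime _ _ ((- v * E1) * (- v * E1))).
  by apply: cgM => //; [have := lg_pint p_prime p_gt3 LE => ?; pin | exact: U_val | exact: U_val].
have -> : - v * E1 * (- v * E1) = v ^+ 2 * (E1 * E1) by ring.
apply: cgMl => //; first by pin.
have [_ _ L] := lgM p_prime p_gt3 LE LE.
apply: (cg_trans p_prime L); apply: cg_eq => //.
by congr (texp _ _ _); field.
Qed.

(** [jacobi_root_6m1] leaves the sign of the trace open; squaring removes it. *)
Lemma U_root : cg 3 (U ^+ 2 * U ^+ 2 + 2 * P * U ^+ 2 + P ^+ 2) (4 * X * U ^+ 2).
Proof.
have [A A2 /dvdzP[k ek]] := jacobi_root_6m1 p_prime p_gt3 pE pxy.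
have e : U ^+ 2 - A%:~R * U + P = P ^+ 3 * (k%:~R * (8^-1 * 8^-1)).
  have := congr1 (fun z : int => z%:~R : F) ek; rewrite /U.
  set I := jacobi_int _ _ _ => e1.
  have -> : P ^+ 3 * (k%:~R * (8^-1 * 8^-1)) = (k * p%:Z ^+ 3)%:~R / 64 :> F.
    by rewrite rmorphM rmorphXn /=; field.
  by rewrite -e1; field.
have {}A2 : A%:~R ^+ 2 = 4 * X.
  by have := congr1 (fun z : int => z%:~R : F) A2 => /= e2; transitivity ((A ^+ 2)%:~R : F); [ring | rewrite e2; ring].
have pA : pint A%:~R by apply: pint_int.
have pk : pint k%:~R by apply: pint_int.
apply: (@cg_intro _ _ _ ((k%:~R * (8^-1 * 8^-1)) * (U ^+ 2 + A%:~R * U + P))); first by pin.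
have -> : P ^+ 3 * ((k%:~R * (8^-1 * 8^-1)) * (U ^+ 2 + A%:~R * U + P))
  = (P ^+ 3 * (k%:~R * (8^-1 * 8^-1))) * (U ^+ 2 + A%:~R * U + P) by ring.
by rewrite -e -A2; ring.
Qed.

Lemma U_unit : U != 0 /\ pint U^-1.
Proof.
have [E0 pE'] := lg_unit p_prime p_gt3 LE.
have [c pc /eqP] := U_val; rewrite subr_eq => /eqP e.
have pcv : pint (- (P ^+ 2 * c * v^-1 * E1^-1)) by pin.
have [u0 pu] := pint_unit1 pcv.
have eU : U = - v * E1 * (1 + P * - (P ^+ 2 * c * v^-1 * E1^-1)) by rewrite e; fld.
split; first by rewrite eU mulf_neq0 // mulf_neq0 // oppr_eq0.
by rewrite eU 2!invfM invrN; pin.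
Qed.

Lemma U_sq1 : cg 1 (U ^+ 2) (4 * X).
Proof.
have [u0 pu] := U_unit; have [c pc /eqP] := U_root; rewrite subr_eq => /eqP e.
apply: (@cg_intro _ _ _ ((P ^+ 2 * c - 2 * U ^+ 2 - P) * (U^-1 * U^-1))); first by pin.
transitivity ((U ^+ 2 * U ^+ 2 + 2 * P * U ^+ 2 + P ^+ 2 - 2 * P * U ^+ 2 - P ^+ 2) * (U^-1 * U^-1)).
  by fld.
by rewrite e; fld.
Qed.

Let i4 : pint 4^-1.
Proof. by rewrite (_ : 4 = 2 * 2) ?invfM; [pin | ring]. Qed.

(** Divide [U_root] by U^2 and insert [U_sq1] in the term of order p^2. *)
Lemma U_sq3 : cg 3 (U ^+ 2) (4 * X - 2 * P - P ^+ 2 / (4 * X)).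
Proof.
have [u0 pu] := U_unit; have [c pc /eqP] := U_root; rewrite subr_eq => /eqP e.
have [c1 pc1 /eqP] := U_sq1; rewrite subr_eq => /eqP e1.
apply: (@cg_intro _ _ _ (c * (U^-1 * U^-1) + c1 * (U^-1 * U^-1) * (4^-1 * X^-1))); first by pin.
transitivity ((U ^+ 2 * U ^+ 2 + 2 * P * U ^+ 2 + P ^+ 2 - 2 * P * U ^+ 2 - P ^+ 2) * (U^-1 * U^-1)).
  by fld.
rewrite e; apply/eqP; rewrite -subr_eq0; apply/eqP.
transitivity (P ^+ 2 * (U^-1 * U^-1) * (4^-1 * X^-1) * (U ^+ 2 - (P ^+ 1 * c1 + 4 * X))).
  by fld.
by rewrite {1}e1 subrr mulr0.
Qed.

(** To leading order [U_val] gives w^2 = U^2 = 4 x^2. *)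
Lemma sum2_X (eps : bool) : cg 3 (sum2 (2 * eps%:R - 1) p) (P ^+ 2 * (2 - 3 * eps%:R) / (4 * X)).
Proof.
apply: (cg_trans p_prime (sum2_6m1 F p_prime p_gt3 pE eps)); rewrite -/v.
have [c1 pc1 /eqP] := U_sq1; rewrite subr_eq => /eqP e1.
have [c2 pc2 /eqP] := U_val; rewrite subr_eq => /eqP e2.
have pe : pint (eps%:R : F) by apply: pint_nat.
pose w : F := - (1 / 3) * h + P * ((- (1 / 3) * h) ^+ 2 / 2 + - (1 / 3) * d).
have pw : pint w by rewrite /w; pin.
have eE : E1 = 1 + P * w by rewrite /E1 /texp /w; ring.
have ev : v ^+ 2 = 4 * X + P * (c1 - (P ^+ 4 * (P * c2 ^+ 2) - 2 * P ^+ 2 * c2 * v * E1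
    + v ^+ 2 * (2 * w + P * w ^+ 2))).
  transitivity (U ^+ 2 - P * (P ^+ 4 * (P * c2 ^+ 2) - 2 * P ^+ 2 * c2 * v * E1
    + v ^+ 2 * (2 * w + P * w ^+ 2))); last by rewrite e1; ring.
  by rewrite e2 eE; ring.
set g := c1 - _ in ev.
have pE1 := lg_pint p_prime p_gt3 LE.
have pg : pint g by rewrite /g; pin.
apply: (@cg_intro _ _ _ (- (2 - 3 * eps%:R) * g * (v^-1 * v^-1) * (4^-1 * X^-1))); first by pin.
apply/eqP; rewrite -subr_eq0; apply/eqP.
transitivity (P ^+ 2 * (2 - 3 * eps%:R) * (v^-1 * v^-1) * (4^-1 * X^-1) * (4 * X + P * g - v ^+ 2)).
  by fld.
by rewrite -ev subrr mulr0.
Qed.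

Lemma case_one4 : cg 3 (cube_sum 4) (- (64 / 45) * X + 32 / 45 * P + 43 * P ^+ 2 / (90 * X)).
Proof.
apply: (cg_trans p_prime cube_sum4).
have [c1 pc1 /eqP] := sum2_X false; rewrite subr_eq sign_false mulr0n => /eqP ->.
have [c2 pc2 /eqP] := cg_trans p_prime (sum1_U false) U_sq3; rewrite subr_eq sign_false => /eqP ->.
apply: (@cg_intro _ _ _ (7 / 3 * ((P + 1 / 3) * c1 + 2 * (4^-1 * X^-1))
   - 16 * (5^-1 * 3^-1 * 3^-1) * c2)); first by pin.
by fld.
Qed.

Lemma case_one16 : cg 3 (cube_sum 16) (4 / 45 * X - 2 / 45 * P + P ^+ 2 / (45 * X)).
Proof.
apply: (cg_trans p_prime cube_sum16).
have [c1 pc1 /eqP] := sum2_X true; rewrite subr_eq sign_true mulr1n => /eqP ->.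
have [c2 pc2 /eqP] := cg_trans p_prime (sum1_U true) U_sq3; rewrite subr_eq sign_true => /eqP ->.
apply: (@cg_intro _ _ _ (1 / 3 * ((P - 1 / 3) * c1 - (4^-1 * X^-1))
   + 1 * (5^-1 * 3^-1 * 3^-1) * c2)); first by pin.
by fld.
Qed.

End One.

Section Two.

Variable m : nat.
Hypothesis pE : p = (6 * m + 5)%N.
Let B : F := 'C(3 * m + 2, m)%:R.
Let R := R3F F p m.
Let pB : pint B. Proof. exact: pint_nat. Qed.

(** By Fermat, seen through [harm_fermat2] and [harm_fermat3], the corrections in R3
    are divisible by p. *)
Lemma R3F_mod : cg 1 R (B ^+ 2).
Proof.
have pE2 : p = (2 * (3 * m + 2)).+1 by rewrite pE; lia.
have n_lt : (3 * m + 2 < p)%N by lia.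
have q_lt : (2 * m + 1 < p)%N by lia.
have p1 := pint_harm F p_prime p_gt3 pE2 n_lt.
have p2 := pint_harm F p_prime p_gt3 pE2 q_lt.
have [c1 pc1] := harm_fermat2 F p_prime p_gt3 pE; have [c2 pc2] := harm_fermat3 F p_prime p_gt3 pE.
move=> e2 e1.
apply: (@cg_intro _ _ _ ((2 + (P * c1 - harm F (3 * m + 2)) * (- 2 / 3) * (- 1)
   + harm F (2 * m + 1) - P * c2) * B ^+ 2)); first by pin.
rewrite /R /R3F -/B.
have -> : 4 / 3 * (2 ^+ p.-1 - 1) = 2 / 3 * (P ^+ 2 * c1) - 2 / 3 * (P * harm F (3 * m + 2)) :> F.
  by rewrite -e1; field.
have -> : 3 / 2 * (3 ^+ p.-1 - 1) = P ^+ 2 * c2 - P * harm F (2 * m + 1) :> F.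
  by rewrite -e2; field.
by field.
Qed.

Lemma pint_R : pint R.
Proof. by apply: (cg_pint p_prime R3F_mod); pin. Qed.

Lemma case_two4 : cg 2 (cube_sum 4) (28 / 9 * R).
Proof.
have pR := pint_R.
apply: (cg_trans p_prime (cg_weak p_prime (isT : (2 <= 3)%N) cube_sum4)).
have [c1 pc1 /eqP] := sum1_6m5 F p_prime p_gt3 pE false; rewrite subr_eq sign_false => /eqP ->.
have [c2 pc2 /eqP] := sum2_6m5 F p_prime p_gt3 pE false; rewrite subr_eq sign_false mulr0n -/R -/B => /eqP ->.
have [c3 pc3 /eqP] := R3F_mod; rewrite subr_eq => /eqP e3.
apply: (@cg_intro _ _ _ (7 / 3 * ((P + 1 / 3) * c2 + 4 * (c3 - 3 * B ^+ 2))
   - 16 * (5^-1 * 3^-1 * 3^-1) * c1)); first by pin.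
apply/eqP; rewrite -subr_eq0; apply/eqP.
transitivity (28 / 3 * P * (R - (P ^+ 1 * c3 + B ^+ 2))); first by field.
by rewrite {1}e3 subrr mulr0.
Qed.

Lemma case_two16 : cg 2 (cube_sum 16) (- (4 / 9) * R).
Proof.
have pR := pint_R.
apply: (cg_trans p_prime (cg_weak p_prime (isT : (2 <= 3)%N) cube_sum16)).
have [c1 pc1 /eqP] := sum1_6m5 F p_prime p_gt3 pE true; rewrite subr_eq sign_true => /eqP ->.
have [c2 pc2 /eqP] := sum2_6m5 F p_prime p_gt3 pE true; rewrite subr_eq sign_true mulr1n -/R -/B => /eqP ->.
have [c3 pc3 /eqP] := R3F_mod; rewrite subr_eq => /eqP e3.
apply: (@cg_intro _ _ _ (1 / 3 * ((P - 1 / 3) * c2 + 4 * (c3 + 3 * B ^+ 2))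
   + 1 * (5^-1 * 3^-1 * 3^-1) * c1)); first by pin.
apply/eqP; rewrite -subr_eq0; apply/eqP.
transitivity (4 / 3 * P * (R - (P ^+ 1 * c3 + B ^+ 2))); first by field.
by rewrite {1}e3 subrr mulr0.
Qed.

End Two.

End Assembly.

Lemma cg_cong_rat p n (a b : rat) : cg p n a b -> cong_rat p n a b.
Proof. by move=> [c [r [s [ps ->]]] e]; exists r, s; split; rewrite // -mulrA. Qed.

Lemma prime_gt3_odd p : prime p -> (3 < p)%N -> odd p.
Proof. by move=> pp p3; case: (even_prime pp) => // e; move: p3; rewrite e. Qed.

Theorem theorem1 (p : nat) (p_prime : prime p) (p_gt3 : (3 < p)%N) :
  ((p = 1 %[mod 3] ->
      forall x y : int, p%:Z = x ^+ 2 + 3 * y ^+ 2 ->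
      domb_cube_sum p 4
        ≡ - (64 / 45) * x%:~R ^+ 2 + 32 / 45 * p%:R
          + 43 * p%:R ^+ 2 / (90 * x%:~R ^+ 2) [rmod p ^ 3])
   /\ (p = 2 %[mod 3] -> p != 5%N ->
      domb_cube_sum p 4 ≡ 28 / 9 * R3 p [rmod p ^ 2]))
  /\
  ((p = 1 %[mod 3] ->
      forall x y : int, p%:Z = x ^+ 2 + 3 * y ^+ 2 ->
      domb_cube_sum p 16
        ≡ 4 / 45 * x%:~R ^+ 2 - 2 / 45 * p%:R
          + p%:R ^+ 2 / (45 * x%:~R ^+ 2) [rmod p ^ 3])
   /\ (p = 2 %[mod 3] -> p != 5%N ->
      domb_cube_sum p 16 ≡ - (4 / 9) * R3 p [rmod p ^ 2])).
Proof.
have p_odd := prime_gt3_odd p_prime p_gt3.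
have one : p = 1 %[mod 3] -> exists2 m, p = (6 * m).+1 & p != 5.
  move=> h; exists (p %/ 6)%N; last by apply/eqP => e; rewrite e in h.
  by move: h p_odd; lia.
have two : p = 2 %[mod 3] -> p = (6 * (p %/ 6)%N + 5)%N.
  by move: p_odd; lia.
have R3E : p = (6 * (p %/ 6)%N + 5)%N -> R3 p = R3F rat p (p %/ 6)%N.
  by move=> e; rewrite /R3 /R3F (_ : p.-1./2 = 3 * (p %/ 6)%N + 2)%N //; lia.
split; split.
- move=> /one[m pE p5] x y pxy; apply: cg_cong_rat.
  exact: (case_one4 rat p_prime p_gt3 p5 pE pxy).
- move=> /two pE p5; rewrite (R3E pE); apply: cg_cong_rat.
  exact: (case_two4 rat p_prime p_gt3 p5 pE).
- move=> /one[m pE p5] x y pxy; apply: cg_cong_rat.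
  exact: (case_one16 rat p_prime p_gt3 p5 pE pxy).
- move=> /two pE p5; rewrite (R3E pE); apply: cg_cong_rat.
  exact: (case_two16 rat p_prime p_gt3 p5 pE).
Qed.
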